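(* Fix a deterministic constant $\Gamma>0$, real numbers $\lambda_\pm^*$, a probability measure $q\in M_1([\lambda_-^*,\lambda_+^*])$, and a sequence $\{W_n\}\in\mathcal W_{\lambda_\pm^*,q}$. Let $\mathbb P^{W,H,n}_\Gamma$ denote the law, conditioned on $W_n$, of $F_n^{W_n,\widetilde{\mathbf h}}$ when $\widetilde{\mathbf h}$ is independent of $W_n$ and Haar (uniformly) distributed on $\sqrt\Gamma\,S^{n-1}$, and let $\mathbb P^{W,G,n}_\Gamma$ denote the law, conditioned on $W_n$, of $F_n^{W_n,\widetilde{\mathbf g}}$ when $\widetilde{\mathbf g}$ is independent of $W_n$ and centered multivariate normal of covariance $\frac{\Gamma}{n}\mathbf I_n$. (a) The sequence $\{\mathbb P^{W,H,n}_\Gamma\}_{n\ge1}$ satisfies the large deviation principle (LDP) on $\mathbb R$ with speed $n$ and good rate function $I^H_q(m;\lambda^*_\pm,\Gamma)$. (b) The sequence $\{\mathbb P^{W,G,n}_\Gamma\}_{n\ge1}$ satisfies the LDP on $\mathbb R$ with speed $n$ and good rate function $I^G_q(m;\lambda^*_\pm,\Gamma)$.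
   Context: For a real symmetric $n\times n$ matrix $W$ and $\mathbf h\in\mathbb R^n$, $F_n^{W,\mathbf h}=\sup_{\mathbf x\in S^{n-1}}\big(\frac12\mathbf x^TW\mathbf x+\mathbf h^T\mathbf x\big)$, where $S^{n-1}$ is the unit sphere in $\mathbb R^n$. $\mathcal W_{\lambda_\pm^*,q}$ is the collection of all sequences $\{W_n\}$ of (random or deterministic) symmetric real $n\times n$ matrices whose ordered eigenvalues $\lambda_1(n)\ge\dots\ge\lambda_n(n)$ satisfy, as $n\to\infty$: $\frac1n\sum_{j=1}^n\delta_{\lambda_j(n)}\to q$ weakly in $M_1(\mathbb R)$; $\lambda_1(n)\to\lambda_+^*$; $\lambda_n(n)\to\lambda_-^*$. (If the $W_n$ are random, these convergences are understood almost surely, and the conclusion is for almost every realization of $\{W_n\}$.) $M_+(J)$, $M_1(J)$ are the finite Borel measures, respectively the probability measures, on $J\subseteq\mathbb R$. For $\nu\in M_+((-\infty,\xi])$, $F(\xi,\nu;\Gamma)=\frac12\inf_{\theta>\xi}\big[\theta+\Gamma\int\frac{\nu(dx)}{\theta-x}\big]$. For a probability measure $\mu$ and finite measure $\nu$, $H(\mu|\nu)=\int d\mu\log\frac{d\mu}{d\nu}+\nu(\mathbb R)-1$ if $\mu\ll\nu$, and $\infty$ otherwise. The rate functions are $$I^H_q(m;\lambda^*_\pm,\Gamma)=\inf\{\tfrac12H(q|\nu):\nu\in M_1([\lambda_-^*,\lambda_+^*]),\ m=F(\lambda_+^*,\nu;\Gamma)\},$$ $$I^G_q(m;\lambda^*_\pm,\Gamma)=\inf\{\tfrac12H(q|\nu):\nu\in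 M_+([\lambda_-^*,\lambda_+^*]),\ m=F(\lambda_+^*,\nu;\Gamma)\},$$ with the infimum over the empty set equal to $+\infty$. *)

(* Defs.v *)
From HB Require Import structures.
From mathcomp Require Import all_boot all_order all_algebra.
From mathcomp Require Import all_classical all_reals all_analysis.

Set Implicit Arguments.
Unset Strict Implicit.
Unset Printing Implicit Defensive.

Import Order.TTheory GRing.Theory Num.Theory.
Import numFieldNormedType.Exports.

Local Open Scope classical_set_scope.
Local Open Scope ring_scope.

(* Matrices (in particular column vectors) with their Borel sigma-algebra. *)
Notation borel_mx R m n := (g_sigma_algebraType (@open 'M[R]_(m, n))).

(* The library's norm on matrices is the sup norm, hence this definition. *)
Definition euclidean_norm {R : realType} {n : nat} (x : 'cV[R]_n) : R :=
  Num.sqrt (\sum_(i < n) x i ord0 ^+ 2).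

Definition sphere (R : realType) (n : nat) (r : R) : set 'cV[R]_n :=
  [set x | euclidean_norm x = r].
Arguments sphere {R} n r.

(* A real supremum: for 0 < n the set below is nonempty and bounded. *)
Definition max_quad {R : realType} {n : nat} (W : 'M[R]_n) (h : 'cV[R]_n) : R :=
  sup [set 2^-1 * (x^T *m W *m x) ord0 ord0 + (h^T *m x) ord0 ord0
      | x in sphere n 1].

(* lam lists the eigenvalues of W, with multiplicity, in nonincreasing order. *)
Definition ordered_eigenvalues {R : realType} {n : nat}
    (W : 'M[R]_n) (lam : n.-tuple R) : Prop :=
  sorted (fun a b => b <= a) lam /\
  char_poly W = \prod_(a <- lam) ('X - a%:P).

Definition empirical_measure {R : realType} (n : nat) (lam : n.+1.-tuple R) :
    {measure set (measurableTypeR R) -> \bar R} :=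
  mscale (n.+1%:R^-1)%:nng
    (msum (fun j => \d_((nth 0 lam j) : measurableTypeR R)) n.+1).

Definition weak_cvg {R : realType}
    (mu : nat -> {measure set (measurableTypeR R) -> \bar R})
    (nu : {measure set (measurableTypeR R) -> \bar R}) : Prop :=
  forall f : R -> R, continuous f -> (exists C : R, forall x, `|f x| <= C) ->
    (\int[mu n]_x (f x)%:E)%E @[n --> \oo] --> (\int[nu]_x (f x)%:E)%E.

(* The n-th term of the sequences below has dimension n.+1, so that the
   sequences range over all dimensions >= 1. *)
Definition spectral_class {R : realType} (lamm lamp : R)
    (q : probability (measurableTypeR R) R)
    (W : forall n : nat, 'M[R]_n.+1) : Prop :=
  (forall n, (W n)^T = W n) /\
  exists lam : forall n, n.+1.-tuple R,
    [/\ forall n, ordered_eigenvalues (W n) (lam n),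
        weak_cvg (fun n => empirical_measure (lam n)) q,
        tnth (lam n) ord0 @[n --> \oo] --> lamp
      & tnth (lam n) ord_max @[n --> \oo] --> lamm].

(* M_1(J) and M_+(J) are represented by the probability, resp. finite, Borel
   measures on R that are concentrated on J. *)
Definition concentrated_on {R : realType}
    (mu : {measure set (measurableTypeR R) -> \bar R}) (J : set R) : Prop :=
  mu (~` J) = 0%E.

Definition Fvar {R : realType} (xi : R)
    (nu : {measure set (measurableTypeR R) -> \bar R}) (Gamma : R) : \bar R :=
  ((2^-1)%:E * ereal_inf
    [set theta%:E +
         Gamma%:E * \int[nu]_(x in `]-oo, xi]) ((theta - x)^-1)%:E
    | theta in `]xi, +oo[])%E.

Definition rel_entropy {R : realType}
    (mu : probability (measurableTypeR R) R)
    (nu : {finite_measure set (measurableTypeR R) -> \bar R}) : \bar R :=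
  if `[< mu `<< nu >] then
    (\int[mu]_x lne (Radon_Nikodym (charge_of_finite_measure mu) nu x)
     + nu setT - 1)%E
  else +oo%E.

Definition rate_H {R : realType} (lamm lamp Gamma : R)
    (q : probability (measurableTypeR R) R) (m : R) : \bar R :=
  ereal_inf [set ((2^-1)%:E * rel_entropy q nu)%E
    | nu in [set nu : probability (measurableTypeR R) R |
              concentrated_on nu `[lamm, lamp] /\ m%:E = Fvar lamp nu Gamma]].

Definition rate_G {R : realType} (lamm lamp Gamma : R)
    (q : probability (measurableTypeR R) R) (m : R) : \bar R :=
  ereal_inf [set ((2^-1)%:E * rel_entropy q nu)%E
    | nu in [set nu : {finite_measure set (measurableTypeR R) -> \bar R} |
              concentrated_on nu `[lamm, lamp] /\ m%:E = Fvar lamp nu Gamma]].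

Definition good_rate_function {R : realType} (I : R -> \bar R) : Prop :=
  [/\ forall x, (0 <= I x)%E,
      lower_semicontinuous I
    & forall a : R, compact [set x | (I x <= a%:E)%E]].

Definition LDP_good {R : realType} (speed : nat -> R)
    (mu : nat -> {measure set (measurableTypeR R) -> \bar R})
    (I : R -> \bar R) : Prop :=
  good_rate_function I /\
  forall B : set (measurableTypeR R), measurable B ->
    ((- ereal_inf (I @` interior (B : set R))
       <= limn_einf (fun n => ((speed n)^-1)%:E * lne (mu n B)))%E
     /\ (limn_esup (fun n => ((speed n)^-1)%:E * lne (mu n B))
       <= - ereal_inf (I @` closure (B : set R)))%E).

Definition independent_RVs d d1 d2 {T : measurableType d}
    {T1 : measurableType d1} {T2 : measurableType d2} {R : realType}
    (P : probability T R) (X : {RV P >-> T1}) (Y : {RV P >-> T2}) : Prop :=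
  forall A B, measurable A -> measurable B ->
    P (X @^-1` A `&` Y @^-1` B) = (P (X @^-1` A) * P (Y @^-1` B))%E.

(* kappa is a version of the (regular) conditional law of Y given X. *)
Definition conditional_law d d1 d2 {T : measurableType d}
    {T1 : measurableType d1} {T2 : measurableType d2} {R : realType}
    (P : probability T R) (X : {RV P >-> T1}) (Y : T -> T2)
    (kappa : R.-pker T1 ~> T2) : Prop :=
  forall A B, measurable A -> measurable B ->
    P (X @^-1` A `&` Y @^-1` B) = (\int[distribution P X]_(x in A) kappa x B)%E.

(* Haar law on r S^(n-1): the rotation-invariant probability on the sphere. *)
Definition haar_sphere {R : realType} {n : nat} (r : R)
    (mu : probability (borel_mx R n 1) R) : Prop :=
  mu (~` sphere n r) = 0%E /\
  forall U : 'M[R]_n, U^T *m U = 1%:M ->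
    forall B : set (borel_mx R n 1), measurable B ->
      mu [set x : 'cV[R]_n | B (U *m x)] = mu B.

(* N(0, I_n): independent N(0, 1) coordinates. *)
Definition standard_normal {R : realType} {n : nat}
    (mu : probability (borel_mx R n 1) R) : Prop :=
  forall B : 'I_n -> set (measurableTypeR R), (forall i, measurable (B i)) ->
    mu [set x : 'cV[R]_n | forall i, B i (x i ord0)] =
    (\prod_(i < n) normal_prob 0 1 (B i))%E.

(* N(0, S): the law of A z with A A^T = S and z of law N(0, I_n). *)
Definition centered_normal {R : realType} {n : nat} (S : 'M[R]_n)
    (mu : probability (borel_mx R n 1) R) : Prop :=
  exists (A : 'M[R]_n) (gamma : probability (borel_mx R n 1) R),
    [/\ A *m A^T = S, standard_normal gamma
      & forall B : set (borel_mx R n 1), measurable B ->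
          mu B = gamma [set z : 'cV[R]_n | B (A *m z)]].

(* Main.v *)
(** After diagonalisation and by rotation invariance, both random fields are
images of a standard Gaussian vector z, and Lagrangian duality gives
max_quad = 1/2 inf_(theta > lamp) [theta + k \sum_i z_i^2 / (theta - l_i)],
with k = Gamma / |z|^2 (Haar) or Gamma / n (Gaussian). Hence one needs the large
deviations of the quadratic forms \sum_i f(l_i) z_i^2.

Upper bounds: the sublevel set {rate <= a} is an interval, and by one-dimensional
minimax and convex duality a value outside of it is separated by a half-space,
whose probability is bounded by the exponential Markov inequality.

Lower bounds: the measures r q + a delta_lamm + b delta_lamp with r continuous and
positive suffice. Such a measure is reached by giving z_i the variance r(l_i) and
by forcing the first and the last coordinates, of eigenvalues close to lamp and
lamm, to carry the masses b n and a n. *)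

Require Import Defs.
From HB Require Import structures.
From mathcomp Require Import all_boot all_order all_algebra ring lra.
From mathcomp Require Import all_classical all_reals all_analysis measurable_realfun.

Set Implicit Arguments.
Unset Strict Implicit.
Unset Printing Implicit Defensive.

Import Order.TTheory GRing.Theory Num.Theory.
Import numFieldNormedType.Exports.

Local Open Scope classical_set_scope.
Local Open Scope ring_scope.

(** * Real functions *)

(** The rate functions are infima over measures of a functional that is itself an infimum over
    [theta], hence not linear in the measure. No topology on measures is used: the convex analysis
    takes place on triples (density, two atoms) seen through an abstract mean [E] on bounded
    continuous functions, and the sets {rate <= a} are only located between intervals [[Fmin],
    [Fmax]] at neighbouring levels, which suffices for goodness and for both bounds. Atoms are what
    makes duality exact: beyond the critical tilt, extra mass can only be placed where the test
    function is maximal, and for plus or minus a resolvent this is an edge. The two tails are not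
    symmetric: a large infimum constrains every [theta], so one [theta] good for all measures is
    found by minimax; a small infimum concerns some unknown [theta] and requires a finite grid and a
    union bound. In the Haar case the random factor 1 / |z|^2 is removed by writing the constraint
    homogeneously. Conditioning on [W] is settled outside of one null set, where the kernels are
    explicit image laws; the rest concerns a deterministic sequence. *)

Section real_lemmas.
Context {R : realType}.
Implicit Types (x y c : R) (f g : R -> R).

Lemma ln_le_sub1 x : 0 < x -> ln x <= x - 1.
Proof.
move=> x0; have := @le_ln1Dx R (x - 1).
have -> : 1 + (x - 1) = x by ring.
by apply; lra.
Qed.

(** The tangent of [ln] at the combination [m] lies above the graph; the two tangent inequalities
    are averaged. *)
Lemma ln_concave (t x y : R) : 0 <= t <= 1 -> 0 < x -> 0 < y ->
  (1 - t) * ln x + t * ln y <= ln ((1 - t) * x + t * y).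
Proof.
move=> /andP[t0 t1] x0 y0.
have m0 : 0 < (1 - t) * x + t * y.
  have [->|tn0] := eqVneq t 0; first lra.
  have tp : 0 < t by rewrite lt_def tn0.
  have : 0 < t * y by rewrite mulr_gt0.
  have : 0 <= (1 - t) * x by rewrite mulr_ge0 ?subr_ge0 // ltW.
  by lra.
set m := (1 - t) * x + t * y in m0 *.
have key (z : R) : 0 < z -> ln z <= ln m + (z / m - 1).
  move=> z0; have := @ln_le_sub1 (z / m); rewrite divr_gt0// => /(_ isT).
  by rewrite ln_div ?posrE//; lra.
have e : (1 - t) * (x / m - 1) + t * (y / m - 1) = 0.
  have -> : (1 - t) * (x / m - 1) + t * (y / m - 1) = m / m - 1.
    by rewrite /m; ring.
  by rewrite divff ?subrr// gt_eqF.
have := ler_wpM2l (_ : 0 <= 1 - t) (key _ x0); rewrite subr_ge0 => /(_ t1).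
have := ler_wpM2l t0 (key _ y0).
by move: e; set a := x / m; set b := y / m; lra.
Qed.

(** The graph of the concave function lies above its chord between 0 and [b]. *)
Lemma ln1D_ge (s b z : R) : 0 <= s -> 0 <= z <= b -> 0 < b ->
  z / b * ln (1 + s * b) <= ln (1 + s * z).
Proof.
move=> s0 /andP[z0 zb] b0.
have sb : 0 <= s * b by rewrite mulr_ge0 // ltW.
have zb1 : 0 <= z / b <= 1.
  by rewrite divr_ge0 ?(ltW b0)//= ler_pdivrMr// mul1r.
have := @ln_concave (z / b) 1 (1 + s * b) zb1 ltr01 ltac:(lra).
rewrite ln1 mulr0 add0r.
suff -> : (1 - z / b) * 1 + z / b * (1 + s * b) = 1 + s * z by [].
by field; rewrite gt_eqF.
Qed.

Lemma cvg_sumr (T : Type) (F : set_system T) (I : Type) (r : seq I) (g : I -> T -> R)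
    (a : I -> R) : Filter F ->
  (forall i, g i x @[x --> F] --> a i) ->
  \sum_(i <- r) g i x @[x --> F] --> \sum_(i <- r) a i.
Proof.
move=> FF ga; elim: r => [|i r IH].
  by rewrite big_nil; under eq_fun do rewrite big_nil; exact: cvg_cst.
by rewrite big_cons; under eq_fun do rewrite big_cons; exact: cvgD.
Qed.

Lemma cvg_sqr (T : Type) (F : set_system T) (g : T -> R) (a : R) : Filter F ->
  g x @[x --> F] --> a -> g x ^+ 2 @[x --> F] --> a ^+ 2.
Proof.
by move=> FF ga; rewrite expr2; under eq_fun do rewrite expr2; exact: cvgM.
Qed.

(** Nothing is known about [f] outside of the segment, so [f] is composed with the truncation [p] to
    make it continuous on the whole line. *)
Lemma uniform_IVT f (a b v : R) : a <= b ->
  (forall e, 0 < e -> exists2 d, 0 < d & forall x y, a <= x <= b -> a <= y <= b ->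
     `|x - y| < d -> `|f x - f y| < e) ->
  f a <= v <= f b -> exists2 c, a <= c <= b & f c = v.
Proof.
move=> ab fu fv.
pose p x := Num.max a (Num.min x b).
have pab x : a <= p x <= b.
  by rewrite /p le_max lexx/= ge_max ab/= ge_min lexx orbT.
have pl x y : `|p x - p y| <= `|x - y|.
  rewrite /p !minEle !maxEle; have [|] := ler0P (x - y);
  repeat case: ifP => /=; move=> *;
  rewrite ?ler_norml ?ler0_norm ?ger0_norm; lra.
have cf : continuous (f \o p).
  move=> x; apply/cvgrPdist_lt => /= e /fu[d d0 fd].
  near=> y; apply: fd => //; apply: le_lt_trans (pl _ _) _.
  by near: y; exact: (nbhsx_ballx x d d0).
have pa : p a = a by rewrite /p min_l// max_l.
have pb : p b = b by rewrite /p min_r// max_r.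
have [c _ fc] := @IVT R (f \o p) a b v ab
  (continuous_subspaceT cf) ltac:(rewrite /= pa pb; case/andP: fv => v1 v2;
  by rewrite ge_min v1/= le_max v2 orbT).
by exists (p c).
Unshelve. all: by end_near. Qed.

End real_lemmas.

(** * Bounded continuous functions *)

Definition bcont {R : realType} (f : R -> R) :=
  continuous f /\ exists C : R, forall x, `|f x| <= C.
(** The uniform lower bound keeps [1 / f] and [ln f] bounded, so that densities, their inverses and
    their logarithms all stay in [bcont]. *)
Definition bpos {R : realType} (f : R -> R) :=
  bcont f /\ exists2 c : R, 0 < c & forall x, c <= f x.

Section bcont_lemmas.
Context {R : realType}.
Implicit Types (f g : R -> R).

Lemma bcont_cst (c : R) : bcont (fun=> c).
Proof. by split; [move=> x; exact: cvg_cst|exists `|c|]. Qed.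

Lemma bcontD f g : bcont f -> bcont g -> bcont (fun x => f x + g x).
Proof.
move=> [cf [C fC]] [cg [D gD]]; split; first by move=> x; apply: cvgD; [exact: cf|exact: cg].
by exists (C + D) => x; rewrite (le_trans (ler_normD _ _))// lerD.
Qed.

Lemma bcontM f g : bcont f -> bcont g -> bcont (fun x => f x * g x).
Proof.
move=> [cf [C fC]] [cg [D gD]]; split; first by move=> x; apply: cvgM; [exact: cf|exact: cg].
by exists (C * D) => x; rewrite normrM ler_pM.
Qed.

Lemma bcontZ k f : bcont f -> bcont (fun x => k * f x).
Proof. by move=> bf; apply: bcontM => //; exact: bcont_cst. Qed.

Lemma bcontN f : bcont f -> bcont (fun x => - f x).
Proof.
move=> /(bcontZ (-1)); congr bcont; apply/funext => x; exact: mulN1r.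
Qed.

Lemma bcontB f g : bcont f -> bcont g -> bcont (fun x => f x - g x).
Proof. by move=> bf bg; apply: bcontD => //; exact: bcontN. Qed.

Lemma bpos_gt0 f x : bpos f -> 0 < f x.
Proof. by move=> [_ [c c0 cf]]; rewrite (lt_le_trans c0). Qed.

Lemma bcont_inv f : bpos f -> bcont (fun x => (f x)^-1).
Proof.
move=> bf; have f0 x := bpos_gt0 x bf.
move: bf => [[cf _] [c c0 fc]]; split.
  by move=> x; apply: cvgV; [rewrite gt_eqF|exact: cf].
exists c^-1 => x; rewrite normfV gtr0_norm// lef_pV2// posrE//.
Qed.

Lemma bpos_inv f : bpos f -> bpos (fun x => (f x)^-1).
Proof.
move=> bf; split; first exact: bcont_inv.
have f0 x := bpos_gt0 x bf; move: bf => [[_ [C fC]] _].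
have C0 : 0 < C by rewrite (lt_le_trans (f0 0))// (le_trans (ler_norm _)).
exists C^-1; first by rewrite invr_gt0.
by move=> x; rewrite lef_pV2 ?posrE// (le_trans (ler_norm _)).
Qed.

Lemma bcont_ln f : bpos f -> bcont (fun x => ln (f x)).
Proof.
move=> bf; have f0 x := bpos_gt0 x bf.
move: bf => [[cf [C fC]] [c c0 fc]]; split.
  by move=> x; apply: (continuous_comp (cf x)); exact: continuous_ln.
have fC' x : f x <= C by rewrite (le_trans (ler_norm _)).
exists (`|ln c| + `|ln C|) => x; rewrite ler_norml; apply/andP; split.
  have : ln c <= ln (f x) by rewrite ler_ln ?posrE.
  have := ler_norm (- ln c); rewrite normrN.
  have := normr_ge0 (ln C); lra.
have : ln (f x) <= ln C by rewrite ler_ln ?posrE// (lt_le_trans (f0 x)).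
have := ler_norm (ln C); have := normr_ge0 (ln c); lra.
Qed.

Lemma bposD f g : bpos f -> bcont g -> (forall x, 0 <= g x) ->
  bpos (fun x => f x + g x).
Proof.
move=> [bf [c c0 cf]] bg g0; split; first exact: bcontD.
by exists c => // x; have := cf x; have := g0 x; lra.
Qed.

Lemma bposM f g : bpos f -> bpos g -> bpos (fun x => f x * g x).
Proof.
move=> [bf [c c0 cf]] [bg [d d0 dg]]; split; first exact: bcontM.
by exists (c * d); [exact: mulr_gt0|move=> x; rewrite ler_pM// ltW].
Qed.

Lemma bposZ k f : 0 < k -> bpos f -> bpos (fun x => k * f x).
Proof.
by move=> k0; apply: bposM; split; [exact: bcont_cst|exists k].
Qed.

Lemma bpos_cst k : 0 < k -> bpos (fun=> k : R).
Proof. by move=> k0; split; [exact: bcont_cst|exists k]. Qed.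

End bcont_lemmas.

(** * Measures with explicit density and atoms at the edges *)

(** A normalised positive linear functional on bounded continuous functions; the last clause encodes
    that it is carried by the segment. All of the convex analysis sees [q] through this interface
    only. *)
Definition mean_on {R : realType} (lamm lamp : R) (E : (R -> R) -> R) :=
  [/\ forall f g, bcont f -> bcont g -> E (fun x => f x + g x) = E f + E g,
      forall k f, bcont f -> E (fun x => k * f x) = k * E f,
      E (fun=> 1) = 1
    & forall f g, bcont f -> bcont g ->
        (forall x, lamm <= x <= lamp -> f x <= g x) -> E f <= E g].

(* The measure r q + a delta_lamm + b delta_lamp, where E is integration
   against q. *)
Record nice (R : realType) := Nice { dens : R -> R; atm : R; atp : R }.

Definition valid {R : realType} (t : nice R) :=
  [/\ bpos (dens t), 0 <= atm t & 0 <= atp t].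

Definition clampK {R : realType} (lamm lamp x : R) :=
  Num.max lamm (Num.min lamp x).

(** Truncating [x] keeps [theta - x] away from 0 on the whole line, so that the resolvent belongs to
    [bcont], without changing it on the segment that carries the measures. *)
Definition resolv {R : realType} (lamm lamp theta x : R) :=
  (theta - clampK lamm lamp x)^-1.

Section nice_measures.
Context {R : realType} (lamm lamp : R) (E : (R -> R) -> R).
Hypothesis lam_le : lamm <= lamp.
Hypothesis mE : mean_on lamm lamp E.
Implicit Types (f g : R -> R) (t : nice R).

Let ED f g : bcont f -> bcont g -> E (fun x => f x + g x) = E f + E g.
Proof. by case: mE => + _ _ _; apply. Qed.
Let EZ k f : bcont f -> E (fun x => k * f x) = k * E f.
Proof. by case: mE => _ + _ _; apply. Qed.
Let E1 : E (fun=> 1) = 1.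
Proof. by case: mE. Qed.
Let Ele f g : bcont f -> bcont g ->
  (forall x, lamm <= x <= lamp -> f x <= g x) -> E f <= E g.
Proof. by case: mE => _ _ _; apply. Qed.

Lemma mean_cst k : E (fun=> k) = k.
Proof.
have := EZ k (bcont_cst 1); rewrite E1 mulr1.
by congr (E _ = _); apply/funext => x; rewrite mulr1.
Qed.

Lemma mean_ge0 f : bcont f -> (forall x, lamm <= x <= lamp -> 0 <= f x) -> 0 <= E f.
Proof. by move=> bf f0; rewrite -(mean_cst 0); apply: Ele => //; exact: bcont_cst. Qed.

Lemma meanN f : bcont f -> E (fun x => - f x) = - E f.
Proof.
move=> bf; rewrite -mulN1r -EZ//; congr E.
by apply/funext => x; rewrite mulN1r.
Qed.

Lemma meanB f g : bcont f -> bcont g -> E (fun x => f x - g x) = E f - E g.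
Proof. by move=> bf bg; rewrite ED ?meanN//; exact: bcontN. Qed.

Lemma clampK_itv x : lamm <= clampK lamm lamp x <= lamp.
Proof. by rewrite /clampK le_max lexx/= ge_max lam_le/= ge_min lexx. Qed.

Lemma clampK_id x : lamm <= x <= lamp -> clampK lamm lamp x = x.
Proof. by move=> /andP[h1 h2]; rewrite /clampK min_r// max_r. Qed.

Lemma clampK_continuous : continuous (clampK lamm lamp).
Proof.
move=> x; apply/cvgrPdist_lt => /= e e0.
near=> y; suff : `|clampK lamm lamp x - clampK lamm lamp y| <= `|x - y|.
  by move/le_lt_trans; apply; near: y; exact: (nbhsx_ballx x e e0).
rewrite /clampK !minEle !maxEle; have [|] := ler0P (x - y);
  repeat case: ifP => /=; move=> *;
  rewrite ?ler_norml ?ler0_norm ?ger0_norm; lra.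
Unshelve. all: by end_near. Qed.

Lemma bcont_clampK f : continuous f -> bcont (fun x => f (clampK lamm lamp x)).
Proof.
move=> cf; split.
  by move=> x; apply: continuous_comp; [exact: clampK_continuous|exact: cf].
have [c cab cM] := @EVT_max R (fun x => `|f x|) lamm lamp lam_le
  (continuous_subspaceT (fun x => continuous_comp (cf x) (@norm_continuous _ R^o _))).
by exists `|f c| => x; apply: cM; rewrite in_itv/= clampK_itv.
Qed.

Lemma resolv_gt0 theta x : lamp < theta -> 0 < resolv lamm lamp theta x.
Proof. by move=> lt; rewrite invr_gt0; have := clampK_itv x; lra. Qed.

Lemma resolvE theta x : lamm <= x <= lamp -> resolv lamm lamp theta x = (theta - x)^-1.
Proof. by move=> xK; rewrite /resolv clampK_id. Qed.

Lemma bpos_theta_sub theta : lamp < theta ->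
  bpos (fun x => theta - clampK lamm lamp x).
Proof.
move=> lt; split.
  apply: (@bcont_clampK (fun x => theta - x)) => x.
  by apply: cvgB; [exact: cvg_cst|exact: cvg_id].
by exists (theta - lamp); [lra|move=> x; have := clampK_itv x; lra].
Qed.

Lemma bpos_resolv theta : lamp < theta -> bpos (resolv lamm lamp theta).
Proof. by move=> /bpos_theta_sub/bpos_inv. Qed.

Lemma resolv_le_lamp theta x : lamp < theta ->
  resolv lamm lamp theta x <= resolv lamm lamp theta lamp.
Proof.
move=> lt; rewrite lef_pV2 ?posrE; have := clampK_itv x; have := clampK_itv lamp;
 rewrite (@clampK_id lamp) ?lam_le ?lexx//; lra.
Qed.

Lemma resolv_ge_lamm theta x : lamp < theta ->
  resolv lamm lamp theta lamm <= resolv lamm lamp theta x.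
Proof.
move=> lt; rewrite lef_pV2 ?posrE; have := clampK_itv x; have := clampK_itv lamm;
 rewrite (@clampK_id lamm) ?lam_le ?lexx//; lra.
Qed.

Definition tint t f := E (fun x => f x * dens t x) + atm t * f lamm + atp t * f lamp.

(** The relative entropy of [q] with respect to [t], computed as if dq/dt were [1 / dens t]. This is
    exact when [q] does not charge the atoms of [t] and an upper bound otherwise; the atoms enter
    through the total mass only. *)
Definition hcost t := tint t (fun=> 1) - 1 - E (fun x => ln (dens t x)).

Lemma valid_bdens t : valid t -> bcont (dens t).
Proof. by case=> -[]. Qed.
Lemma valid_dens_gt0 t x : valid t -> 0 < dens t x.
Proof. by case=> /(bpos_gt0 x). Qed.

Lemma tintD t f g : valid t -> bcont f -> bcont g ->
  tint t (fun x => f x + g x) = tint t f + tint t g.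
Proof.
move=> vt bf bg; rewrite /tint.
have -> : (fun x => (f x + g x) * dens t x) = (fun x => f x * dens t x + g x * dens t x).
  by apply/funext => x; rewrite mulrDl.
by rewrite ED; [ring|apply: bcontM => //; exact: valid_bdens..].
Qed.

Lemma tintZ t k f : valid t -> bcont f -> tint t (fun x => k * f x) = k * tint t f.
Proof.
move=> vt bf; rewrite /tint.
have -> : (fun x => (k * f x) * dens t x) = (fun x => k * (f x * dens t x)).
  by apply/funext => x; rewrite mulrA.
by rewrite EZ; [ring|apply: bcontM => //; exact: valid_bdens..].
Qed.

Lemma tintN t f : valid t -> bcont f -> tint t (fun x => - f x) = - tint t f.
Proof.
move=> vt bf; rewrite -mulN1r -tintZ//; congr tint.
by apply/funext => x; rewrite mulN1r.
Qed.

Lemma tint_cst t k : valid t -> tint t (fun=> k) = k * tint t (fun=> 1).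
Proof.
move=> vt; rewrite -tintZ//; last exact: bcont_cst.
by congr tint; apply/funext => x; rewrite mulr1.
Qed.

Lemma tint_le t f g : valid t -> bcont f -> bcont g ->
  (forall x, lamm <= x <= lamp -> f x <= g x) -> tint t f <= tint t g.
Proof.
move=> vt bf bg fg; have [_ a0 b0] := vt; rewrite /tint.
apply: lerD; [apply: lerD|].
- apply: Ele; [apply: bcontM => //; exact: valid_bdens..|].
  by move=> x /fg fgx; rewrite ler_wpM2r// ltW// valid_dens_gt0.
- by rewrite ler_wpM2l// fg// lexx.
- by rewrite ler_wpM2l// fg// lam_le lexx.
Qed.

Lemma tint_ge0 t f : valid t -> bcont f -> (forall x, lamm <= x <= lamp -> 0 <= f x) ->
  0 <= tint t f.
Proof.
move=> vt bf f0; rewrite (le_trans _ (@tint_le t (fun=> 0) f _ _ _ _))//.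
  by rewrite tint_cst// mul0r.
exact: bcont_cst.
Qed.

Definition mix (k : R) t1 t2 := Nice
  (fun x => (1 - k) * dens t1 x + k * dens t2 x)
  ((1 - k) * atm t1 + k * atm t2) ((1 - k) * atp t1 + k * atp t2).

Definition scale (k : R) t := Nice (fun x => k * dens t x) (k * atm t) (k * atp t).

Definition add_atoms (a b : R) t := Nice (dens t) (atm t + a) (atp t + b).

Definition base : nice R := Nice (fun=> 1) 0 0.

Lemma valid_scale k t : 0 < k -> valid t -> valid (scale k t).
Proof.
move=> k0 [r a b]; split => /=; [exact: bposZ|rewrite mulr_ge0// ltW..]; done.
Qed.

Lemma tint_scale k t f : valid t -> bcont f -> tint (scale k t) f = k * tint t f.
Proof.
move=> vt bf; rewrite /tint/=.
have -> : (fun x => f x * (k * dens t x)) = (fun x => k * (f x * dens t x)).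
  by apply/funext => x; ring.
by rewrite EZ; [ring|apply: bcontM => //; exact: valid_bdens].
Qed.

Lemma hcost_scale k t : 0 < k -> valid t ->
  hcost (scale k t) = hcost t + (k - 1) * tint t (fun=> 1) - ln k.
Proof.
move=> k0 vt; rewrite /hcost tint_scale//; last exact: bcont_cst.
have -> : (fun x => ln (dens (scale k t) x)) = (fun x => ln k + ln (dens t x)).
  by apply/funext => x/=; rewrite lnM ?posrE// valid_dens_gt0.
rewrite ED ?mean_cst; [ring|exact: bcont_cst|].
by apply: bcont_ln; case: vt.
Qed.

Lemma valid_add_atoms a b t : 0 <= a -> 0 <= b -> valid t -> valid (add_atoms a b t).
Proof. by move=> a0 b0 [r ta tb]; split => //=; rewrite addr_ge0. Qed.

Lemma tint_add_atoms a b t f :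
  tint (add_atoms a b t) f = tint t f + a * f lamm + b * f lamp.
Proof. by rewrite /tint/=; ring. Qed.

Lemma hcost_add_atoms a b t : hcost (add_atoms a b t) = hcost t + a + b.
Proof. by rewrite /hcost tint_add_atoms/=; ring. Qed.

Lemma valid_mix k t1 t2 : 0 <= k <= 1 -> valid t1 -> valid t2 -> valid (mix k t1 t2).
Proof.
move=> k01 [r1 a1 b1] [r2 a2 b2]; have k0 : 0 <= k by lra.
have k1 : 0 <= 1 - k by lra.
split => /=; [|by rewrite addr_ge0// mulr_ge0..].
have [k1'|k1'] := eqVneq k 1.
  have -> : (fun x => (1 - k) * dens t1 x + k * dens t2 x) = dens t2.
    by apply/funext => x; rewrite k1'; ring.
  exact: r2.
apply: bposD; [apply: bposZ => //; lra|by apply: bcontZ; case: r2|].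
by move=> x; rewrite mulr_ge0// ltW// bpos_gt0.
Qed.

Lemma tint_mix k t1 t2 f : valid t1 -> valid t2 -> bcont f ->
  tint (mix k t1 t2) f = (1 - k) * tint t1 f + k * tint t2 f.
Proof.
move=> v1 v2 bf; rewrite /tint/=.
have -> : (fun x => f x * ((1 - k) * dens t1 x + k * dens t2 x)) =
  (fun x => (1 - k) * (f x * dens t1 x) + k * (f x * dens t2 x)).
  by apply/funext => x; ring.
have b1 := bcontM bf (valid_bdens v1); have b2 := bcontM bf (valid_bdens v2).
by rewrite ED ?EZ//; [ring|exact: bcontZ..].
Qed.

Lemma hcost_mix k t1 t2 : 0 <= k <= 1 -> valid t1 -> valid t2 ->
  hcost (mix k t1 t2) <= (1 - k) * hcost t1 + k * hcost t2.
Proof.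
move=> k01 v1 v2; rewrite /hcost tint_mix//; last exact: bcont_cst.
have [d1 _ _] := v1; have [d2 _ _] := v2; have [dm _ _] := valid_mix k01 v1 v2.
have l1 := bcont_ln d1; have l2 := bcont_ln d2.
have : (1 - k) * E (fun x => ln (dens t1 x)) + k * E (fun x => ln (dens t2 x)) <=
   E (fun x => ln (dens (mix k t1 t2) x)).
  rewrite -EZ// -EZ// -ED; [|exact: bcontZ..].
  apply: Ele; [by apply: bcontD; exact: bcontZ|exact: bcont_ln|].
  by move=> x _; apply: ln_concave => //; exact: valid_dens_gt0.
lra.
Qed.

Lemma valid_base : valid base.
Proof. by split => //=; apply: bpos_cst. Qed.

Lemma tint_base f : tint base f = E f.
Proof.
rewrite /tint/= !mul0r !addr0; congr E.
by apply/funext => x; rewrite mulr1.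
Qed.

Lemma hcost_base : hcost base = 0.
Proof. by rewrite /hcost tint_base E1/= ln1 mean_cst; ring. Qed.

(** Variational lower bound for the entropy: ln (w r) <= w r - 1 is integrated against [q], and the
    atoms only help since [w] is positive. *)
Lemma hcost_ge t w : valid t -> bpos w ->
  E (fun x => ln (w x)) + tint t (fun=> 1) - tint t w <= hcost t.
Proof.
move=> vt bw; rewrite /hcost.
have [dt a0 b0] := vt; have [bcw _] := bw.
have lw := bcont_ln bw; have lt := bcont_ln dt.
suff : E (fun x => ln (w x)) + E (fun x => ln (dens t x)) <= tint t w - 1 by lra.
rewrite -ED//.
apply: (@le_trans _ _ (E (fun x => w x * dens t x - 1))).
  apply: Ele; [exact: bcontD| |].
    by apply: bcontB; [exact: bcontM (valid_bdens vt)|exact: bcont_cst].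
  move=> x _; have wx := bpos_gt0 x bw; have tx := valid_dens_gt0 x vt.
  by rewrite -lnM ?posrE// ln_le_sub1// mulr_gt0.
rewrite meanB ?mean_cst; [|exact: bcontM (valid_bdens vt)|exact: bcont_cst].
rewrite /tint; have := mulr_ge0 a0 (ltW (bpos_gt0 lamm bw)).
by have := mulr_ge0 b0 (ltW (bpos_gt0 lamp bw)); lra.
Qed.

Lemma tint1_gt0 t : valid t -> 0 < tint t (fun=> 1).
Proof.
move=> vt; have [dt a0 b0] := vt; rewrite /tint !mulr1.
suff : 0 < E (fun x => 1 * dens t x) by lra.
have [bd [c c0 cd]] := dt.
apply: (lt_le_trans c0); rewrite -(mean_cst c); apply: Ele => //; first exact: bcont_cst.
  by apply: bcontZ.
by move=> x _; rewrite mul1r.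
Qed.

(** The variational bound for the constant weight 1/2. *)
Lemma tint1_le t : valid t -> tint t (fun=> 1) <= 2 * hcost t + 2.
Proof.
move=> vt; have hh : (0 : R) < 2^-1 by rewrite invr_gt0.
have := hcost_ge vt (bpos_cst hh); rewrite mean_cst (tint_cst 2^-1 vt).
have : ln (2^-1 : R) >= -1.
  have := @ln_le_sub1 R 2 ltac:(lra); rewrite lnV ?posrE//; lra.
by lra.
Qed.

(** With T the total mass, the cost changes by 1 - T + ln T, which is nonpositive. A measure can
    thus be made a probability without exceeding its budget. *)
Lemma normalize_cost t : valid t ->
  hcost (scale (tint t (fun=> 1))^-1 t) <= hcost t.
Proof.
move=> vt; have T0 := tint1_gt0 vt; rewrite hcost_scale ?invr_gt0//.
rewrite lnV ?posrE// opprK mulrBl mulVf ?gt_eqF// mul1r.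
by have := ln_le_sub1 T0; lra.
Qed.

Lemma mean_norm_le f k : bcont f -> (forall x, `|f x| <= k) -> `|E f| <= k.
Proof.
move=> bf fk; have bk := bcont_cst k.
have fk' x : - k <= f x <= k by rewrite -ler_norml.
rewrite ler_norml -{2}(mean_cst k) -(mean_cst (- k)); apply/andP; split.
  by apply: Ele => //; [exact: bcont_cst|move=> x _; case/andP: (fk' x)].
by apply: Ele => // x _; case/andP: (fk' x).
Qed.

(** The chord bound [ln1D_ge] on [0, [B]] gives E ln (1 + s f) >= p ln (1 + s B) with p = E f / B,
    and [s] is chosen to make the right-hand side exceed [A]. *)
Lemma mean_ln_unbounded f A : bcont f -> (forall x, 0 <= f x) -> 0 < E f ->
  exists2 s, 0 < s & A < E (fun x => ln (1 + s * f x)).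
Proof.
move=> bf f0 Ef0; have [cf [C fC]] := bf.
pose B := C + 1.
have fB x : 0 <= f x <= B.
  by rewrite f0/= (le_trans (ler_norm _))// (le_trans (fC x))// /B; lra.
have B0 : 0 < B by have := le_trans (normr_ge0 _) (fC 0); rewrite /B; lra.
pose p := E f / B; have p0 : 0 < p by rewrite divr_gt0.
pose s := expR ((`|A| + 1) / p) / B.
have s0 : 0 < s by rewrite divr_gt0// expR_gt0.
exists s => //.
have bw : bpos (fun x => 1 + s * f x).
  apply: bposD; [exact: bpos_cst|exact: bcontZ|by move=> x; rewrite mulr_ge0// ltW].
have : p * ln (1 + s * B) <= E (fun x => ln (1 + s * f x)).
  have -> : p * ln (1 + s * B) = E (fun x => ln (1 + s * B) / B * f x).
    by rewrite EZ// /p; ring.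
  apply: Ele => //; [exact: bcontZ|exact: bcont_ln|].
  move=> x _; have -> : ln (1 + s * B) / B * f x = f x / B * ln (1 + s * B) by ring.
  exact: ln1D_ge (ltW s0) (fB x) B0.
have : `|A| + 1 <= p * ln (1 + s * B).
  rewrite -ler_pdivrMl// mulrC -[leLHS]expRK ler_ln ?posrE ?expR_gt0//.
    by rewrite /s divfK ?gt_eqF//; lra.
  by have := mulr_gt0 s0 B0; lra.
by have := ler_norm A; lra.
Qed.

(** A measure of bounded cost cannot nearly avoid a function of positive mean: this is [hcost_ge]
    for the weight 1 + s f, with [s] so large that the logarithmic term exceeds A + 1. *)
Lemma coercivity f A : bcont f -> (forall x, 0 <= f x) -> 0 < E f ->
  exists2 k, 0 < k & forall t, valid t -> hcost t <= A -> k <= tint t f.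
Proof.
move=> bf f0 Ef0; have [s s0 sA] := mean_ln_unbounded (A + 1) bf f0 Ef0.
exists s^-1; first by rewrite invr_gt0.
move=> t vt hA.
have bw : bpos (fun x => 1 + s * f x).
  apply: bposD; [exact: bpos_cst|exact: bcontZ|by move=> x; rewrite mulr_ge0// ltW].
have := hcost_ge vt bw.
have -> : tint t (fun x => 1 + s * f x) = tint t (fun=> 1) + s * tint t f.
  by rewrite tintD ?tintZ//; [exact: bcont_cst|exact: bcontZ].
move=> h; have : 1 <= s * tint t f by lra.
by rewrite -ler_pdivrMl// mulr1.
Qed.

(** * Strong duality for half-spaces *)

Lemma bpos_tilt f (M s : R) : bcont f -> (forall x, f x <= M) -> 0 <= s -> s * M < 1 ->
  bpos (fun x => 1 - s * f x).
Proof.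
move=> bf fM s0 sM; split.
  by apply: bcontB; [exact: bcont_cst|exact: bcontZ].
exists (1 - s * M); first by lra.
by move=> x; have := ler_wpM2l s0 (fM x); lra.
Qed.

(** The density 1 / (1 - s f) is the stationary point of [hcost t - s * tint t f], obtained by
    solving 1 - 1 / r = s f pointwise. *)
Let tilt f (s : R) := Nice (fun x => (1 - s * f x)^-1) 0 0.

Let valid_tilt f s : bpos (fun x => 1 - s * f x) -> valid (tilt f s).
Proof. by move=> bw; split => //=; exact: bpos_inv. Qed.

Let hcost_tilt f s : bcont f -> bpos (fun x => 1 - s * f x) ->
  hcost (tilt f s) = s * tint (tilt f s) f + E (fun x => ln (1 - s * f x)).
Proof.
move=> bf bw; have bi := bcont_inv bw.
rewrite /hcost/= /tint/= !mul0r !addr0.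
have -> : (fun x => 1 * (1 - s * f x)^-1) = (fun x => 1 + s * (f x * (1 - s * f x)^-1)).
  apply/funext => x; have := bpos_gt0 x bw.
  by move=> w0; field; rewrite gt_eqF.
have -> : (fun x => ln (1 - s * f x)^-1) = (fun x => - ln (1 - s * f x)).
  by apply/funext => x; rewrite lnV ?posrE; [|exact: (bpos_gt0 x bw)].
rewrite ED ?EZ ?meanN ?mean_cst; first by ring.
- exact: bcont_ln.
- exact: bcontM.
- exact: bcont_cst.
- by apply: bcontZ; exact: bcontM.
Qed.

Let tilt_continuous f (M s1 : R) : bcont f -> (forall x, f x <= M) -> s1 * M < 1 ->
  forall e, 0 < e -> exists2 d, 0 < d & forall s s', 0 <= s <= s1 -> 0 <= s' <= s1 ->
     `|s - s'| < d -> `|tint (tilt f s) f - tint (tilt f s') f| < e.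
Proof.
move=> bf fM sM e e0; have [_ [C fC]] := bf.
(* A lower bound of 1 - s f valid for all [s] in [0, [s1]], whatever the sign of [M]; it makes the
   tilted integral Lipschitz in [s]. *)
pose k := Num.min 1 (1 - s1 * M).
have k0 : 0 < k by rewrite lt_min ltr01; lra.
have C0 : 0 <= C := le_trans (normr_ge0 _) (fC 0).
have wk s x : 0 <= s <= s1 -> k <= 1 - s * f x.
  move=> /andP[s0 ss1]; rewrite /k ge_min.
  have h1 := ler_wpM2l s0 (fM x).
  have [M0|M0] := leP 0 M.
    by have := ler_wpM2r M0 ss1; lra.
  by have := ler_wpM2l s0 (ltW M0); lra.
have bs s : 0 <= s <= s1 -> bpos (fun x => 1 - s * f x).
  move=> ss; split; first by apply: bcontB; [exact: bcont_cst|exact: bcontZ].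
  by exists k => // x; exact: wk.
pose K := C ^+ 2 / k ^+ 2 + 1.
have K0 : 0 < K by rewrite /K ltr_wpDl// divr_ge0// ?sqr_ge0.
exists (e / K); first by rewrite divr_gt0.
move=> s s' hs hs' ss'; rewrite /tint/= !mul0r !addr0.
have b1 := bcontM bf (bcont_inv (bs _ hs)); have b2 := bcontM bf (bcont_inv (bs _ hs')).
rewrite -meanB//.
apply: (@le_lt_trans _ _ (`|s - s'| * K)); last by rewrite -ltr_pdivlMr.
apply: mean_norm_le; first exact: bcontB.
move=> x; have w1 := wk _ x hs; have w2 := wk _ x hs'.
have -> : f x * (1 - s * f x)^-1 - f x * (1 - s' * f x)^-1 =
  (s - s') * (f x ^+ 2 / ((1 - s * f x) * (1 - s' * f x))).
  by field; rewrite !gt_eqF//; lra.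
rewrite normrM ler_wpM2l// /K (@le_trans _ _ (C ^+ 2 / k ^+ 2))//; last by lra.
rewrite normrM normfV ler_pM ?invr_ge0//.
  by rewrite normrX lerXn2r ?nnegrE.
have D0 : 0 < (1 - s * f x) * (1 - s' * f x) by apply: mulr_gt0; lra.
rewrite gtr0_norm// lef_pV2 ?posrE ?exprn_gt0//.
by rewrite expr2 ler_pM// ltW.
Qed.

(** Either some multiplier [s] certifies that the half-space costs more than [A], or the half-space
    contains measures of cost nearly [A]. The optimal measure is a tilt, tuned by the intermediate
    value theorem. If the tilts stay short of [c] up to the critical value 1 / M, the deficit is
    made up by an atom at the edge where [f] attains its maximum [M]; [top] tells which edge. *)
Lemma half_space_duality f (M c A : R) (top : bool) : bcont f -> (forall x, f x <= M) ->
  f (if top then lamp else lamm) = M -> 0 <= A ->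
  (exists s, [/\ 0 <= s, s * M < 1 & A < s * c + E (fun x => ln (1 - s * f x))]) \/
  (forall e, 0 < e -> exists t, [/\ valid t, c <= tint t f & hcost t <= A + e]).
Proof.
move=> bf fM fe A0.
have [|nL] := pselect (exists s, [/\ 0 <= s, s * M < 1 &
  A < s * c + E (fun x => ln (1 - s * f x))]); [by left|right => e e0].
have L s : 0 <= s -> s * M < 1 -> s * c + E (fun x => ln (1 - s * f x)) <= A.
  by move=> s0 sM; rewrite leNgt; apply/negP => h; apply: nL; exists s.
have [cE|Ec] := leP c (E f).
  exists base; split; [exact: valid_base|by rewrite tint_base|].
  by rewrite hcost_base; lra.
have [[s [s0 sM cs]]|nA] := pselect (exists s, [/\ 0 <= s, s * M < 1 & c <= tint (tilt f s) f]).
  have t0 : tint (tilt f 0) f = E f.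
    rewrite /tint/= !mul0r !addr0; congr E; apply/funext => x.
    by rewrite mul0r subr0 invr1 mulr1.
  have [|s' /andP[s'0 s's] s'c] := @uniform_IVT R (fun s => tint (tilt f s) f) 0 s c s0
    (@tilt_continuous f M s bf fM sM).
    by rewrite t0 cs ltW.
  have s'M : s' * M < 1.
    have [M0|M0] := leP 0 M; first by have := ler_wpM2r M0 s's; lra.
    by have := mulr_ge0_le0 s'0 (ltW M0); lra.
  have bw := bpos_tilt bf fM s'0 s'M.
  exists (tilt f s'); split; [exact: valid_tilt|by rewrite s'c|].
  by rewrite hcost_tilt// s'c; have := L _ s'0 s'M; lra.
have Ac s : 0 <= s -> s * M < 1 -> tint (tilt f s) f < c.
  by move=> s0 sM; rewrite ltNge; apply/negP => h; apply: nA; exists s.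
have [M0|M0] := ltP 0 M.
  pose g := c - E f; have g0 : 0 < g by rewrite /g; lra.
  (* Close enough to 1 / M: here 1 - s M = e M / (g + e M), and the atom of mass [b] satisfies b M
     <= g, so that its excess price b (1 - s M) is at most [e]. *)
  pose s := g / (g + e * M) / M.
  have gM : 0 < g + e * M by rewrite addr_gt0// mulr_gt0.
  have sM1 : s * M = g / (g + e * M) by rewrite /s divfK// gt_eqF.
  have s0 : 0 <= s by rewrite /s !divr_ge0// ltW.
  have sM : s * M < 1.
    by rewrite sM1 ltr_pdivrMr// mul1r ltrDl mulr_gt0.
  have bw := bpos_tilt bf fM s0 sM.
  have vt := valid_tilt bw.
  have Asc := Ac _ s0 sM.
  pose b := (c - tint (tilt f s) f) / M.
  have b0 : 0 <= b by rewrite divr_ge0//; lra.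
  have bM : b * M = c - tint (tilt f s) f by rewrite /b divfK// gt_eqF.
  pose t := add_atoms (if top then 0 else b) (if top then b else 0) (tilt f s).
  have tf : tint t f = c.
    rewrite /t tint_add_atoms; move: fe; case: (top) => ->; lra.
  have ht : hcost t = hcost (tilt f s) + b by rewrite /t hcost_add_atoms; case: (top); lra.
  exists t; split; [by apply: valid_add_atoms => //; case: (top)|by rewrite tf|].
  rewrite ht hcost_tilt//; have := L _ s0 sM.
  have -> : tint (tilt f s) f = c - b * M by lra.
  suff : b - s * (b * M) <= e by lra.
  have -> : b - s * (b * M) = b * (1 - s * M) by ring.
  have -> : 1 - s * M = e * M / (g + e * M) by rewrite sM1; field; rewrite gt_eqF.
  have -> : b * (e * M / (g + e * M)) = (b * M) * (e / (g + e * M)) by ring.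
  apply: (@le_trans _ _ (g * (e / (g + e * M)))).
    apply: ler_wpM2r; first by rewrite divr_ge0// ltW.
    rewrite bM /g; suff : E f <= tint (tilt f s) f by lra.
    rewrite /tint/= !mul0r !addr0; apply: Ele => //.
      by apply: bcontM => //; exact: bcont_inv.
    move=> x _; have w0 := bpos_gt0 x bw; rewrite ler_pdivlMr//.
    by have := mulr_ge0 s0 (sqr_ge0 (f x)); lra.
  rewrite mulrA ler_pdivrMr// mulrC ler_wpM2l ?(ltW e0)//.
  by have := mulr_gt0 e0 M0; lra.
(* Now [M <= 0], every [s >= 0] is admissible and no multiplier may beat [A]. If c < 0, the tilt at
   s = - 1 / c reaches [c]; if c = 0, E ln (1 - s f) is unbounded because E f < 0; if c > 0, the
   term s c exceeds [A] by itself. *)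
exfalso.
have sMlt s : 0 <= s -> s * M < 1 by move=> s0; have := mulr_ge0_le0 s0 M0; lra.
have f0 x : f x <= 0 := le_trans (fM x) M0.
have [c0|c0] := ltP c 0.
  have s0 : 0 < - c^-1 by rewrite oppr_gt0 invr_lt0.
  have := Ac _ (ltW s0) (sMlt _ (ltW s0)).
  suff : c <= tint (tilt f (- c^-1)) f by lra.
  have bw := bpos_tilt bf fM (ltW s0) (sMlt _ (ltW s0)).
  rewrite /tint/= !mul0r !addr0 -[leLHS](mean_cst c); apply: Ele.
  - exact: bcont_cst.
  - by apply: bcontM => //; exact: bcont_inv.
  - move=> x _; have w0 := bpos_gt0 x bw; rewrite ler_pdivlMr//.
    have -> : c * (1 - - c^-1 * f x) = c + f x by field; rewrite lt_eqF.
    by lra.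
have [c1|c1] := eqVneq c 0.
  have [s s0] := @mean_ln_unbounded (fun x => - f x) A (bcontN bf)
    ltac:(by move=> x; rewrite oppr_ge0) ltac:(by rewrite meanN//; lra).
  have := L _ (ltW s0) (sMlt _ (ltW s0)).
  have -> : (fun x => ln (1 + s * - f x)) = (fun x => ln (1 - s * f x)).
    by apply/funext => x; congr ln; ring.
  by rewrite c1; lra.
have cp : 0 < c by rewrite lt_def c1.
have s0 : 0 < (A + 1) / c by rewrite divr_gt0//; lra.
have bw := bpos_tilt bf fM (ltW s0) (sMlt _ (ltW s0)).
have := L _ (ltW s0) (sMlt _ (ltW s0)); rewrite divfK//.
suff : 0 <= E (fun x => ln (1 - (A + 1) / c * f x)) by lra.
apply: mean_ge0; first exact: bcont_ln.
move=> x _; apply: ln_ge0; have := mulr_ge0_le0 (ltW s0) (f0 x); lra.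
Qed.

End nice_measures.

(** * A one-dimensional minimax theorem *)

(** A Helly-type argument on the line replaces compactness. If every [theta] fails for some [x], two
    of the intervals {g x <= w0} are separated by a point [xi]; a convex combination of the
    corresponding two functions is then at least [w0] everywhere, although each mixed point must go
    below [w0] somewhere. *)
Lemma minimax_line {R : realType} (X : Type) (C : X -> Prop) (g : X -> R -> R)
    (tm w0 w : R) :
  (forall x u v s, C x -> tm <= u -> u < v -> v < s ->
     (s - u) * g x v <= (s - v) * g x u + (v - u) * g x s) ->
  (forall x y k, C x -> C y -> 0 <= k <= 1 -> exists2 z, C z &
     forall th, tm <= th -> (1 - k) * g x th + k * g y th <= g z th) ->
  (forall x th, C x -> tm <= th -> th <= g x th) ->
  (forall x u v, C x -> tm <= u -> u <= v -> g x v <= g x u + (v - u)) ->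
  (forall x, C x -> exists2 th, tm <= th & g x th < w0) ->
  w0 < w ->
  exists2 th, tm <= th & forall x, C x -> g x th < w.
Proof.
move=> gconv gmix ggrow gslow glow ww.
have [//|H] := pselect (exists2 th, tm <= th & forall x, C x -> g x th < w).
exfalso.
have Hx th : tm <= th -> exists2 x, C x & w <= g x th.
  move=> tth; have [//|nx] := pselect (exists2 x, C x & w <= g x th).
  exfalso; apply: H; exists th => // x Cx; rewrite ltNge; apply/negP => gw.
  by apply: nx; exists x.
pose I x th := tm <= th /\ g x th <= w0.
(* The points lying strictly to the left of some sublevel interval. The separating point is sought
   just below the supremum of this set. *)
pose S := [set th | tm <= th /\ exists2 x, C x & forall u, I x u -> th < u].
have Stm : S tm.
  split => //; have [x Cx wx] := Hx tm (lexx _); exists x => // u [tu gu].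
  by rewrite lt_neqAle tu andbT; apply/eqP => e; move: gu; rewrite -e; lra.
have Sub : ubound S w0.
  move=> th [tth [x Cx Ix]]; have [u tu gu] := glow _ Cx.
  have := Ix u (conj tu (ltW gu)); have := ggrow _ _ Cx tu; lra.
have supS : has_sup S by split; [exists tm|exists w0].
have tmS : tm <= sup S by apply: ub_le_sup => //; exists w0.
(* The window around [sup S] has width at most [2 * eta = w - w0]; with slope at most 1, [g x1]
   cannot climb from [w0] to [w] inside it. *)
pose eta := (w - w0) / 2.
have [xi [txi [x2 Cx2 Ix2]] xiS] := @sup_adherent R S eta ltac:(rewrite /eta; lra) supS.
pose th' := sup S + eta.
have th'S : ~ S th'.
  move=> h; have : th' <= sup S by apply: ub_le_sup => //; exists w0.
  by rewrite /th' /eta; lra.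
have tth' : tm <= th' by rewrite /th' /eta; lra.
have [x1 Cx1 wx1] := Hx _ tth'.
have [u0 [tu0 gu0] u0th] : exists2 u0, I x1 u0 & u0 <= th'.
  have [//|nu] := pselect (exists2 u0, I x1 u0 & u0 <= th').
  exfalso; apply: th'S; split => //; exists x1 => // u Iu.
  by rewrite ltNge; apply/negP => h; apply: nu; exists u.
have step u : I x1 u -> u <= th' -> u < xi.
  move=> [tu gu] uth; rewrite ltNge; apply/negP => xiu.
  have := gslow _ _ _ Cx1 tu uth; move: xiS wx1; rewrite /th' /eta in uth *; lra.
(* Points beyond [th'] are excluded by convexity: together with [u0] they would force
   [g x1 th' <= w0]. *)
have Ix1 u : I x1 u -> u < xi.
  move=> Iu; have [/step|thu] := leP u th'; first exact.
  have u0xi := step _ (conj tu0 gu0) u0th.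
  have u0th' : u0 < th'.
    by rewrite lt_neqAle u0th andbT; apply/eqP => e; move: wx1 gu0; rewrite e; lra.
  have := gconv _ _ _ _ Cx1 tu0 u0th' thu; case: Iu => tu gu.
  have := ler_wpM2l (_ : 0 <= u - th') gu0; rewrite subr_ge0 => /(_ (ltW thu)).
  have := ler_wpM2l (_ : 0 <= th' - u0) gu; rewrite subr_ge0 => /(_ (ltW u0th')).
  have : (u - u0) * w <= (u - u0) * g x1 th' by apply: ler_wpM2l => //; lra.
  have : 0 < (u - u0) * (w - w0) by apply: mulr_gt0; lra.
  by lra.
pose g1 u := g x1 u - w0; pose g2 u := g x2 u - w0.
have g1p u : tm <= u -> xi <= u -> 0 < g1 u.
  move=> tu xu; rewrite ltNge; apply/negP => h.
  have := Ix1 u; have : I x1 u by split => //; move: h; rewrite /g1; lra.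
  by move=> h1 /(_ h1); lra.
have g2p u : tm <= u -> u <= xi -> 0 < g2 u.
  move=> tu xu; rewrite ltNge; apply/negP => h.
  have := Ix2 u; have : I x2 u by split => //; move: h; rewrite /g2; lra.
  by move=> h1 /(_ h1); lra.
(* Chords of both convex functions are compared at [xi], where both are positive. Every ratio
   [- g1 u / g2 u] on the left is thus at most every ratio [g1 v / - g2 v] on the right, and any [k]
   in between makes [g1 + k * g2] nonnegative everywhere. *)
have cross u v : I x1 u -> I x2 v -> - g1 u * - g2 v <= g1 v * g2 u.
  move=> Iu Iv; have uxi := Ix1 _ Iu; have xiv := Ix2 _ Iv.
  case: (Iu) => tu gu; case: (Iv) => tv gv.
  have g1v := g1p v tv (ltW xiv); have g2u := g2p u tu (ltW uxi).
  have g1xi := g1p xi txi (lexx _); have g2xi := g2p xi txi (lexx _).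
  have c1 : (v - xi) * - g1 u <= (xi - u) * g1 v.
    have := gconv _ _ _ _ Cx1 tu uxi xiv.
    have : 0 < (v - u) * g1 xi by apply: mulr_gt0 => //; lra.
    by rewrite /g1; lra.
  have c2 : (xi - u) * - g2 v <= (v - xi) * g2 u.
    have := gconv _ _ _ _ Cx2 tu uxi xiv.
    have : 0 < (v - u) * g2 xi by apply: mulr_gt0 => //; lra.
    by rewrite /g2; lra.
  have pr : 0 < (v - xi) * (xi - u) by apply: mulr_gt0; lra.
  rewrite -(ler_pM2l pr).
  have := ler_pM (_ : 0 <= (v - xi) * - g1 u) (_ : 0 <= (xi - u) * - g2 v) c1 c2.
  move/(_ ltac:(apply: mulr_ge0; rewrite /g1; lra)).
  move/(_ ltac:(apply: mulr_ge0; rewrite /g2; lra)).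
  by lra.
pose K := [set - g1 u / g2 u | u in [set u | I x1 u]].
have [v0 tv0 gv0] := glow _ Cx2.
have Iv0 : I x2 v0 by split => //; exact: ltW.
have Kub v : I x2 v -> g2 v < 0 -> ubound K (g1 v / - g2 v).
  move=> Iv g2v _ [u Iu <-]; have [tu gu] := Iu.
  have g2u : 0 < g2 u by apply: g2p => //; exact/ltW/Ix1.
  rewrite ler_pdivrMr// mulrAC ler_pdivlMr; last by lra.
  exact: cross.
have g2v0 : g2 v0 < 0 by rewrite /g2; lra.
have K0 : K (- g1 u0 / g2 u0) by exists u0.
have hub : has_ubound K by exists (g1 v0 / - g2 v0); exact: Kub.
pose k := sup K.
have k0 : 0 <= k.
  apply: (@le_trans _ _ (- g1 u0 / g2 u0)); last exact: ub_le_sup.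
  rewrite divr_ge0//; first by rewrite /g1; lra.
  by apply/ltW/g2p => //; apply/ltW/Ix1.
have comb th : tm <= th -> 0 <= g1 th + k * g2 th.
  move=> tth; have [g1t|g1t] := leP (g x1 th) w0.
    have g2t : 0 < g2 th by apply: g2p => //; apply/ltW/Ix1.
    have : - g1 th / g2 th <= k by apply: ub_le_sup => //; exists th.
    by rewrite ler_pdivrMr//; lra.
  have g1pt : 0 < g1 th by rewrite /g1; lra.
  have [g2t|g2t] := leP 0 (g2 th); first by have := mulr_ge0 k0 g2t; lra.
  have It : I x2 th by split => //; move: g2t; rewrite /g2; lra.
  have : k <= g1 th / - g2 th.
    by apply: ge_sup; [exists (- g1 u0 / g2 u0)|exact: Kub].
  by rewrite ler_pdivlMr; lra.
have k1 : 0 < 1 + k by lra.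
have [|z Cz zg] := gmix x1 x2 (k / (1 + k)) Cx1 Cx2.
  by rewrite divr_ge0 ?(ltW k1)//= ler_pdivrMr// mul1r; lra.
have [th tth gth] := glow _ Cz.
have := zg _ tth; have := comb _ tth.
have -> : (1 - k / (1 + k)) * g x1 th + k / (1 + k) * g x2 th =
  w0 + (g1 th + k * g2 th) / (1 + k) by rewrite /g1 /g2; field; rewrite gt_eqF.
move=> h1; have : 0 <= (g1 th + k * g2 th) / (1 + k) by rewrite divr_ge0// ltW.
by lra.
Qed.

(** * The variational functional *)

Definition half_inf {R : realType} (lamp : R) (g : R -> R) :=
  2^-1 * inf [set g theta | theta in [set theta | lamp < theta]].

(** Shared by the limiting functional and by the dual function in finite dimension, both of the form
    [theta] plus a nonnegative nonincreasing term. It bounds the infimum from below and controls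
    values on the left of a point by the value at that point. *)
Definition slow {R : realType} (lamp : R) (g : R -> R) :=
  (forall u, lamp < u -> u <= g u) /\
  (forall u v, lamp < u -> u <= v -> g v <= g u + (v - u)).

Section half_inf_lemmas.
Context {R : realType} (lamp : R).
Implicit Types (g : R -> R).

Let S g := [set g theta | theta in [set theta | lamp < theta]].

Lemma half_inf_le g u : slow lamp g -> lamp < u -> 2 * half_inf lamp g <= g u.
Proof.
move=> [g1 g2] lu; rewrite /half_inf mulrA divff// mul1r; apply: ge_inf; last by exists u.
by exists lamp => _ [v /= lv <-]; rewrite (le_trans (ltW lv))// g1.
Qed.

Lemma half_inf_ge g w : (forall u, lamp < u -> w <= g u) -> w <= 2 * half_inf lamp g.
Proof.
move=> wg; rewrite /half_inf mulrA divff// mul1r; apply: lb_le_inf.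
  by exists (g (lamp + 1)); exists (lamp + 1) => //=; rewrite ltrDl.
by move=> _ [v /= lv <-]; exact: wg.
Qed.

Lemma half_inf_lt g w : 2 * half_inf lamp g < w -> exists2 u, lamp < u & g u < w.
Proof.
move=> h; have [//|nu] := pselect (exists2 u, lamp < u & g u < w).
exfalso; have : w <= 2 * half_inf lamp g; last by lra.
apply: half_inf_ge => u lu; rewrite leNgt; apply/negP => gu.
by apply: nu; exists u.
Qed.

(** Near [lamp] the resolvents are not uniformly bounded, so the functions are compared from
    [lamp + d] on; the slope bound carries the infimum across the gap at the price [d]. *)
Lemma half_inf_close g g' d k : slow lamp g -> slow lamp g' -> 0 < d -> 0 <= k ->
  (forall u, lamp + d <= u -> g' u <= g u + k) ->
  2 * half_inf lamp g' <= 2 * half_inf lamp g + d + k.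
Proof.
move=> sg sg' d0 k0 gk; suff : 2 * half_inf lamp g' - d - k <= 2 * half_inf lamp g by lra.
apply: half_inf_ge => u lu; have [ud|ud] := leP (lamp + d) u.
  by have := half_inf_le sg' lu; have := gk _ ud; lra.
have ld : lamp < lamp + d by rewrite ltrDl.
have := half_inf_le sg' ld; have := gk _ (lexx _).
by have := (proj2 sg) _ _ lu (ltW ud); lra.
Qed.

(** Between two nodes [g] grows by at most the mesh [d], and beyond the last one [g theta >= theta].
    A lower bound on the infimum is thereby reduced to finitely many [theta]. *)
Lemma half_inf_grid g d (n : nat) w : slow lamp g -> 0 < d -> w <= lamp + d * n%:R ->
  (forall k, (k < n)%N -> w <= g (lamp + d * k.+1%:R)) ->
  w - d <= 2 * half_inf lamp g.
Proof.
move=> sg d0 wn wk; apply: half_inf_ge => u lu.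
have [ub|ub] := leP (lamp + d * n%:R) u.
  by have := (proj1 sg) _ lu; lra.
pose k := Num.truncn ((u - lamp) / d).
have r0 : 0 <= (u - lamp) / d by rewrite divr_ge0 ?(ltW d0)//; lra.
have /andP[k1 k2] := truncn_itv r0.
rewrite -/k in k1 k2.
have e : u - lamp = (u - lamp) / d * d by rewrite divfK// gt_eqF.
have kn : (k < n)%N.
  rewrite -(ltr_nat R) (le_lt_trans k1)// ltr_pdivrMr//; lra.
have := wk _ kn.
have u1 : u <= lamp + d * k.+1%:R.
  by move: k2; rewrite ltr_pdivrMr// mulrC; lra.
have : u >= lamp + d * k%:R by move: k1; rewrite ler_pdivlMr// mulrC; lra.
have := (proj2 sg) _ _ lu u1.
by rewrite -natr1; lra.
Qed.

End half_inf_lemmas.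

(** * Sublevel sets of the variational functional *)

Section sublevels.
Context {R : realType} (lamm lamp Gamma : R) (E : (R -> R) -> R).
Hypothesis lam_le : lamm <= lamp.
Hypothesis Gamma_gt0 : 0 < Gamma.
Hypothesis mE : mean_on lamm lamp E.
Implicit Types (f g : R -> R) (t : nice R).

Local Notation tint := (tint lamm lamp E).
Local Notation hcost := (hcost lamm lamp E).
Local Notation resolv := (resolv lamm lamp).

Definition Gfun t theta := theta + Gamma * tint t (resolv theta).
Definition Fnice t := half_inf lamp (Gfun t).

Let Rgt0 theta x : lamp < theta -> 0 < resolv theta x.
Proof. exact: resolv_gt0. Qed.
Let bR theta : lamp < theta -> bcont (resolv theta).
Proof. by move=> /(bpos_resolv lam_le)[]. Qed.

Lemma resolv_anti u v x : lamp < u -> u <= v -> resolv v x <= resolv u x.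
Proof.
move=> lu uv; rewrite lef_pV2 ?posrE; have := clampK_itv lam_le x; lra.
Qed.

(** Convexity in [theta] without denominators, as the minimax argument uses it; the defect is an
    explicit positive fraction. *)
Lemma resolv_convex u v s x : lamp < u -> u < v -> v < s ->
  (s - u) * resolv v x <= (s - v) * resolv u x + (v - u) * resolv s x.
Proof.
move=> lu uv vs; rewrite /resolv; have := clampK_itv lam_le x.
set y := clampK _ _ _ => /andP[y1 y2].
have zu : 0 < u - y by lra.
have zv : 0 < v - y by lra.
have zs : 0 < s - y by lra.
rewrite -subr_ge0.
have -> : (s - v) * (u - y)^-1 + (v - u) * (s - y)^-1 - (s - u) * (v - y)^-1 =
  (v - u) * (s - v) * (s - u) / ((u - y) * (v - y) * (s - y)).
  by field; rewrite !gt_eqF.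
by rewrite divr_ge0// !mulr_ge0//; lra.
Qed.

Lemma slow_Gfun t : valid t -> slow lamp (Gfun t).
Proof.
move=> vt; split=> [u lu|u v lu uv].
  rewrite /Gfun lerDl mulr_ge0 ?(ltW Gamma_gt0)//.
  apply: (tint_ge0 lam_le mE) => //; first exact: bR.
  by move=> x _; exact/ltW/Rgt0.
have : tint t (resolv v) <= tint t (resolv u).
  apply: (tint_le lam_le mE) => //; [exact/bR/(lt_le_trans lu)|exact: bR|].
  by move=> x _; exact: resolv_anti.
by move=> /(ler_wpM2l (ltW Gamma_gt0)); rewrite /Gfun; lra.
Qed.

Lemma Gfun_mix k t1 t2 u : lamp < u -> valid t1 -> valid t2 ->
  Gfun (mix k t1 t2) u = (1 - k) * Gfun t1 u + k * Gfun t2 u.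
Proof.
move=> lu v1 v2; rewrite /Gfun (tint_mix mE)//; first by ring.
exact: bR.
Qed.

Lemma Gfun_convex t u v s : valid t -> lamp < u -> u < v -> v < s ->
  (s - u) * Gfun t v <= (s - v) * Gfun t u + (v - u) * Gfun t s.
Proof.
move=> vt lu uv vs; rewrite /Gfun.
have bu := bR lu; have bv := bR (lt_trans lu uv).
have bs := bR (lt_trans lu (lt_trans uv vs)).
suff : (s - u) * tint t (resolv v) <=
  (s - v) * tint t (resolv u) + (v - u) * tint t (resolv s).
  by move=> /(ler_wpM2l (ltW Gamma_gt0)); lra.
rewrite -!(tintZ mE)// -(tintD mE)//; [|exact: bcontZ..].
apply: (tint_le lam_le mE) => //; [exact: bcontZ|by apply: bcontD; exact: bcontZ|].
by move=> x _; exact: resolv_convex.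
Qed.

(* haar selects the class of probability measures. *)
Definition level (haar : bool) (a : R) t :=
  [/\ valid t, hcost t <= 2 * a & haar -> tint t (fun=> 1) = 1].

Lemma level_base haar a : 0 <= a -> level haar a base.
Proof.
move=> a0; split; first exact: valid_base.
  by rewrite (hcost_base mE); lra.
by move=> _; rewrite tint_base; case: mE.
Qed.

Lemma level_mix haar a t1 t2 k : 0 <= k <= 1 -> level haar a t1 -> level haar a t2 ->
  level haar a (mix k t1 t2).
Proof.
move=> k01 [v1 h1 m1] [v2 h2 m2]; split; first exact: valid_mix.
  have := hcost_mix mE k01 v1 v2.
  have := ler_wpM2l (_ : 0 <= 1 - k) h1; have := ler_wpM2l (_ : 0 <= k) h2.
  by move=> /(_ ltac:(lra)) + /(_ ltac:(lra)); lra.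
move=> hr; rewrite (tint_mix mE) ?m1 ?m2//; first by ring.
exact: bcont_cst.
Qed.

Definition slack (v theta : R) := (2 * v - theta) / Gamma.

(** The constraint [Gfun t theta >= 2 * v] becomes [tint t (dual_up haar v theta) >= dual_thr haar v
    theta] on the relevant class. In the Haar case [slack] is multiplied by the total mass, which
    makes the constraint homogeneous: the threshold is 0 and normalising the measure preserves
    it. *)
Definition dual_up (haar : bool) (v theta x : R) :=
  resolv theta x - (if haar then slack v theta else 0).
Definition dual_dn (haar : bool) (v theta x : R) :=
  (if haar then slack v theta else 0) - resolv theta x.
Definition dual_thr (haar : bool) (v theta : R) := if haar then 0 else slack v theta.

Lemma bcont_dual_up haar v theta : lamp < theta -> bcont (dual_up haar v theta).
Proof. by move=> lt; apply: bcontB; [exact: bR|exact: bcont_cst]. Qed.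
Lemma bcont_dual_dn haar v theta : lamp < theta -> bcont (dual_dn haar v theta).
Proof. by move=> lt; apply: bcontB; [exact: bcont_cst|exact: bR]. Qed.

Lemma tint_dual_up haar v theta t : lamp < theta -> valid t ->
  tint t (dual_up haar v theta) =
  tint t (resolv theta) - (if haar then slack v theta else 0) * tint t (fun=> 1).
Proof.
move=> lt vt; rewrite /dual_up (tintD mE)//; [|exact: bR|exact: bcont_cst].
by rewrite (tint_cst mE _ vt) mulNr.
Qed.

Lemma tint_dual_dn haar v theta t : lamp < theta -> valid t ->
  tint t (dual_dn haar v theta) =
  (if haar then slack v theta else 0) * tint t (fun=> 1) - tint t (resolv theta).
Proof.
move=> lt vt; rewrite /dual_dn (tintD mE)//; [|exact: bcont_cst|exact/bcontN/bR].
by rewrite (tint_cst mE _ vt) (tintN mE)//; exact: bR.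
Qed.

Lemma slackE v theta : Gamma * slack v theta = 2 * v - theta.
Proof. by rewrite /slack mulrC divfK// gt_eqF. Qed.

Let nrm t := scale (tint t (fun=> 1))^-1 t.

Let level_nrm a t : valid t -> hcost t <= 2 * a -> level true a (nrm t).
Proof.
move=> vt ht; have T0 := tint1_gt0 mE vt.
split; first by apply: valid_scale => //; rewrite invr_gt0.
  exact: le_trans (normalize_cost mE vt) ht.
move=> _; rewrite (tint_scale mE)//; last exact: bcont_cst.
by rewrite mulVf// gt_eqF.
Qed.

Let level_of haar a t f : valid t -> hcost t <= 2 * a -> bcont f ->
  exists t' k, [/\ level haar a t', 0 < k, tint t' f = k * tint t f & ~~ haar -> k = 1].
Proof.
move=> vt ht bf; case: haar; last by exists t, 1; split => //; rewrite mul1r.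
have T0 := tint1_gt0 mE vt.
exists (nrm t), (tint t (fun=> 1))^-1; split => //; [exact: level_nrm|by rewrite invr_gt0|].
by rewrite (tint_scale mE).
Qed.

(** Minimax provides one [theta] at which all measures of level [a] satisfy [Gfun t theta < 2 * v].
    These measures then miss a half-space of test function [dual_up], maximal at [lamp], and duality
    yields the multiplier. *)
Lemma dual_upper haar a' a u v : 0 <= a' -> a' < a -> u < v ->
  (forall t, level haar a t -> Fnice t <= u) ->
  exists theta s, [/\ lamp < theta, 0 <= s,
    bpos (fun x => 1 - s * dual_up haar v theta x) &
    2 * a' < s * dual_thr haar v theta + E (fun x => ln (1 - s * dual_up haar v theta x))].
Proof.
move=> a'0 a'a uv Fu; pose d := (v - u) / 2; have d0 : 0 < d by rewrite /d; lra.
have [theta tt Gt] : exists2 theta, lamp + d <= theta &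
    forall t, level haar a t -> Gfun t theta < 2 * v.
  apply: (@minimax_line R (nice R) (level haar a) Gfun (lamp + d) (u + v) (2 * v)).
  - by move=> t x y z [vt _ _] tx; apply: Gfun_convex => //; lra.
  - move=> t1 t2 k l1 l2 k01; exists (mix k t1 t2); first exact: level_mix.
    move=> th tth; rewrite Gfun_mix//; first lra.
    by case: l1.
    by case: l2.
  - by move=> t th [vt _ _] tth; apply: (proj1 (slow_Gfun vt)); lra.
  - by move=> t x y [vt _ _] tx; apply: (proj2 (slow_Gfun vt)); lra.
  - move=> t lt; have [vt _ _] := lt; have := Fu t lt => Ftu.
    have [th lth Gth] : exists2 th, lamp < th & Gfun t th < 2 * u + d.
      by apply: half_inf_lt; rewrite -/(Fnice t); lra.
    have [h|h] := leP (lamp + d) th; first by exists th => //; rewrite /d in Gth; lra.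
    exists (lamp + d) => //; have := proj2 (slow_Gfun vt) _ _ lth (ltW h).
    by rewrite /d in Gth *; lra.
  - by lra.
have lt : lamp < theta by lra.
have bf := bcont_dual_up haar v lt.
have [[s [s0 sM hs]]|H] := @half_space_duality R lamm lamp E mE
  (dual_up haar v theta) (dual_up haar v theta lamp) (dual_thr haar v theta) (2 * a') true bf
  (fun x => lerB (resolv_le_lamp lam_le x lt) (lexx _)) erefl ltac:(lra).
  exists theta, s; split => //.
  apply: (bpos_tilt (M := dual_up haar v theta lamp)) => // x.
  by rewrite lerB// resolv_le_lamp.
(* The other alternative gives a measure of cost at most [2 * a] in the half-space; after
   normalisation in the Haar case it belongs to the level and contradicts the choice of [theta]. *)
exfalso; have [t [vt ct ht]] := H (2 * (a - a')) ltac:(lra).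
have [t' [k [lt' k0 tk kh]]] := @level_of haar a t (dual_up haar v theta) vt ltac:(lra) bf.
have := Gt _ lt'; rewrite /Gfun; have [vt' _ m1] := lt'.
move: tk; rewrite tint_dual_up// => tk.
suff : slack v theta <= tint t' (resolv theta).
  by move=> /(ler_wpM2l (ltW Gamma_gt0)); rewrite slackE; lra.
move: ct kh tk m1; rewrite /dual_thr; case: (haar) => ct kh tk m1.
  by have := mulr_ge0 (ltW k0) ct; rewrite -tk m1//; lra.
by move: tk; rewrite kh// mul1r; lra.
Qed.

(** No minimax here: an infimum above [u] bounds [Gfun] from below at every [theta], so each one
    gives its own half-space. The test function [dual_dn] is maximal at [lamm], where the atom of
    the duality lemma goes. *)
Lemma dual_lower haar a' a u v theta : 0 <= a' -> a' < a -> v < u ->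
  (forall t, level haar a t -> u <= Fnice t) -> lamp < theta ->
  exists s, [/\ 0 <= s,
    bpos (fun x => 1 - s * dual_dn haar v theta x) &
    2 * a' < s * - dual_thr haar v theta + E (fun x => ln (1 - s * dual_dn haar v theta x))].
Proof.
move=> a'0 a'a uv Fu lt.
have bf := bcont_dual_dn haar v lt.
have [[s [s0 sM hs]]|H] := @half_space_duality R lamm lamp E mE
  (dual_dn haar v theta) (dual_dn haar v theta lamm) (- dual_thr haar v theta) (2 * a') false bf
  (fun x => lerB (lexx _) (resolv_ge_lamm lam_le x lt)) erefl ltac:(lra).
  exists s; split => //.
  apply: (bpos_tilt (M := dual_dn haar v theta lamm)) => // x.
  by rewrite lerB// resolv_ge_lamm.
exfalso; have [t [vt ct ht]] := H (2 * (a - a')) ltac:(lra).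
have [t' [k [lt' k0 tk kh]]] := @level_of haar a t (dual_dn haar v theta) vt ltac:(lra) bf.
have := Fu _ lt'; have [vt' _ m1] := lt'; have := half_inf_le (slow_Gfun vt') lt.
rewrite -/(Fnice t') /Gfun.
move: tk; rewrite tint_dual_dn// => tk.
suff : tint t' (resolv theta) <= slack v theta.
  by move=> /(ler_wpM2l (ltW Gamma_gt0)); rewrite slackE; lra.
move: ct kh tk m1; rewrite /dual_thr; case: (haar) => ct kh tk m1.
  by rewrite oppr0 in ct; have := mulr_ge0 (ltW k0) ct; rewrite -tk m1//; lra.
by move: tk; rewrite kh// mul1r; lra.
Qed.

Lemma Fnice_ge t : valid t -> lamp <= 2 * Fnice t.
Proof.
move=> vt; apply: half_inf_ge => u lu.
by rewrite (le_trans (ltW lu))// (proj1 (slow_Gfun vt)).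
Qed.

(** Evaluation at [theta = lamp + 1], where the resolvent is at most 1, together with the mass bound
    [2 * hcost t + 2]. *)
Definition Fbound a := lamp + 1 + Gamma * (4 * a + 2).

Lemma Fnice_le haar a t : level haar a t -> 2 * Fnice t <= Fbound a.
Proof.
move=> [vt ht _]; have l1 : lamp < lamp + 1 by rewrite ltrDl.
apply: le_trans (half_inf_le (slow_Gfun vt) l1) _.
rewrite /Gfun /Fbound lerD2l ler_pM2l//.
apply: (@le_trans _ _ (tint t (fun=> 1))); last by have := tint1_le mE vt; lra.
apply: (tint_le lam_le mE) => //; [exact: bR|exact: bcont_cst|].
move=> x _; rewrite invf_le1; have := clampK_itv lam_le x; lra.
Qed.

Lemma mix0 t1 t2 : mix 0 t1 t2 = t1.
Proof.
case: t1 t2 => [r1 a1 b1] [r2 a2 b2]; rewrite /mix/=; congr Nice.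
- by apply/funext => x; ring.
- by ring.
- by ring.
Qed.

Lemma mix1 t1 t2 : mix 1 t1 t2 = t2.
Proof.
case: t1 t2 => [r1 a1 b1] [r2 a2 b2]; rewrite /mix/=; congr Nice.
- by apply/funext => x; ring.
- by ring.
- by ring.
Qed.

Lemma resolv_le_inv d u x : 0 < d -> lamp + d <= u -> resolv u x <= d^-1.
Proof.
by move=> d0 lu; rewrite lef_pV2 ?posrE//; have := clampK_itv lam_le x; lra.
Qed.

(** Along the segment [mix k t1 t2] the functional is uniformly continuous: beyond [lamp + e] the
    resolvents are at most [1 / e] and [Gfun] is affine in [k], while the part closer to [lamp]
    costs at most [e]. *)
Lemma Fnice_intermediate haar a t1 t2 m : level haar a t1 -> level haar a t2 ->
  Fnice t1 <= m <= Fnice t2 -> exists2 t, level haar a t & Fnice t = m.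
Proof.
move=> l1 l2 Fm; have [v1 _ _] := l1; have [v2 _ _] := l2.
have [||k k01 Fk] := @uniform_IVT R (fun k => Fnice (mix k t1 t2)) 0 1 m ler01.
- move=> e e0; have T1 := tint1_gt0 mE v1; have T2 := tint1_gt0 mE v2.
  pose C := Gamma * (tint t1 (fun=> 1) + tint t2 (fun=> 1)) / e.
  have C0 : 0 < C by rewrite divr_gt0// mulr_gt0// addr_gt0.
  exists (e / (C + 1)); first by rewrite divr_gt0//; lra.
  suff H x y : 0 <= x <= 1 -> 0 <= y <= 1 -> `|x - y| < e / (C + 1) ->
      Fnice (mix x t1 t2) - Fnice (mix y t1 t2) < e.
    move=> x y hx hy xy; rewrite ltr_norml ltrNl opprB.
    by rewrite !H// distrC.
  move=> hx hy xy.
  have vx := valid_mix hx v1 v2; have vy := valid_mix hy v1 v2.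
  have := @half_inf_close R lamp (Gfun (mix y t1 t2)) (Gfun (mix x t1 t2)) e
    (`|x - y| * C) (slow_Gfun vy) (slow_Gfun vx) e0 (mulr_ge0 (normr_ge0 _) (ltW C0)).
  rewrite -/(Fnice _) -/(Fnice _) => h.
  have : `|x - y| * (C + 1) < e by rewrite -ltr_pdivlMr//; lra.
  have := normr_ge0 (x - y).
  suff : forall u, lamp + e <= u ->
    Gfun (mix x t1 t2) u <= Gfun (mix y t1 t2) u + `|x - y| * C by move=> /h; lra.
  move=> u eu; have lu : lamp < u by lra.
  rewrite !Gfun_mix// /Gfun.
  set p := tint t1 (resolv u); set q := tint t2 (resolv u).
  have pq t : valid t -> 0 <= tint t (resolv u) <= tint t (fun=> 1) / e.
    move=> vt; apply/andP; split.
      by apply: (tint_ge0 lam_le mE) => //; [exact: bR|move=> z _; exact/ltW/Rgt0].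
    rewrite mulrC -(tint_cst mE)//; apply: (tint_le lam_le mE) => //.
    - exact: bR.
    - exact: bcont_cst.
    - by move=> z _; exact: resolv_le_inv.
  have /andP[p0 p1] := pq _ v1; have /andP[q0 q1] := pq _ v2.
  rewrite -/p -/q in p0 p1 q0 q1.
  have : (x - y) * (Gamma * (q - p)) <= `|x - y| * C.
    apply: le_trans (ler_norm _) _; rewrite normrM ler_wpM2l// normrM gtr0_norm// /C -mulrA.
    rewrite ler_pM2l// mulrDl ler_norml; lra.
  lra.
- by rewrite mix0 mix1.
exists (mix k t1 t2) => //; exact: level_mix.
Qed.

Let cl := clampK lamm lamp.

Let clK x : lamm <= cl x <= lamp.
Proof. exact: clampK_itv. Qed.

Let gap_lamp u x : lamp < u ->
  resolv u lamp - resolv u x = (lamp - cl x) / ((u - lamp) * (u - cl x)).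
Proof.
move=> lu; rewrite /resolv (@clampK_id _ _ _ lamp) ?lam_le ?lexx// -/(cl x).
have := clK x => /andP[h1 h2].
by field; rewrite !gt_eqF//; lra.
Qed.

Let gap_lamm u x : lamp < u ->
  resolv u x - resolv u lamm = (cl x - lamm) / ((u - cl x) * (u - lamm)).
Proof.
move=> lu; rewrite /resolv (@clampK_id _ _ _ lamm) ?lam_le ?lexx// -/(cl x).
have := clK x => /andP[h1 h2].
by field; rewrite !gt_eqF//; lra.
Qed.

Let bcl : bcont cl.
Proof. by apply: (bcont_clampK lam_le (f := id)) => x; exact: cvg_id. Qed.

(** Only [theta] up to this value matter: beyond it, [Gfun t theta >= theta] exceeds
    [2 * Fnice t + 1] for every [t] of level [a]. *)
Let M_ a := Fbound a + 1.

Let M_gt a : 0 <= a -> lamp + 1 < M_ a.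
Proof.
move=> a0; rewrite /M_ /Fbound.
have : 0 <= Gamma * (4 * a + 2) by rewrite mulr_ge0 ?(ltW Gamma_gt0)//; lra.
lra.
Qed.

Let frac_ge (y p q M : R) : 0 <= y -> 0 < p -> 0 < q -> p <= M -> q <= M ->
  y / M ^+ 2 <= y / (p * q).
Proof.
move=> y0 p0 q0 pM qM; rewrite ler_wpM2l// lef_pV2 ?posrE ?exprn_gt0 ?mulr_gt0//.
- by rewrite expr2 ler_pM// ltW.
- exact: lt_le_trans pM.
Qed.

(** The fraction of a probability measure that can be moved to an edge with the budget increase
    [2 * (a' - a)]: scaling by 1 - k and adding an atom of mass k costs exactly - ln (1 - k). *)
Let weight (a a' : R) := 1 - expR (- (2 * (a' - a))).

Let weight01 a a' : a < a' -> 0 < weight a a' < 1.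
Proof.
move=> aa; rewrite /weight; have := expR_gt0 (- (2 * (a' - a))).
suff : expR (- (2 * (a' - a))) < 1 by lra.
by rewrite -[ltRHS]expR0 ltr_expR; lra.
Qed.

Let ln_weight a a' : ln (1 - weight a a') = - (2 * (a' - a)).
Proof. by rewrite /weight subKr expRK. Qed.

(* Mass is added at lamp (Gaussian case) or moved to lamp (Haar case). *)
Lemma push_up haar a a' : 0 <= a -> a < a' ->
  (exists2 k, 0 < k & forall t, level haar a t ->
     exists2 t', level haar a' t' & Fnice t + k <= Fnice t') \/
  (forall t, level haar a t -> Fnice t <= Fnice base).
Proof.
move=> a0 aa; have MA := M_gt a0.
have up t t' c : 0 <= c -> level haar a t -> valid t' ->
    (forall u, lamp < u <= M_ a -> Gfun t u + c <= Gfun t' u) ->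
    Fnice t + Num.min 1 c / 2 <= Fnice t'.
  move=> c0 lt vt' H; have [vt _ _] := lt.
  suff : 2 * Fnice t + Num.min 1 c <= 2 * Fnice t' by lra.
  apply: half_inf_ge => u lu; have [uM|uM] := leP u (M_ a).
    have : Num.min 1 c <= c by rewrite ge_min lexx orbT.
    have := half_inf_le (slow_Gfun vt) lu; rewrite -/(Fnice t).
    by have := H u; rewrite lu uM => /(_ isT); lra.
  have : Num.min 1 c <= 1 by rewrite ge_min lexx.
  have := proj1 (slow_Gfun vt') _ lu; have := Fnice_le lt.
  by move: uM; rewrite /M_; lra.
case: haar up => up; last first.
  left; pose b := 2 * (a' - a); have b0 : 0 < b by rewrite /b; lra.
  pose c := Gamma * (b * (M_ a - lamp)^-1).
  have c0 : 0 < c by rewrite /c mulr_gt0// mulr_gt0// invr_gt0; lra.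
  exists (Num.min 1 c / 2); first by rewrite divr_gt0// lt_min ltr01.
  move=> t lt; have [vt ht _] := lt.
  have vt' : valid (add_atoms 0 b t) by apply: valid_add_atoms => //; exact: ltW.
  exists (add_atoms 0 b t).
    by split => //; rewrite hcost_add_atoms /b; lra.
  apply: up => //; first exact: ltW.
  move=> u /andP[lu uM]; rewrite /Gfun tint_add_atoms.
  suff : c <= Gamma * (b * resolv u lamp) by lra.
  rewrite /c !ler_pM2l// resolvE ?lexx ?lam_le//.
  by rewrite lef_pV2 ?posrE; lra.
(* If [q] sits at [lamp], moving mass there gains nothing, but then [q] itself maximises the
   functional among probability measures. *)
have [p0|p0] := ltP 0 (E (fun x => lamp - cl x)); last first.
  right => t [vt _ m1].
  suff : 2 * Fnice t <= 2 * Fnice base by lra.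
  apply: half_inf_ge => u lu.
  apply: le_trans (half_inf_le (slow_Gfun vt) lu) _.
  rewrite /Gfun lerD2l ler_pM2l// tint_base.
  apply: (@le_trans _ _ (resolv u lamp)).
    rewrite -[leRHS]mulr1 -(m1 isT) -(tint_cst mE)//.
    apply: (tint_le lam_le mE) => //; [exact: bR|exact: bcont_cst|].
    by move=> x _; exact: resolv_le_lamp.
  rewrite -subr_le0 -(mean_cst mE (resolv u lamp)) -(meanB mE); [|exact: bcont_cst|exact: bR].
  apply: (@le_trans _ _ (E (fun x => ((u - lamp) ^+ 2)^-1 * (lamp - cl x)))).
    have [_ _ _ Ele] := mE; apply: Ele.
    - by apply: bcontB; [exact: bcont_cst|exact: bR].
    - by apply: bcontZ; apply: bcontB => //; exact: bcont_cst.
    - move=> x _; rewrite gap_lamp// mulrC ler_wpM2r//; first by have /andP[h1 h2] := clK x; lra.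
      rewrite lef_pV2 ?posrE ?exprn_gt0 ?mulr_gt0//; have := clK x; try lra.
      by move=> /andP[h1 h2]; rewrite expr2 ler_pM//; lra.
  have [_ EZ _ _] := mE; rewrite EZ; last by apply: bcontB => //; exact: bcont_cst.
  by rewrite mulr_ge0_le0// invr_ge0 sqr_ge0.
left.
have g0 x : 0 <= lamp - cl x by have /andP[h1 h2] := clK x; lra.
(* Measures of bounded cost keep a definite mean distance to [lamp], so replacing a fixed fraction
   of them by an atom raises [Gfun] by a fixed amount for all relevant [theta]. *)
have [k0 k0p H] := coercivity mE (2 * a) (bcontB (bcont_cst lamp) bcl) g0 p0.
pose k := weight a a'; have /andP[kp k1] : 0 < k < 1 := weight01 aa.
pose c := Gamma * (k * (k0 / (M_ a - lamm) ^+ 2)).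
have Ml : 0 < M_ a - lamm.
  by rewrite subr_gt0 (le_lt_trans lam_le)// (lt_trans _ MA)// ltrDl.
have c0 : 0 < c by rewrite /c mulr_gt0// mulr_gt0// divr_gt0// exprn_gt0.
exists (Num.min 1 c / 2); first by rewrite divr_gt0// lt_min ltr01.
move=> t lt; have [vt ht m1] := lt.
have vs : valid (scale (1 - k) t) by apply: valid_scale => //; lra.
have vt' : valid (add_atoms 0 k (scale (1 - k) t)).
  by apply: valid_add_atoms => //; exact: ltW.
exists (add_atoms 0 k (scale (1 - k) t)).
  split => //.
    rewrite hcost_add_atoms (hcost_scale mE)//; last lra.
    by rewrite ln_weight m1// -/k; lra.
  by move=> _; rewrite tint_add_atoms (tint_scale mE) ?m1//; [lra|exact: bcont_cst].
apply: up => //; first exact: ltW.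
move=> u /andP[lu uM]; rewrite /Gfun tint_add_atoms (tint_scale mE)//; last exact: bR.
suff : k0 / (M_ a - lamm) ^+ 2 <= resolv u lamp - tint t (resolv u).
  by move=> /(ler_wpM2l (ltW kp))/(ler_wpM2l (ltW Gamma_gt0)); rewrite -/c; lra.
have -> : resolv u lamp - tint t (resolv u) = tint t (fun x => resolv u lamp - resolv u x).
  rewrite (tintD mE) ?(tintN mE)//; [|exact: bR|exact: bcont_cst|exact/bcontN/bR].
  by rewrite (tint_cst mE)// m1// mulr1.
apply: (@le_trans _ _ (tint t (fun x => ((M_ a - lamm) ^+ 2)^-1 * (lamp - cl x)))).
  rewrite (tintZ mE)//; last by apply: bcontB => //; exact: bcont_cst.
  by rewrite mulrC ler_wpM2l ?invr_ge0 ?sqr_ge0// H.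
apply: (tint_le lam_le mE) => //.
- by apply: bcontZ; apply: bcontB => //; exact: bcont_cst.
- by apply: bcontB; [exact: bcont_cst|exact: bR].
- move=> x _; rewrite gap_lamp// mulrC; have := clK x => /andP[h1 h2].
  by apply: frac_ge => //; lra.
Qed.

(** Mass is removed (Gaussian case) or moved to [lamm] (Haar case), and coercivity makes the
    decrease uniform over the level. The second alternative is taken only when [q] sits at [lamm],
    where [q] is already minimal. The gain is read off at a nearly optimal [theta] for [t]. *)
Lemma push_down haar a a' : 0 <= a -> a < a' ->
  (exists2 k, 0 < k & forall t, level haar a t ->
     exists2 t', level haar a' t' & Fnice t' + k <= Fnice t) \/
  (forall t, level haar a t -> Fnice base <= Fnice t).
Proof.
move=> a0 aa; have MA := M_gt a0.
have dn t t' c : 0 < c -> level haar a t -> valid t' ->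
    (forall u, lamp < u <= M_ a -> Gfun t' u + c <= Gfun t u) ->
    Fnice t' + c / 4 <= Fnice t.
  move=> c0 lt vt' H; have [vt _ _] := lt.
  have e0 : 0 < Num.min 1 (c / 2) by rewrite lt_min ltr01 divr_gt0.
  have [u lu Gu] : exists2 u, lamp < u & Gfun t u < 2 * Fnice t + Num.min 1 (c / 2).
    by apply: half_inf_lt; rewrite -/(Fnice t); lra.
  have : Num.min 1 (c / 2) <= 1 by rewrite ge_min lexx.
  have : Num.min 1 (c / 2) <= c / 2 by rewrite ge_min lexx orbT.
  have := proj1 (slow_Gfun vt) _ lu; have := Fnice_le lt => h1 h2 h3 h4.
  have uM : u <= M_ a by rewrite /M_; lra.
  have := H u; rewrite lu uM => /(_ isT).
  by have := half_inf_le (slow_Gfun vt') lu; rewrite -/(Fnice t'); lra.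
pose k := weight a a'; have /andP[kp k1] : 0 < k < 1 := weight01 aa.
have Ml : 0 < M_ a - lamm.
  by rewrite subr_gt0 (le_lt_trans lam_le)// (lt_trans _ MA)// ltrDl.
case: haar dn => dn; last first.
  left; have E0 : 0 < E (fun=> 1) by case: mE => _ _ -> _.
  have [k0 k0p H] := coercivity mE (2 * a) (bcont_cst 1) (fun x => ler01) E0.
  pose c := Gamma * (k * (k0 * (M_ a - lamm)^-1)).
  have c0 : 0 < c by rewrite /c mulr_gt0// mulr_gt0// mulr_gt0// invr_gt0.
  exists (c / 4); first by rewrite divr_gt0.
  move=> t lt; have [vt ht _] := lt.
  have vs : valid (scale (1 - k) t) by apply: valid_scale => //; lra.
  exists (scale (1 - k) t).
    split => //; rewrite (hcost_scale mE)//; last lra.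
    rewrite ln_weight; have := mulr_ge0 (ltW kp) (ltW (tint1_gt0 mE vt)); lra.
  apply: dn => // u /andP[lu uM]; rewrite /Gfun (tint_scale mE)//; last exact: bR.
  suff : k0 * (M_ a - lamm)^-1 <= tint t (resolv u).
    by move=> /(ler_wpM2l (ltW kp))/(ler_wpM2l (ltW Gamma_gt0)); rewrite -/c; lra.
  apply: (@le_trans _ _ (tint t (fun=> (M_ a - lamm)^-1))).
    by rewrite (tint_cst mE)// mulrC ler_wpM2l ?invr_ge0 ?(ltW Ml)// H.
  apply: (tint_le lam_le mE) => //; [exact: bcont_cst|exact: bR|].
  by move=> x _; rewrite lef_pV2 ?posrE//; have := clK x; rewrite -/(cl x); lra.
have [p0|p0] := ltP 0 (E (fun x => cl x - lamm)); last first.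
  right => t [vt _ m1].
  suff : 2 * Fnice base <= 2 * Fnice t by lra.
  apply: half_inf_ge => u lu.
  apply: le_trans (half_inf_le (slow_Gfun valid_base) lu) _.
  rewrite /Gfun lerD2l ler_pM2l// tint_base.
  apply: (@le_trans _ _ (resolv u lamm)); last first.
    rewrite -[leLHS]mulr1 -(m1 isT) -(tint_cst mE)//.
    apply: (tint_le lam_le mE) => //; [exact: bcont_cst|exact: bR|].
    by move=> x _; exact: resolv_ge_lamm.
  rewrite -subr_le0 -(mean_cst mE (resolv u lamm)) -(meanB mE); [|exact: bR|exact: bcont_cst].
  apply: (@le_trans _ _ (E (fun x => ((u - lamp) ^+ 2)^-1 * (cl x - lamm)))).
    have [_ _ _ Ele] := mE; apply: Ele.
    - by apply: bcontB; [exact: bR|exact: bcont_cst].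
    - by apply: bcontZ; apply: bcontB => //; exact: bcont_cst.
    - move=> x _; rewrite gap_lamm// mulrC ler_wpM2r//; first by have /andP[h1 h2] := clK x; lra.
      rewrite lef_pV2 ?posrE ?exprn_gt0 ?mulr_gt0//; have := clK x; try lra.
      by move=> /andP[h1 h2]; rewrite expr2 ler_pM//; lra.
  have [_ EZ _ _] := mE; rewrite EZ; last by apply: bcontB => //; exact: bcont_cst.
  by rewrite mulr_ge0_le0// invr_ge0 sqr_ge0.
left.
have g0 x : 0 <= cl x - lamm by have /andP[h1 h2] := clK x; lra.
have [k0 k0p H] := coercivity mE (2 * a) (bcontB bcl (bcont_cst lamm)) g0 p0.
pose c := Gamma * (k * (k0 / (M_ a - lamm) ^+ 2)).
have c0 : 0 < c by rewrite /c mulr_gt0// mulr_gt0// divr_gt0// exprn_gt0.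
exists (c / 4); first by rewrite divr_gt0.
move=> t lt; have [vt ht m1] := lt.
have vs : valid (scale (1 - k) t) by apply: valid_scale => //; lra.
have vt' : valid (add_atoms k 0 (scale (1 - k) t)).
  by apply: valid_add_atoms => //; exact: ltW.
exists (add_atoms k 0 (scale (1 - k) t)).
  split => //.
    rewrite hcost_add_atoms (hcost_scale mE)//; last lra.
    by rewrite ln_weight m1// -/k; lra.
  by move=> _; rewrite tint_add_atoms (tint_scale mE) ?m1//; [lra|exact: bcont_cst].
apply: dn => //.
move=> u /andP[lu uM]; rewrite /Gfun tint_add_atoms (tint_scale mE)//; last exact: bR.
suff : k0 / (M_ a - lamm) ^+ 2 <= tint t (resolv u) - resolv u lamm.
  by move=> /(ler_wpM2l (ltW kp))/(ler_wpM2l (ltW Gamma_gt0)); rewrite -/c; lra.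
have -> : tint t (resolv u) - resolv u lamm = tint t (fun x => resolv u x - resolv u lamm).
  rewrite (tintD mE)//; [|exact: bR|exact: bcont_cst].
  by rewrite (tint_cst mE)// m1// mulr1.
apply: (@le_trans _ _ (tint t (fun x => ((M_ a - lamm) ^+ 2)^-1 * (cl x - lamm)))).
  rewrite (tintZ mE)//; last by apply: bcontB => //; exact: bcont_cst.
  by rewrite mulrC ler_wpM2l ?invr_ge0 ?sqr_ge0// H.
apply: (tint_le lam_le mE) => //.
- by apply: bcontZ; apply: bcontB => //; exact: bcont_cst.
- by apply: bcontB; [exact: bR|exact: bcont_cst].
- move=> x _; rewrite gap_lamm// mulrC; have := clK x => /andP[h1 h2].
  by apply: frac_ge => //; lra.
Qed.

Definition Fvalues haar a := [set Fnice t | t in [set t | level haar a t]].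
Definition Fmax haar a := sup (Fvalues haar a).
Definition Fmin haar a := inf (Fvalues haar a).

Let Fvalues_base haar a : 0 <= a -> Fvalues haar a (Fnice base).
Proof. by move=> a0; exists base => //; exact: level_base. Qed.

Let has_sup_Fvalues haar a : 0 <= a -> has_sup (Fvalues haar a).
Proof.
move=> a0; split; first by exists (Fnice base); exact: Fvalues_base.
by exists (Fbound a / 2) => _ [t lt <-]; have := Fnice_le lt; lra.
Qed.

Let has_inf_Fvalues haar a : 0 <= a -> has_inf (Fvalues haar a).
Proof.
move=> a0; split; first by exists (Fnice base); exact: Fvalues_base.
by exists (lamp / 2) => _ [t [vt _ _] <-]; have := Fnice_ge vt; lra.
Qed.

Lemma Fnice_le_max haar a t : 0 <= a -> level haar a t -> Fnice t <= Fmax haar a.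
Proof. by move=> a0 lt; apply: (ub_le_sup (proj2 (has_sup_Fvalues haar a0))); exists t. Qed.

Lemma Fnice_ge_min haar a t : 0 <= a -> level haar a t -> Fmin haar a <= Fnice t.
Proof. by move=> a0 lt; apply: (ge_inf (proj2 (has_inf_Fvalues haar a0))); exists t. Qed.

(** The extreme values at level [a] may fail to be attained. The slightly larger budget [a'] passes
    them by a uniform amount, and the intermediate values are filled in by mixing. *)
Lemma Fvalues_interval haar a a' m : 0 <= a -> a < a' ->
  Fmin haar a <= m <= Fmax haar a -> exists2 t, level haar a' t & Fnice t = m.
Proof.
move=> a0 aa /andP[mm mM]; have a'0 : 0 <= a' by lra.
have [t1 l1 F1] : exists2 t, level haar a' t & Fnice t <= Fmin haar a.
  have [[k kp H]|H] := push_down haar a0 aa.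
    have [_ [t lt <-] Ft] := inf_adherent kp (has_inf_Fvalues haar a0).
    have [t' lt' Ft'] := H _ lt; exists t' => //.
    by move: Ft; rewrite -/(Fmin haar a); lra.
  exists base; first exact: level_base.
  apply: lb_le_inf; first by case: (has_inf_Fvalues haar a0).
  by move=> _ [t lt <-]; exact: H.
have [t2 l2 F2] : exists2 t, level haar a' t & Fmax haar a <= Fnice t.
  have [[k kp H]|H] := push_up haar a0 aa.
    have [_ [t lt <-] Ft] := sup_adherent kp (has_sup_Fvalues haar a0).
    have [t' lt' Ft'] := H _ lt; exists t' => //.
    by move: Ft; rewrite -/(Fmax haar a); lra.
  exists base; first exact: level_base.
  apply: ge_sup; first by case: (has_sup_Fvalues haar a0).
  by move=> _ [t lt <-]; exact: H.
apply: (Fnice_intermediate l1 l2); lra.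
Qed.

End sublevels.

(** * Borel sets of matrices and product laws *)

Section borel_matrix.
Context {R : realType} (m n : nat).
Local Notation M := 'M[R]_(m, n).

Lemma continuous_measurable_mx (f : M -> R) : continuous f ->
  measurable_fun [set: borel_mx R m n] (f : borel_mx R m n -> measurableTypeR R).
Proof.
move=> cf; apply: (measurability _ (RGenOInfty.measurableE R)).
move=> _ [_ [x ->] <-]; rewrite setTI.
by apply: sub_sigma_algebra; move/continuousP: cf; apply; exact: interval_open.
Qed.

Lemma measurable_coord i j :
  measurable_fun [set: borel_mx R m n] (fun x : borel_mx R m n => (x : M) i j : measurableTypeR R).
Proof. by apply: continuous_measurable_mx; exact: coord_continuous. Qed.

Definition box (c : 'M[rat]_(m, n)) (r : rat) : set M :=
  [set x | forall i j, `|ratr (c i j) - x i j| < ratr r].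

Lemma open_sup_ball (U : set M) x : open U -> U x ->
  exists2 e : R, 0 < e & forall y : M, (forall i j, `|x i j - y i j| < e) -> U y.
Proof.
move=> oU Ux; have : nbhs x U by rewrite openE in oU; exact: oU.
by move=> /nbhs_ballP[e e0 eU]; exists e => // y xy; apply: eU; split.
Qed.

(** Boxes with rational centre and radius form a countable base, so that measurability can be tested
    coordinatewise. *)
Lemma open_box_cover (U : set M) : open U ->
  U = \bigcup_(cr in [set cr : 'M[rat]_(m, n) * rat | box cr.1 cr.2 `<=` U]) box cr.1 cr.2.
Proof.
move=> oU; apply/seteqP; split => [x Ux|x [[c r] /= cU cx]]; last exact: cU.
have [e e0 eU] := open_sup_ball oU Ux.
have [r /andP[r0 re]] : exists r : rat, 0 < (ratr r : R) < e / 2.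
  have e2 : 0 < e / 2 by rewrite divr_gt0.
  have [r] := rat_in_itvoo e2.
  by rewrite in_itv/= => h; exists r.
have cex i j : exists c : rat, `|ratr c - x i j| < ratr r.
  have lt : x i j - ratr r < x i j + ratr r by lra.
  have [c] := rat_in_itvoo lt.
  by rewrite in_itv/= => /andP[c1 c2]; exists c; rewrite ltr_norml; lra.
pose c : 'M[rat]_(m, n) := \matrix_(i, j) projT1 (cid (cex i j)).
have cP i j : `|ratr (c i j) - x i j| < ratr r by rewrite mxE; case: cid.
exists (c, r) => //= y yb; apply: eU => i j.
have -> : x i j - y i j = - (ratr (c i j) - x i j) + (ratr (c i j) - y i j) by ring.
rewrite (le_lt_trans (ler_normD _ _))// normrN.
by have := cP i j; have := yb i j; rewrite /=; lra.
Qed.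

Lemma measurable_mx d (T : measurableType d) (f : T -> M) :
  (forall i j, measurable_fun [set: T] (fun t => f t i j : measurableTypeR R)) ->
  measurable_fun [set: T] (f : T -> borel_mx R m n).
Proof.
move=> mf; apply: (@measurability _ _ T (borel_mx R m n) setT f (@open M) erefl).
move=> _ [U oU <-]; rewrite setTI (open_box_cover oU) preimage_bigcup bigcup_mkcond.
apply: countable_bigcupT_measurable; first exact: countableP.
move=> [c r]; case: ifP => // _ /=.
have -> : f @^-1` box c r =
    \bigcap_i \bigcap_j [set t | `|ratr (c i j) - f t i j| < ratr r].
  by apply/seteqP; split => t /= h; [move=> i _ j _; exact: h|move=> i j; exact: h].
apply: fin_bigcap_measurable; first exact: finite_finset.
move=> i _; apply: fin_bigcap_measurable; first exact: finite_finset.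
move=> j _; rewrite -[X in measurable X]setTI.
have mg : measurable_fun [set: T] (fun t => `|ratr (c i j) - f t i j| : measurableTypeR R).
  apply: measurableT_comp; first exact: normr_measurable.
  by apply: measurable_funB; [exact: measurable_cst|exact: mf].
have -> : [set t | `|ratr (c i j) - f t i j| < ratr r] =
  (fun t => `|ratr (c i j) - f t i j|) @^-1` `]-oo, ratr r[.
  by apply/seteqP; split => t /=; rewrite in_itv.
exact: mg.
Qed.

End borel_matrix.

(** * Rectangles as a generating family *)

Section rectangles.
Context {R : realType} (n : nat).
Local Notation V := (borel_mx R n 1).
Local Notation TR := (measurableTypeR R).

Definition rect (B : 'I_n -> set TR) : set V := [set x : 'cV[R]_n | forall i, B i (x i ord0)].

Lemma measurable_rect B : (forall i, measurable (B i)) -> measurable (rect B).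
Proof.
move=> mB; have -> : rect B = \bigcap_i ((fun x : 'cV[R]_n => x i ord0) @^-1` B i).
  by apply/seteqP; split => x /= h; [move=> i _; exact: h|move=> i; exact: h].
apply: fin_bigcap_measurable; first exact: finite_finset.
move=> i _; rewrite -[X in measurable X]setTI.
by apply: measurable_coord.
Qed.

Definition rectangles := [set rect B | B in [set B | forall i, measurable (B i)]].

Lemma borel_generated_rect : (@measurable _ V) = <<s rectangles >>.
Proof.
apply/seteqP; split; last first.
  apply: smallest_sub; first exact: sigma_algebra_measurable.
  by move=> _ [B mB <-]; exact: measurable_rect.
apply: smallest_sub; first exact: smallest_sigma_algebra.
move=> U oU; rewrite (open_box_cover oU) bigcup_mkcond.
pose T := g_sigma_algebraType rectangles.
have H : @measurable _ T (\bigcup_i (if i \in [set cr | box cr.1 cr.2 `<=` U] then box i.1 i.2 else set0)).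
  apply: (@countable_bigcupT_measurable _ T); first exact: countableP.
  move=> [c r]; case: ifP => // _ /=; apply: sub_sigma_algebra.
  exists (fun i => [set y : R | `|ratr (c i ord0) - y| < ratr r]).
    move=> i /=; rewrite -[X in measurable X]setTI.
    have mg : measurable_fun [set: TR] (fun t : TR => `|ratr (c i ord0) - t| : TR).
      apply: measurableT_comp; first exact: normr_measurable.
      by apply: measurable_funB; [exact: measurable_cst|exact: measurable_id].
    have -> : [set y : R | `|ratr (c i ord0) - y| < ratr r] =
      (fun t => `|ratr (c i ord0) - t|) @^-1` `]-oo, ratr r[.
      by apply/seteqP; split => t /=; rewrite in_itv.
    exact: mg.
  apply/seteqP; split => x /= h; last by move=> i; exact: h.
  by move=> i j; rewrite (ord1 j); exact: h.
exact: H.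
Qed.

Lemma rect_unique (m1 m2 : {measure set V -> \bar R}) :
  (m1 setT < +oo)%E ->
  (forall B : 'I_n -> set TR, (forall i, measurable (B i)) -> m1 (rect B) = m2 (rect B)) ->
  forall A, measurable A -> m1 A = m2 A.
Proof.
move=> m1oo m12 A mA.
apply: (measure_unique rectangles (fun=> setT)) => //.
- exact: borel_generated_rect.
- move=> _ _ [B mB <-] [C mC <-]; exists (fun i => B i `&` C i).
    by move=> i; apply: measurableI.
  by apply/seteqP; split => x /= h; [split => i; case: (h i)|move=> i; split; [exact: h.1|exact: h.2]].
- by move=> _; exists (fun=> setT) => //; apply/seteqP; split.
- by rewrite bigcup_const//; exists 0%N.
- by move=> _ [B mB <-]; exact: m12.
Qed.

End rectangles.

Lemma emeasurable_prod d (T : measurableType d) (R : realType) (I : Type) (s : seq I)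
    (g : I -> T -> \bar R) :
  (forall i, measurable_fun setT (g i)) ->
  measurable_fun setT (fun x => \prod_(i <- s) g i x)%E.
Proof.
move=> mg; elim: s => [|i s IH].
  by under eq_fun do rewrite big_nil; exact: measurable_cst.
by under eq_fun do rewrite big_cons; exact: emeasurable_funM.
Qed.

Definition push_prob d d' (T : measurableType d) (T' : measurableType d') (R : realType)
  (P : probability T R) (f : T -> T') (mf : measurable_fun setT f) : probability T' R :=
  let mixin := isMeasurableFun.Build _ _ _ _ f mf in
  let X : {RV P >-> T'} := HB.pack f mixin in distribution P X.

Lemma push_probE d d' (T : measurableType d) (T' : measurableType d') (R : realType)
  (P : probability T R) (f : T -> T') (mf : measurable_fun setT f) A :
  push_prob P mf A = P (f @^-1` A).
Proof. by []. Qed.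

(** * Product laws on column vectors *)

Section product_law.
Context {R : realType}.
Local Notation TR := (measurableTypeR R).

Definition prod_law n (p : 'I_n -> probability TR R) (mu : probability (borel_mx R n 1) R) :=
  forall B : 'I_n -> set TR, (forall i, measurable (B i)) ->
    mu (rect B) = (\prod_(i < n) p i (B i))%E.

Definition cons_cv n (xv : TR * borel_mx R n 1) : borel_mx R n.+1 1 :=
  col_mx (const_mx xv.1 : 'M[R]_1) (xv.2 : 'cV[R]_n) : 'M[R]_(1 + n, 1).

Lemma cons_cv0 n xv : (@cons_cv n xv : 'cV[R]_n.+1) ord0 ord0 = xv.1.
Proof.
have := col_mxEu (const_mx xv.1 : 'M[R]_1) (xv.2 : 'cV[R]_n) ord0 ord0.
rewrite [RHS]mxE => e; apply: etrans e; congr (fun_of_matrix _ _ ord0); exact: val_inj.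
Qed.

Lemma cons_cvS n xv i : (@cons_cv n xv : 'cV[R]_n.+1) (lift ord0 i) ord0 = (xv.2 : 'cV[R]_n) i ord0.
Proof.
have e := col_mxEd (const_mx xv.1 : 'M[R]_1) (xv.2 : 'cV[R]_n) i ord0.
apply: etrans e; congr (fun_of_matrix _ _ ord0); exact: val_inj.
Qed.

Lemma measurable_cons_cv n : measurable_fun setT (@cons_cv n).
Proof.
apply: measurable_mx => i j; rewrite (ord1 j).
have [k ->|->] := unliftP ord0 i.
  have -> : (fun t => (@cons_cv n t : 'cV[R]_n.+1) (lift ord0 k) ord0) =
    (fun x : borel_mx R n 1 => (x : 'cV[R]_n) k ord0 : TR) \o snd.
    by apply/funext => t; rewrite cons_cvS.
  by apply: measurableT_comp; [exact: measurable_coord|exact: measurable_snd].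
have -> : (fun t => (@cons_cv n t : 'cV[R]_n.+1) ord0 ord0) = fst.
  by apply/funext => t; rewrite cons_cv0.
exact: measurable_fst.
Qed.

Lemma cons_cv_rect n (B : 'I_n.+1 -> set TR) :
  @cons_cv n @^-1` rect B = B ord0 `*` rect (fun i => B (lift ord0 i)).
Proof.
apply/seteqP; split => -[x v] /=.
  move=> h; split => /=; first by have := h ord0; rewrite cons_cv0.
  by move=> i; have := h (lift ord0 i); rewrite cons_cvS.
move=> [/= h1 h2] i; have [k ->|->] := unliftP ord0 i.
  by rewrite cons_cvS; exact: h2.
by rewrite cons_cv0.
Qed.

Lemma prod_law_cons n (p : 'I_n.+1 -> probability TR R) mu :
  prod_law (fun i => p (lift ord0 i)) mu ->
  prod_law p (push_prob (p ord0 \x mu)%E (@measurable_cons_cv n)).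
Proof.
move=> H B mB; rewrite push_probE cons_cv_rect.
apply: (etrans (product_measure1E _ _ (mB ord0) (measurable_rect _))) => //.
by rewrite big_ord_recl; congr (_ * _)%E; apply: (H (fun i => B (lift ord0 i))) => i; exact: mB.
Qed.

Lemma prod_law_exists n (p : 'I_n -> probability TR R) : exists mu, prod_law p mu.
Proof.
elim: n p => [|n IH] p.
  exists (@dirac _ (borel_mx R 0 1) (0 : 'cV[R]_0) R) => B mB.
  by rewrite big_ord0 /= /dirac/= indicE mem_set// => -[].
have [mu H] := IH (fun i => p (lift ord0 i)).
by exists (push_prob (p ord0 \x mu)%E (@measurable_cons_cv n)); exact: prod_law_cons.
Qed.

Lemma prod_law_unique n (p : 'I_n -> probability TR R) mu nu A :
  prod_law p mu -> prod_law p nu -> measurable A -> mu A = nu A.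
Proof.
move=> H1 H2 mA; apply: rect_unique => //; first exact: (eq_ind_r (fun x => (x < +oo)%E) (ltry 1) (probability_setT mu)).
by move=> B mB; apply: etrans (H1 B mB) _; apply/esym; exact: H2.
Qed.

(** Tonelli after splitting off the first coordinate. By uniqueness of product laws, [nu] may be any
    realisation, not only the constructed one. *)
Lemma prod_law_integral_cons n (p : 'I_n.+1 -> probability TR R) mu nu f :
  prod_law (fun i => p (lift ord0 i)) mu -> prod_law p nu ->
  measurable_fun setT f -> (forall x, 0 <= f x)%E ->
  (\int[nu]_x f x = \int[p ord0]_x \int[mu]_v f (@cons_cv n (x, v)))%E.
Proof.
move=> H1 H2 mf f0.
have H3 := prod_law_cons H1.
rewrite (eq_measure_integral (push_prob (p ord0 \x mu)%E (@measurable_cons_cv n))); last first.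
  by move=> A mA _; exact: prod_law_unique H2 H3 mA.
rewrite [LHS](@ge0_integral_pushforward _ _ _ _ _ _ (@measurable_cons_cv n) (p ord0 \x mu)%E setT)//.
rewrite preimage_setT fubini_tonelli1//=.
by apply: measurableT_comp => //; exact: measurable_cons_cv.
Qed.

Lemma prod_law_integral n (p : 'I_n -> probability TR R) mu (u : 'I_n -> TR -> \bar R) :
  prod_law p mu -> (forall i, measurable_fun setT (u i)) -> (forall i x, 0 <= u i x)%E ->
  (\int[mu]_x \prod_(i < n) u i ((x : 'cV[R]_n) i ord0) = \prod_(i < n) \int[p i]_x u i x)%E.
Proof.
elim: n p mu u => [|n IH] p mu u H mu_ u0.
  under eq_integral do rewrite big_ord0.
  by rewrite big_ord0 integral_cst// mul1e; exact: probability_setT.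
have [nu Hnu] := prod_law_exists (fun i => p (lift ord0 i)).
have mprod k (w : 'I_k -> TR -> \bar R) : (forall i, measurable_fun setT (w i)) ->
  measurable_fun [set: borel_mx R k 1] (fun x : borel_mx R k 1 => \prod_(i < k) w i ((x : 'cV[R]_k) i ord0))%E.
  move=> mw; apply: emeasurable_prod => i.
  exact: (measurableT_comp (mw i) (@measurable_coord R k 1 i ord0)).
rewrite (prod_law_integral_cons Hnu H)//; last 2 first.
- exact: mprod.
- by move=> x; apply: prode_ge0.
rewrite big_ord_recl -(IH _ nu (fun i => u (lift ord0 i)) Hnu (fun i => mu_ _) (fun i => u0 _)).
under eq_integral => x _.
  under eq_integral => v _.
    rewrite big_ord_recl cons_cv0/=.
    under eq_bigr do rewrite cons_cvS/=.
    over.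
  rewrite ge0_integralZl//; last 2 first.
  - exact: (mprod n (fun i => u (lift ord0 i)) (fun i => mu_ _)).
  - by move=> v _; apply: prode_ge0.
  over.
rewrite ge0_integralZr//.
by apply: integral_ge0 => v _; apply: prode_ge0.
Qed.

End product_law.

(** * Integration against a density *)

Section density.
Local Open Scope ereal_scope.
Context d (T : measurableType d) (R : realType).

(** Two densities with the same integrals agree almost everywhere, so [g] can replace the
    Radon-Nikodym derivative in the change of variables. *)
Lemma ge0_integral_density (mu : {sigma_finite_measure set T -> \bar R})
    (nu : {finite_measure set T -> \bar R}) (g f : T -> \bar R) :
  measurable_fun setT g -> (forall x, 0 <= g x) ->
  (forall A, measurable A -> nu A = \int[mu]_(x in A) g x) ->
  measurable_fun setT f -> (forall x, 0 <= f x) ->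
  \int[nu]_x f x = \int[mu]_x (f x * g x).
Proof.
move=> mg g0 nuE mf f0.
have numu : nu `<< mu.
  apply/null_content_dominatesP => A mA muA.
  by apply: etrans (nuE A mA) _; apply: null_set_integral => //; exact: measurable_funTS.
rewrite -(Radon_Nikodym_SigmaFinite.change_of_variables numu f0 measurableT)//.
have mRN := measurable_int _ (Radon_Nikodym_SigmaFinite.f_integrable numu).
apply: ge0_ae_eq_integral => //.
- exact: emeasurable_funM.
- exact: emeasurable_funM.
- by move=> x _; rewrite mule_ge0// Radon_Nikodym_SigmaFinite.f_ge0.
- by move=> x _; rewrite mule_ge0.
apply: ae_eqe_mul2l; apply: integral_ae_eq => //.
- exact: Radon_Nikodym_SigmaFinite.f_integrable.
- move=> A _ mA; rewrite -nuE//.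
  by rewrite -Radon_Nikodym_SigmaFinite.f_integral.
Qed.

End density.

(** * Rotation invariance of the Gaussian law *)

Section gauss_plane.
Context {R : realType}.
Local Notation TR := (measurableTypeR R).
Local Notation leb := (@lebesgue_measure R).
Local Notation gauss := (normal_prob (0 : R) 1).
Local Notation pdf := (@normal_pdf R 0 1).

Lemma ge0_integral_translate (f : TR -> \bar R) (c : R) :
  measurable_fun setT f -> (forall x, 0 <= f x)%E ->
  (\int[leb]_x f (x + c)%R = \int[leb]_x f x)%E.
Proof.
move=> mf f0.
have mc : measurable_fun [set: TR] (fun x : TR => x + c : TR) by exact: measurable_funD.
have trans A : measurable A -> pushforward leb (fun x : TR => x + c : TR) A = leb A.
  move=> mA; pose m := pushforward leb (fun x : TR => x + c : TR).
  apply/esym/(@lebesgue_measure_unique R) => //= _ [[a b]] _ <-.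
  rewrite /pushforward.
  have -> : (fun x => x + c) @^-1` `]a, b]%classic = `]a - c, b - c]%classic.
    apply/seteqP; split => x /=; rewrite !in_itv/= => /andP[h1 h2]; apply/andP; split; lra.
  rewrite !lebesgue_measure_itv/= !lte_fin ltrD2r.
  by case: ifP => // _; congr EFin; ring.
rewrite -[RHS](@eq_measure_integral _ _ _ _ _ (pushforward leb (fun x : TR => x + c : TR))); last first.
  by move=> A mA _; exact: trans.
by rewrite ge0_integral_pushforward.
Qed.

Lemma measurable_lin2 (a b c e : R) : measurable_fun [set: TR * TR]
  (fun xy : TR * TR => (a * xy.1 + b * xy.2, c * xy.1 + e * xy.2) : TR * TR).
Proof.
have lin (k l : R) : measurable_fun [set: TR * TR] (fun xy : TR * TR => k * xy.1 + l * xy.2 : TR).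
  apply: measurable_funD.
    by apply: measurable_funM; [exact: measurable_cst|exact: measurable_fst].
  by apply: measurable_funM; [exact: measurable_cst|exact: measurable_snd].
exact: measurable_fun_pair (lin _ _) (lin _ _).
Qed.

(** A rotation with s != 0 is a product of three shears, with coefficients (c - 1) / s, s and (c -
    1) / s. Each shear preserves the double integral by Tonelli and invariance under
    translations. *)
Lemma rotation_lebesgue (h : TR * TR -> \bar R) (c s : R) :
  measurable_fun setT h -> (forall x, 0 <= h x)%E -> c ^+ 2 + s ^+ 2 = 1 -> s != 0 ->
  (\int[leb]_x \int[leb]_y h (c * x - s * y, s * x + c * y)%R =
   \int[leb]_x \int[leb]_y h (x, y))%E.
Proof.
move=> mh h0 cs s0.
have shx (a : R) : measurable_fun [set: TR * TR] (fun xy : TR * TR => (xy.1 + a * xy.2, xy.2) : TR * TR).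
  rewrite (_ : (fun xy => _) = (fun xy => (1 * xy.1 + a * xy.2, 0 * xy.1 + 1 * xy.2))).
    exact: measurable_lin2.
  by apply/funext => xy; rewrite !mul1r mul0r add0r.
have shy (a : R) : measurable_fun [set: TR * TR] (fun xy : TR * TR => (xy.1, xy.2 + a * xy.1) : TR * TR).
  rewrite (_ : (fun xy => _) = (fun xy => (1 * xy.1 + 0 * xy.2, a * xy.1 + 1 * xy.2))).
    exact: measurable_lin2.
  by apply/funext => xy; rewrite !mul1r mul0r addr0 addrC.
have sh1 (g : TR * TR -> \bar R) (a : R) : measurable_fun setT g -> (forall x, 0 <= g x)%E ->
    (\int[leb]_x \int[leb]_y g (x + a * y, y)%R = \int[leb]_x \int[leb]_y g (x, y))%E.
  move=> mg g0.
  have mm := shx a.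
  apply: etrans (@fubini_tonelli _ _ _ _ _ leb leb
    (fun xy : TR * TR => g (xy.1 + a * xy.2, xy.2)%R) (measurableT_comp mg mm) (fun _ => g0 _)) _.
  apply/esym; apply: etrans (@fubini_tonelli _ _ _ _ _ leb leb g mg g0) _; apply/esym.
  apply: eq_integral => y _ /=.
  rewrite (@ge0_integral_translate (fun x => g (x, y)))//.
  by apply: measurableT_comp => //; exact: pair2_measurable.
have sh2 (g : TR * TR -> \bar R) (a : R) : measurable_fun setT g -> (forall x, 0 <= g x)%E ->
    (\int[leb]_x \int[leb]_y g (x, y + a * x)%R = \int[leb]_x \int[leb]_y g (x, y))%E.
  move=> mg g0; apply: eq_integral => x _ /=.
  rewrite (@ge0_integral_translate (fun y => g (x, y)))//.
  by apply: measurableT_comp => //; exact: pair1_measurable.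
pose a := (c - 1) / s.
have as1 : a * s = c - 1 by rewrite /a divfK.
have aas : a * (2 + a * s) = - s.
  apply: (mulIf s0); rewrite as1 mulrAC as1.
  have -> : (c - 1) * (2 + (c - 1)) = c ^+ 2 - 1 by ring.
  by rewrite -cs; ring.
pose h1 xy : \bar R := h (xy.1 + a * xy.2, xy.2)%R.
pose h2 xy : \bar R := h1 (xy.1, xy.2 + s * xy.1)%R.
have mh1 : measurable_fun [set: TR * TR] h1 := measurableT_comp mh (shx a).
have mh2 : measurable_fun [set: TR * TR] h2 := measurableT_comp mh1 (shy s).
rewrite -(sh1 h a mh h0) -(sh2 h1 s mh1 (fun _ => h0 _)) -(sh1 h2 a mh2 (fun _ => h0 _)).
apply: eq_integral => x _; apply: eq_integral => y _.
rewrite /h2 /h1/=; congr (h (_, _)).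
  have -> : x + a * y + a * (y + s * (x + a * y)) = x + (a * s) * x + (a * (2 + a * s)) * y by ring.
  by rewrite aas as1; ring.
have -> : y + s * (x + a * y) = s * x + y + (a * s) * y by ring.
by rewrite as1; ring.
Qed.

Lemma ge0_integral_gauss (f : TR -> \bar R) :
  measurable_fun setT f -> (forall x, 0 <= f x)%E ->
  (\int[gauss]_x f x = \int[leb]_x (f x * (pdf x)%:E))%E.
Proof.
move=> mf f0; apply: ge0_integral_density => //.
- by apply/measurable_EFinP; exact: measurable_normal_pdf.
- by move=> x; rewrite lee_fin normal_pdf_ge0.
Qed.

(** The product of the two densities is a function of x^2 + y^2, so the Lebesgue statement
    applies. *)
Lemma rotation_gauss (g : TR * TR -> \bar R) (c s : R) :
  measurable_fun setT g -> (forall x, 0 <= g x)%E -> c ^+ 2 + s ^+ 2 = 1 -> s != 0 ->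
  (\int[gauss]_x \int[gauss]_y g (c * x - s * y, s * x + c * y)%R =
   \int[gauss]_x \int[gauss]_y g (x, y))%E.
Proof.
move=> mg g0 cs s0.
have mpdf : measurable_fun [set: TR] (fun x : TR => (pdf x)%:E).
  by apply/measurable_EFinP; exact: measurable_normal_pdf.
have pdf0 x : (0 <= (pdf x)%:E)%E by rewrite lee_fin normal_pdf_ge0.
have key (k : TR * TR -> \bar R) : measurable_fun setT k -> (forall x, 0 <= k x)%E ->
    (\int[gauss]_x \int[gauss]_y k (x, y) =
     \int[leb]_x \int[leb]_y (k (x, y) * (pdf x * pdf y)%:E))%E.
  move=> mk k0; rewrite ge0_integral_gauss//; last 2 first.
  - exact: (@measurable_fun_fubini_tonelli_F _ _ _ _ _ gauss k mk k0).
  - by move=> x; apply: integral_ge0.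
  apply: eq_integral => x _.
  have mkx : measurable_fun setT (fun y => k (x, y)).
    by apply: measurableT_comp => //; exact: pair1_measurable.
  rewrite ge0_integral_gauss// -ge0_integralZr//.
  - by apply: eq_integral => y _; rewrite EFinM -muleA [((pdf y)%:E * _)%E]muleC.
  - by apply: emeasurable_funM.
  - by move=> y _; rewrite mule_ge0.
pose g' (xy : TR * TR) := g (c * xy.1 - s * xy.2, s * xy.1 + c * xy.2)%R.
have mg' : measurable_fun [set: TR * TR] g'.
  apply: (measurableT_comp mg).
  rewrite (_ : (fun xy => _) = (fun xy : TR * TR => (c * xy.1 + (- s) * xy.2, s * xy.1 + c * xy.2))).
    exact: measurable_lin2.
  by apply/funext => xy; rewrite mulNr.
pose h (xy : TR * TR) := (g xy * (pdf xy.1 * pdf xy.2)%:E)%E.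
have mh : measurable_fun [set: TR * TR] h.
  apply: emeasurable_funM => //; apply/measurable_EFinP; apply: measurable_funM.
    by apply: measurableT_comp; [exact: measurable_normal_pdf|exact: measurable_fst].
  by apply: measurableT_comp; [exact: measurable_normal_pdf|exact: measurable_snd].
have h0 xy : (0 <= h xy)%E by rewrite mule_ge0// lee_fin mulr_ge0// normal_pdf_ge0.
apply: etrans (key g' mg' (fun _ => g0 _)) _.
apply/esym; apply: etrans (key g mg g0) _; apply/esym.
apply: etrans (@rotation_lebesgue h c s mh h0 cs s0).
apply: eq_integral => x _; apply: eq_integral => y _.
rewrite /g' /h/=; congr (_ * _%:E)%E.
rewrite !normal_pdfE ?oner_neq0// /normal_fun.
rewrite mulrACA [RHS]mulrACA -!expRD; congr (_ * expR _).
rewrite !subr0 -!mulrDl; congr (_ / _).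
have -> : - (c * x - s * y) ^+ 2 + - (s * x + c * y) ^+ 2 =
  - ((c ^+ 2 + s ^+ 2) * (x ^+ 2 + y ^+ 2)) by ring.
by rewrite cs; ring.
Qed.

Lemma gauss_opp (A : set TR) : measurable A -> gauss ((fun x => - x) @^-1` A) = gauss A.
Proof.
move=> mA.
have mN : measurable_fun [set: TR] (fun x : TR => - x : TR) by exact: oppr_measurable.
have mpdf : measurable_fun [set: TR] (fun x : TR => (pdf x)%:E).
  by apply/measurable_EFinP; exact: measurable_normal_pdf.
rewrite /normal_prob.
rewrite -[RHS](@eq_measure_integral _ _ _ _ _ (pushforward leb (fun x : TR => - x : TR))); last first.
  by move=> B mB _; exact: lebesgue_measureN.
have pdf0 : {in A, forall y : TR, (0 <= (pdf y)%:E)%E}.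
  by move=> y _; rewrite lee_fin normal_pdf_ge0.
apply/esym; apply: etrans (ge0_integral_pushforward mN leb mA (measurable_funTS mpdf) pdf0) _; apply/esym.
apply: eq_integral => x _ /=; rewrite !normal_pdfE ?oner_neq0// /normal_fun.
by rewrite !subr0 sqrrN.
Qed.

End gauss_plane.

(** * Elementary transformations preserving the standard Gaussian law *)

Section orthogonal_invariance.
Context {R : realType}.
Local Notation TR := (measurableTypeR R).
Local Notation gauss := (normal_prob (0 : R) 1).
Local Notation V n := (borel_mx R n 1).

Definition gauss_law n (mu : probability (V n) R) := prod_law (fun=> gauss) mu.

Lemma measurable_preim d d' (T : measurableType d) (T' : measurableType d') (f : T -> T') A :
  measurable_fun setT f -> measurable A -> measurable (f @^-1` A).
Proof. by move=> mf mA; rewrite -[X in measurable X]setTI; exact: mf. Qed.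

Lemma measurable_mulmx n (U : 'M[R]_n) :
  measurable_fun [set: V n] (fun z : V n => U *m (z : 'cV[R]_n) : V n).
Proof.
apply: measurable_mx => i j.
have -> : (fun t : V n => (U *m (t : 'cV[R]_n)) i j) =
    (fun t : V n => \sum_k (U i k * (t : 'cV[R]_n) k j)).
  by apply/funext => t; rewrite mxE.
apply: measurable_sum => k; apply: measurable_funM; first exact: measurable_cst.
exact: measurable_coord.
Qed.

Definition preserves n (U : 'M[R]_n) := forall mu, gauss_law mu ->
  forall B : set (V n), measurable B -> mu [set z : 'cV[R]_n | B (U *m z)] = mu B.

Lemma preserves_mul n (U W : 'M[R]_n) : preserves U -> preserves W -> preserves (U *m W).
Proof.
move=> pU pW mu g B mB; rewrite -(pU mu g B mB).
rewrite -(pW mu g _ (measurable_preim (measurable_mulmx U) mB)).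
by congr (mu _); apply/seteqP; split => z /=; rewrite mulmxA.
Qed.

Lemma preserves_tr n (U : 'M[R]_n) : U^T *m U = 1%:M -> preserves U -> preserves U^T.
Proof.
move=> oU pU mu g B mB.
have mB' := measurable_preim (measurable_mulmx U^T) mB.
rewrite -(pU mu g _ mB'); congr (mu _).
by apply/seteqP; split => z /=; rewrite mulmxA oU mul1mx.
Qed.

Lemma preserves1 n : preserves (1%:M : 'M[R]_n).
Proof.
move=> mu g B mB; congr (mu _).
by apply/seteqP; split => z /=; rewrite mul1mx.
Qed.

Lemma gauss_law_exists n : exists mu : probability (V n) R, gauss_law mu.
Proof. exact: prod_law_exists. Qed.

Lemma measurable_cons_section n x (B : set (V n.+1)) : measurable B ->
  measurable [set v : V n | B (cons_cv (x, v))].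
Proof.
exact: (measurable_preim (measurableT_comp (@measurable_cons_cv R n) (pair1_measurable x))).
Qed.

Lemma gauss_law_cons n (mu : probability (V n.+1) R) (nu : probability (V n) R) B :
  gauss_law mu -> gauss_law nu -> measurable B ->
  mu B = (\int[gauss]_x nu [set v | B (cons_cv (x, v))])%E.
Proof.
move=> gmu gnu mB.
have mI : measurable_fun [set: V n.+1] (fun x => (\1_B x)%:E : \bar R).
  by apply/measurable_EFinP; exact: measurable_indic.
have e1 := integral_indic mu measurableT mB.
rewrite setIT in e1; rewrite -e1.
apply: etrans (@prod_law_integral_cons R n (fun=> gauss) nu mu _ gnu gmu mI _) _.
  by move=> x; rewrite lee_fin.
apply: eq_integral => x _.
have e2 := integral_indic nu measurableT (measurable_cons_section x mB).
by rewrite setIT in e2; rewrite -e2.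
Qed.

Lemma block1_cons n (U : 'M[R]_n) x (v : 'cV[R]_n) :
  (block_mx 1%:M 0 0 U : 'M[R]_(1 + n)) *m (cons_cv (x, v : V n) : 'cV[R]_(1 + n)) =
  cons_cv (x, U *m v : V n).
Proof. by rewrite /cons_cv/= mul_block_col mul1mx !mul0mx addr0 add0r. Qed.

Lemma preserves_block n (U : 'M[R]_n) : preserves U ->
  preserves (block_mx 1%:M 0 0 U : 'M[R]_(1 + n)).
Proof.
move=> pU mu g B mB.
have [nu gnu] := gauss_law_exists n.
have mB' := measurable_preim (measurable_mulmx (block_mx 1%:M 0 0 U : 'M[R]_(1 + n))) mB.
apply: etrans (gauss_law_cons g gnu mB') _.
apply/esym; apply: etrans (gauss_law_cons g gnu mB) _.
apply: eq_integral => x _.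
rewrite -(pU nu gnu _ (measurable_cons_section x mB)); congr (nu _).
by apply/seteqP; split => v /=; rewrite block1_cons.
Qed.

Lemma preserves_flip n : preserves (block_mx (-1)%:M 0 0 1%:M : 'M[R]_(1 + n)).
Proof.
move=> mu g B mB; set F := block_mx _ _ _ _.
have mF := @measurable_mulmx (1 + n) F.
apply: (@prod_law_unique _ _ (fun=> gauss) (push_prob mu mF)) => // C mC.
rewrite push_probE.
pose C' (i : 'I_(1 + n)) : set TR := if i == ord0 then (fun x : R => - x) @^-1` C i else C i.
have -> : (fun z : V (1 + n) => F *m (z : 'cV[R]_(1 + n)) : V (1 + n)) @^-1` rect C = rect C'.
  have ent (z : 'cV[R]_(1 + n)) i : (F *m z) i ord0 =
      if i == ord0 then - z i ord0 else z i ord0.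
    rewrite -[z]vsubmxK mul_block_col mul1mx !mul0mx addr0 add0r mul_scalar_mx scaleN1r.
    case: (split_ordP i) => j ->.
      by rewrite !col_mxEu (ord1 j) [LHS]mxE.
    by rewrite !col_mxEd.
  apply/seteqP; split => z /= h i; have := h i; rewrite /C' ent;
    by case: (i == ord0).
apply: etrans (g C' _) _.
  move=> i; rewrite /C'; case: (i == ord0) => //.
  apply: (@measurable_preim _ _ TR TR) => //; exact: oppr_measurable.
apply: eq_bigr => i _; rewrite /C'; case: (i == ord0) => //.
exact: gauss_opp.
Qed.

Definition givens n (c s : R) : 'M[R]_(1 + (1 + n)) :=
  block_mx c%:M (row_mx (- s)%:M 0) (col_mx s%:M 0) (block_mx c%:M 0 0 1%:M).

Lemma givens_cons n (c s x y : R) (v : 'cV[R]_n) :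
  givens n c s *m (cons_cv (x, cons_cv (y, v : V n)) : 'cV[R]_(1 + (1 + n))) =
  cons_cv (c * x - s * y, cons_cv (s * x + c * y, v : V n)).
Proof.
rewrite /cons_cv/= /givens mul_block_col mul_row_col mul_col_mx mul_block_col.
rewrite !mul0mx !addr0 mul1mx ?add0r !mul_scalar_mx add_col_mx ?add0r.
congr col_mx; first by apply/matrixP => i j; rewrite !mxE mulNr.
congr col_mx; apply/matrixP => i j; rewrite !mxE; reflexivity.
Qed.

(** Integrating out the remaining coordinates leaves a function of the first two, to which the
    planar statement applies. *)
Lemma preserves_givens n (c s : R) : c ^+ 2 + s ^+ 2 = 1 -> s != 0 ->
  preserves (givens n c s).
Proof.
move=> cs s0 mu g B mB.
have [nu1 gnu1] := gauss_law_exists (1 + n); have [nu gnu] := gauss_law_exists n.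
pose cc (xyv : (TR * TR) * V n) : V (1 + (1 + n)) := cons_cv (xyv.1.1, cons_cv (xyv.1.2, xyv.2)).
have mcc : measurable_fun setT cc.
  apply: (measurableT_comp (@measurable_cons_cv R (1 + n))).
  apply: measurable_fun_pair.
    by apply: measurableT_comp; [exact: measurable_fst|exact: measurable_fst].
  apply: (measurableT_comp (@measurable_cons_cv R n)).
  apply: measurable_fun_pair; last exact: measurable_snd.
  by apply: measurableT_comp; [exact: measurable_snd|exact: measurable_fst].
have two A : measurable A -> mu A =
    (\int[gauss]_x \int[gauss]_y nu [set v | A (cc ((x, y), v))])%E.
  move=> mA; apply: etrans (gauss_law_cons g gnu1 mA) _; apply: eq_integral => x _.
  exact: (gauss_law_cons gnu1 gnu (measurable_cons_section x mA)).
pose f (xy : TR * TR) := nu [set v | B (cc (xy, v))].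
have mf : measurable_fun setT f.
  have := @measurable_fun_xsection _ _ (TR * TR)%type (V n) R nu _ (measurable_preim mcc mB).
  by congr measurable_fun; apply/funext => xy; rewrite /f /=; congr (nu _);
    apply/seteqP; split => v /=; rewrite /xsection/= ?inE//; move/mem_set.
apply: etrans (two _ (measurable_preim (measurable_mulmx _) mB)) _.
apply/esym; apply: etrans (two B mB) _; apply/esym.
apply: etrans (rotation_gauss mf _ cs s0); last by move=> x.
apply: eq_integral => x _; apply: eq_integral => y _; rewrite /f.
by congr (nu _); apply/seteqP; split => v /=; rewrite /cc/= givens_cons.
Qed.

End orthogonal_invariance.

(** * Orthogonal matrices: reduction, Gaussian invariance, diagonalisation *)

Section orthogonal_matrices.
Context {R : realType}.

Definition orthogonal n (U : 'M[R]_n) := U^T *m U = 1%:M.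

Definition e_cv n (r : R) : 'cV[R]_(1 + n) := col_mx r%:M 0.

Lemma e_cvZ n (k x : R) : k *: e_cv n x = e_cv n (k * x).
Proof. by rewrite /e_cv scale_col_mx scaler0 scale_scalar_mx. Qed.

Lemma e_cv_norm n (x : R) : (e_cv n x)^T *m e_cv n x = (x ^+ 2)%:M.
Proof.
by rewrite /e_cv tr_col_mx mul_row_col mulmx0 addr0 tr_scalar_mx -scalar_mxM expr2.
Qed.

Lemma cons_cvE n (x : R) (v : 'cV[R]_n) :
  (cons_cv (x, v : borel_mx R n 1) : 'cV[R]_(1 + n)) = col_mx x%:M v.
Proof.
by rewrite /cons_cv/=; congr col_mx; apply/matrixP => i j; rewrite !mxE !ord1 mulr1n.
Qed.

Lemma mulmx_ext n (A B : 'M[R]_n) : (forall z : 'cV[R]_n, A *m z = B *m z) -> A = B.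
Proof.
move=> H; apply/matrixP => i j.
have := H (delta_mx j 0); rewrite -!colE => /matrixP/(_ i 0).
by rewrite !mxE.
Qed.

Lemma orthogonal_mul n (U W : 'M[R]_n) : orthogonal U -> orthogonal W -> orthogonal (U *m W).
Proof. by move=> oU oW; rewrite /orthogonal trmx_mul mulmxA -(mulmxA _ _ U) oU mulmx1 oW. Qed.

Lemma orthogonal_tr n (U : 'M[R]_n) : orthogonal U -> orthogonal U^T.
Proof. by move=> oU; rewrite /orthogonal trmxK; exact: mulmx1C. Qed.

Lemma orthogonal1 n : orthogonal (1%:M : 'M[R]_n).
Proof. by rewrite /orthogonal trmx1 mulmx1. Qed.

Lemma orthogonal_block n (U : 'M[R]_n) : orthogonal U ->
  orthogonal (block_mx 1%:M 0 0 U : 'M[R]_(1 + n)).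
Proof.
move=> oU; rewrite /orthogonal tr_block_mx !trmx0 trmx1 mulmx_block.
by rewrite !mul0mx !mulmx0 !addr0 !add0r mulmx1 oU -scalar_mx_block.
Qed.

Lemma orthogonal_flip n : orthogonal (block_mx (-1)%:M 0 0 1%:M : 'M[R]_(1 + n)).
Proof.
rewrite /orthogonal tr_block_mx !trmx0 trmx1 tr_scalar_mx mulmx_block.
rewrite !mul0mx !mulmx0 !addr0 !add0r mulmx1 -scalar_mxM mulrNN mulr1.
by rewrite -scalar_mx_block.
Qed.

Lemma orthogonal_givens n (c s : R) : c ^+ 2 + s ^+ 2 = 1 -> orthogonal (givens n c s).
Proof.
move=> cs; have tg : (givens n c s)^T = givens n c (- s).
  rewrite /givens tr_block_mx tr_row_mx tr_col_mx tr_block_mx !tr_scalar_mx !trmx0.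
  by rewrite opprK.
rewrite /orthogonal tg; apply: mulmx_ext => z.
rewrite -[z]vsubmxK; set x := usubmx z; set w := dsubmx z.
rewrite -(vsubmxK w) mul1mx.
have e1 (u : 'cV[R]_1) : u = (u 0 0)%:M by apply/matrixP => i j; rewrite !mxE !ord1 mulr1n.
rewrite (e1 x) (e1 (usubmx w)).
rewrite -[col_mx _ (dsubmx w)]cons_cvE -cons_cvE -mulmxA !givens_cons.
have h1 (a b : R) : c * (c * a - s * b) - - s * (s * a + c * b) = a.
  by transitivity ((c ^+ 2 + s ^+ 2) * a); [ring|rewrite cs mul1r].
have h2 (a b : R) : - s * (c * a - s * b) + c * (s * a + c * b) = b.
  by transitivity ((c ^+ 2 + s ^+ 2) * b); [ring|rewrite cs mul1r].
by rewrite h1 h2.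
Qed.

(** The tail is first reduced to r e_1, then a planar rotation sends (x, r) to (sqrt (x^2 + r^2),
    0). When r = 0 the rotation would be trivial and only a sign change is needed. The result serves
    Gaussian invariance, transitivity on spheres and diagonalisation. *)
Lemma reduce_vector n (v : 'cV[R]_(1 + n)) : exists U : 'M[R]_(1 + n), exists r : R,
  [/\ orthogonal U, preserves U, 0 <= r & U *m v = e_cv n r].
Proof.
have fl m (x : R) (w : 'cV[R]_m) :
    (block_mx (-1)%:M 0 0 1%:M : 'M[R]_(1 + m)) *m col_mx x%:M w = col_mx (- x)%:M w.
  by rewrite mul_block_col mul1mx !mul0mx addr0 add0r mul_scalar_mx scaleN1r raddfN.
have e1 (u : 'cV[R]_1) : u = (u 0 0)%:M by apply/matrixP => i j; rewrite !mxE !ord1 mulr1n.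
have sgn m (x : R) : exists U : 'M[R]_(1 + m), exists r : R,
    [/\ orthogonal U, preserves U, 0 <= r & U *m e_cv m x = e_cv m r].
  have [x0|x0] := leP 0 x.
    exists 1%:M, x; split => //; [exact: orthogonal1|exact: preserves1|by rewrite mul1mx].
  exists (block_mx (-1)%:M 0 0 1%:M), (- x); split.
  - exact: orthogonal_flip.
  - exact: preserves_flip.
  - by rewrite oppr_ge0 ltW.
  - by rewrite /e_cv fl.
elim: n v => [|n IH] v.
  have [U [r [oU pU r0 Uv]]] := sgn 0%N ((v : 'cV[R]_1) 0 0).
  exists U, r; split => //; rewrite -Uv; congr (_ *m _).
  apply/matrixP => i j; rewrite (ord1 j) /e_cv.
  case: (@split_ordP 1 0 i) => [i' ->|[]//].
  apply: etrans (esym (col_mxEu _ _ i' _)).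
  by rewrite mxE [i' == _](_ : _ = true) ?mulr1n; [congr (v _ _); rewrite (ord1 i'); exact: val_inj|rewrite (ord1 i')].
have [U [r [oU pU r0 Uv]]] := IH (dsubmx (v : 'cV[R]_(1 + n.+1))).
set x := (usubmx (v : 'cV[R]_(1 + n.+1))) 0 0.
have vE : (v : 'cV[R]_(1 + n.+1)) = col_mx x%:M (dsubmx (v : 'cV[R]_(1 + n.+1))).
  by apply: etrans (esym (vsubmxK (v : 'cV[R]_(1 + n.+1)))) _; congr col_mx; exact: e1.
pose U1 : 'M[R]_(1 + n.+1) := block_mx 1%:M 0 0 U.
have U1v : U1 *m v = col_mx x%:M (e_cv n r).
  by rewrite vE mul_block_col mul1mx !mul0mx addr0 add0r Uv.
have [r00|rn0] := eqVneq r 0.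
  have [U2 [r2 [oU2 pU2 r20 U2v]]] := sgn n.+1 x.
  exists (U2 *m U1), r2; split => //.
  - by apply: orthogonal_mul => //; exact: orthogonal_block.
  - by apply: preserves_mul => //; exact: preserves_block.
  - rewrite -mulmxA U1v -U2v; congr (_ *m col_mx _ _).
    by rewrite /e_cv r00 raddf0 col_mx0.
pose q := Num.sqrt (x ^+ 2 + r ^+ 2).
have q2 : q ^+ 2 = x ^+ 2 + r ^+ 2 by rewrite sqr_sqrtr// addr_ge0 ?sqr_ge0.
have q0 : 0 < q.
  rewrite sqrtr_gt0 ltr_wpDl ?sqr_ge0//.
  by rewrite lt_def sqr_ge0 andbT sqrf_eq0.
have cs : (x / q) ^+ 2 + (- r / q) ^+ 2 = 1.
  rewrite !expr_div_n sqrrN -mulrDl -q2 divff// sqrf_eq0 gt_eqF//.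
have s0 : - r / q != 0 by rewrite mulf_neq0 ?oppr_eq0 ?invr_eq0// gt_eqF.
exists (givens n (x / q) (- r / q) *m U1), q; split => //.
- by apply: orthogonal_mul; [exact: orthogonal_givens|exact: orthogonal_block].
- by apply: preserves_mul; [exact: preserves_givens|exact: preserves_block].
- exact: ltW.
rewrite -mulmxA U1v /e_cv -[X in col_mx x%:M X]cons_cvE -cons_cvE givens_cons !cons_cvE.
have -> : x / q * x - - r / q * r = q.
  have -> : x / q * x - - r / q * r = (x ^+ 2 + r ^+ 2) / q by ring.
  by rewrite -q2 expr2 mulfK// gt_eqF.
have -> : - r / q * x + x / q * r = 0 by ring.
by rewrite raddf0 col_mx0.
Qed.

Lemma first_col_block n (A : 'M[R]_(1 + n)) (a : R) :
  A *m e_cv n 1 = e_cv n a ->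
  A = block_mx a%:M (ursubmx A) 0 (drsubmx A).
Proof.
rewrite -{1}[A]submxK /e_cv mul_block_col !mulmx0 !addr0 !mulmx1 => /eq_col_mx[h1 h2].
by rewrite -{1}[A]submxK h1 h2.
Qed.

(** A product of elementary transformations brings the first column of [U] back to e_1. The
    resulting orthogonal matrix fixes e_1, hence is block diagonal, and its lower block is
    smaller. *)
Lemma orthogonal_preserves n (U : 'M[R]_n) : orthogonal U -> preserves U.
Proof.
elim: n U => [|n IH] U oU.
  have -> : U = 1%:M by rewrite [LHS]flatmx0 [RHS]flatmx0.
  exact: preserves1.
have [V [r [oV pV r0 Vv]]] := reduce_vector ((U : 'M[R]_(1 + n)) *m e_cv n 1).
have nrm (M : 'M[R]_(1 + n)) z : orthogonal M -> (M *m z)^T *m (M *m z) = z^T *m z :> 'M[R]_1.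
  by move=> oM; rewrite trmx_mul mulmxA -(mulmxA _ _ M) oM mulmx1.
have r1 : r = 1.
  have : (r ^+ 2)%:M = (1 ^+ 2)%:M :> 'M[R]_1.
    by rewrite -!(e_cv_norm n) -Vv (nrm V)// (nrm U).
  move=> /matrixP/(_ 0 0); rewrite !mxE !mulr1n => /eqP.
  by rewrite eqrXn2// => /eqP.
pose A : 'M[R]_(1 + n) := V *m U.
have oA : orthogonal A by exact: orthogonal_mul.
have Ae : A *m e_cv n 1 = e_cv n 1 by rewrite -mulmxA Vv r1.
have Ate : A^T *m e_cv n 1 = e_cv n 1 by rewrite -{1}Ae mulmxA oA mul1mx.
have AE := first_col_block Ae; have AtE := first_col_block Ate.
have ur0 : ursubmx A = 0.
  have := congr1 trmx AtE; rewrite trmxK {1}AE tr_block_mx trmx0.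
  by move=> /eq_block_mx[_ ->].
rewrite ur0 in AE.
have oD : orthogonal (drsubmx A).
  have := oA; rewrite /orthogonal {1 2}AE tr_block_mx !trmx0 mulmx_block.
  rewrite !mul0mx !mulmx0 !addr0 !add0r scalar_mx_block.
  by move=> /eq_block_mx[].
have pA : preserves A by rewrite AE; apply: preserves_block; exact: IH.
have -> : U = V^T *m A by rewrite /A mulmxA oV mul1mx.
by apply: preserves_mul => //; exact: preserves_tr.
Qed.

Lemma char_poly_conj n (V W : 'M[R]_n) : orthogonal V ->
  char_poly (V *m W *m V^T) = char_poly W.
Proof.
move=> oV; rewrite /char_poly /char_poly_mx.
have oV' := mulmx1C oV.
have e : 'X%:M - map_mx polyC (V *m W *m V^T) =
    map_mx polyC V *m ('X%:M - map_mx polyC W) *m map_mx polyC V^T.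
  rewrite mulmxBr mulmxBl -!map_mxM; congr (_ - _).
  by rewrite scalar_mxC -mulmxA -map_mxM oV' map_mx1 mulmx1.
rewrite e !det_mulmx mulrAC -det_mulmx -map_mxM oV' map_mx1 det1 mul1r//.
Qed.

(** Deflation along the prescribed list [s]: a real eigenvector for its head exists because the
    characteristic polynomial is assumed split, and symmetry makes the conjugated matrix block
    diagonal. The diagonal thus comes in the order of [s]. *)
Lemma symmetric_diagonalization n (W : 'M[R]_n) (s : seq R) :
  W^T = W -> char_poly W = \prod_(a <- s) ('X - a%:P) ->
  exists U : 'M[R]_n, orthogonal U /\ U^T *m W *m U = diag_mx (\row_i nth 0 s i).
Proof.
elim: n W s => [|n IH] W s sW cW.
  by exists 1%:M; split; [exact: orthogonal1|rewrite [LHS]flatmx0 [RHS]flatmx0].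
move: W sW cW; rewrite -[n.+1]/(1 + n)%N => W sW cW.
have := size_char_poly W; rewrite cW size_prod_XsubC => -[].
case: s cW => // a s cW _.
have : eigenvalue W a by rewrite eigenvalue_root_char cW root_prod_XsubC mem_head.
move=> /eigenvalueP[u uW u0].
pose x : 'cV[R]_(1 + n) := u^T.
have Wx : W *m x = a *: x by rewrite /x -{1}sW -trmx_mul uW linearZ.
have [V [r [oV pV r0 Vx]]] := reduce_vector x.
have rn0 : r != 0.
  apply: contra_neq u0 => r00.
  have : x = 0 by rewrite -[x]mul1mx -oV -mulmxA Vx /e_cv r00 raddf0 col_mx0 mulmx0.
  by rewrite /x => /(congr1 trmx); rewrite trmxK trmx0.
pose A : 'M[R]_(1 + n) := V *m W *m V^T.
have Vte : V^T *m e_cv n 1 = r^-1 *: x.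
  have -> : e_cv n 1 = r^-1 *: (V *m x).
    by rewrite Vx e_cvZ mulVf.
  by rewrite -scalemxAr mulmxA oV mul1mx.
have Ae : A *m e_cv n 1 = e_cv n a.
  rewrite /A -!mulmxA Vte -!scalemxAr Wx -scalemxAr Vx scalerA.
  by rewrite e_cvZ mulrAC mulVf// mul1r.
have sA : A^T = A by rewrite /A !trmx_mul trmxK sW mulmxA.
have AE := first_col_block Ae.
have ur0 : ursubmx A = 0.
  have := congr1 trmx AE; rewrite sA {1}AE tr_block_mx trmx0.
  by move=> /eq_block_mx[_ ->].
rewrite ur0 in AE.
have sD : (drsubmx A)^T = drsubmx A.
  have := sA; rewrite {1 2}AE tr_block_mx !trmx0.
  by move=> /eq_block_mx[].
have cA : char_poly A = ('X - a%:P) * char_poly (drsubmx A).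
  rewrite {1}AE /char_poly char_block_diag_mx det_ublock; congr (_ * _).
  by rewrite /char_poly_mx det_mx11 !mxE !eqxx !mulr1n.
have cD : char_poly (drsubmx A) = \prod_(b <- s) ('X - b%:P).
  have e : ('X - a%:P) * char_poly (drsubmx A) = ('X - a%:P) * \prod_(b <- s) ('X - b%:P).
    by rewrite -cA char_poly_conj// cW big_cons.
  exact: (mulfI (negbT (polyXsubC_eq0 a)) e).
have [U [oU dU]] := IH _ _ sD cD.
exists (V^T *m block_mx 1%:M 0 0 U); split.
  by apply: orthogonal_mul; [exact: orthogonal_tr|exact: orthogonal_block].
have -> : (V^T *m block_mx 1%:M 0 0 U)^T *m W *m (V^T *m block_mx 1%:M 0 0 U) =
   (block_mx 1%:M 0 0 U)^T *m A *m (block_mx 1%:M 0 0 U : 'M[R]_(1 + n)).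
  by rewrite trmx_mul trmxK /A !mulmxA.
rewrite AE tr_block_mx !trmx0 trmx1 !mulmx_block !mul0mx !mulmx0 !addr0 !add0r.
rewrite !mul1mx !mulmx1 ?mul0mx ?mulmx0 ?addr0 ?add0r dU.
apply/matrixP => i j; rewrite [RHS]mxE.
case: (@split_ordP 1 n i) => i' ->; case: (@split_ordP 1 n j) => j' ->.
- by rewrite block_mxEul !mxE !ord1 /= !mulr1n.
- by rewrite block_mxEur !mxE eq_lrshift.
- by rewrite block_mxEdl !mxE eq_rlshift.
- by rewrite block_mxEdr !mxE eq_rshift.
Qed.

End orthogonal_matrices.

(** * Uniqueness of the rotation-invariant law on a sphere *)

Section haar_unique.
Context {R : realType} (n : nat) (r : R).
Local Notation TR := (measurableTypeR R).
Local Notation V := (borel_mx R n.+1 1).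
Local Notation S := (sphere n.+1 r : set V).
Implicit Types (x y z : 'cV[R]_n.+1).

(** The squared Euclidean distance, since the sup norm is not invariant under rotations. *)
Definition dist2 x y : R := \sum_i (x i ord0 - y i ord0) ^+ 2.

Lemma dist2C x y : dist2 x y = dist2 y x.
Proof. by apply: eq_bigr => i _; rewrite -sqrrN opprB. Qed.

Lemma dist2_le x y z : dist2 x z <= 2 * (dist2 x y + dist2 y z).
Proof.
rewrite -big_split mulr_sumr; apply: ler_sum => i _ /=.
set a := x i ord0; set b := y i ord0; set c := z i ord0.
by have := sqr_ge0 (a - b - (b - c)); lra.
Qed.

Lemma sqr_sumE x : \sum_i x i ord0 ^+ 2 = (x^T *m x) ord0 ord0.
Proof. by rewrite mxE; apply: eq_bigr => i _; rewrite mxE expr2. Qed.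

Lemma dist2E x y : dist2 x y = ((x - y)^T *m (x - y)) ord0 ord0.
Proof. by rewrite -sqr_sumE; apply: eq_bigr => i _; rewrite !mxE. Qed.

Lemma sqr_sum_orthogonal m (U : 'M[R]_m) (x : 'cV[R]_m) : orthogonal U ->
  (U *m x)^T *m (U *m x) = x^T *m x.
Proof. by move=> oU; rewrite trmx_mul mulmxA -(mulmxA _ _ U) oU mulmx1. Qed.

Lemma dist2_orthogonal (U : 'M[R]_n.+1) x y : orthogonal U ->
  dist2 (U *m x) (U *m y) = dist2 x y.
Proof. by move=> oU; rewrite !dist2E -mulmxBr sqr_sum_orthogonal. Qed.

Lemma sphere_transitive x y : S x -> S y -> exists2 U, orthogonal U & U *m x = y.
Proof.
have red z : S z -> exists2 U : 'M[R]_n.+1, orthogonal U & U *m z = e_cv n r.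
  move=> Sz; have [U [a [oU _ a0 Uz]]] := reduce_vector z.
  exists U => //; rewrite Uz; congr e_cv.
  have h := sqr_sum_orthogonal z oU; rewrite Uz in h.
  have : (a ^+ 2)%:M = z^T *m z := etrans (esym (e_cv_norm n a)) h.
  move=> /matrixP/(_ ord0 ord0); rewrite -sqr_sumE mxE mulr1n.
  move: Sz; rewrite /sphere/= /euclidean_norm => <- <-.
  by rewrite sqrtr_sqr ger0_norm.
move=> /red[U oU Ux] /red[W oW Wy]; exists (W^T *m U).
  by apply: orthogonal_mul => //; exact: orthogonal_tr.
by rewrite -mulmxA Ux -Wy mulmxA oW mul1mx.
Qed.

Lemma measurable_sphere : measurable S.
Proof.
have mf : measurable_fun [set: V] (fun x : V => euclidean_norm (x : 'cV[R]_n.+1) : TR).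
  apply: (@measurableT_comp _ _ _ _ _ _ (@Num.sqrt R : TR -> TR)).
    by apply: continuous_measurable_fun; exact: sqrt_continuous.
  apply: measurable_sum => i; apply: measurable_funX; exact: measurable_coord.
exact: (measurable_preim mf (measurable_set1 r)).
Qed.

Lemma measurable_dist2 : measurable_fun [set: V * V] (fun xy : V * V => dist2 xy.1 xy.2 : TR).
Proof.
apply: measurable_sum => i; apply: measurable_funX; apply: measurable_funB.
  by apply: (measurableT_comp (@measurable_coord R n.+1 1 i ord0)); exact: measurable_fst.
by apply: (measurableT_comp (@measurable_coord R n.+1 1 i ord0)); exact: measurable_snd.
Qed.

Definition near_pairs (rho : R) : set (V * V) := [set xy | dist2 xy.1 xy.2 < rho].

Lemma measurable_near_pairs rho : measurable (near_pairs rho).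
Proof.
have -> : near_pairs rho = (fun xy : V * V => dist2 xy.1 xy.2) @^-1` `]-oo, rho[%classic.
  by apply/seteqP; split => xy /=; rewrite in_itv.
exact: (measurable_preim measurable_dist2 (measurable_itv _)).
Qed.

Lemma measurable_cap x rho : measurable ([set y | dist2 x y < rho] : set V).
Proof. exact: (@measurable_preim _ _ V (V * V)%type _ _ (pair1_measurable (x : V)) (measurable_near_pairs rho)). Qed.

Lemma cap_const (mu : probability V R) x y rho : haar_sphere r mu -> S x -> S y ->
  mu [set z | dist2 x z < rho] = mu [set z | dist2 y z < rho].
Proof.
move=> [_ inv] Sx Sy; have [U oU <-] := sphere_transitive Sx Sy.
rewrite -[RHS](inv U oU _ (measurable_cap _ _)); congr (mu _).
by apply/seteqP; split => z /=; rewrite dist2_orthogonal.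
Qed.

Lemma haar_sphere_nonempty (mu : probability V R) : haar_sphere r mu -> exists x, S x.
Proof.
move=> [muS _]; have [//|nS] := pselect (exists x, S x).
have : mu setT = 0%E.
  by rewrite -muS; congr (mu _); apply/seteqP; split => // x _ Sx; apply: nS; exists x.
by rewrite probability_setT => /eqP; rewrite onee_eq0.
Qed.

(** Countably many caps of equal size cover the sphere and all have the same measure; if it were 0,
    so would be the total mass. *)
Lemma cap_gt0 (mu : probability V R) x (rho : R) : haar_sphere r mu -> S x -> 0 < rho ->
  (0 < mu [set z | (dist2 x z < rho)%R])%E.
Proof.
move=> hmu Sx rho0; rewrite lt0e measure_ge0 andbT; apply/eqP => m0.
(* With a quarter of [rho], a ball around a rational point that meets the sphere at [y] lies in the
   cap around [y], since 2 (rho / 4 + rho / 4) = rho in [dist2_le]. *)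
pose Q (c : 'cV[rat]_n.+1) : set V := [set y | dist2 (\col_i ratr (c i ord0)) y < rho / 4].
have Qneg c : mu.-negligible (Q c).
  have [[y [Qy Sy]]|nQ] := pselect (exists y, Q c y /\ S y).
    have mcap := measurable_cap y rho.
    have nS : measurable (~` S) by apply: measurableC; exact: measurable_sphere.
    exists (~` S `|` [set z | dist2 y z < rho]); split.
    - exact: measurableU.
    - apply/eqP; rewrite eq_le measure_ge0 andbT.
      apply: le_trans (measureU2 _ nS mcap) _.
      rewrite -[leRHS]adde0; apply: leeD; rewrite le_eqVlt; apply/orP; left; apply/eqP.
        exact: (proj1 hmu).
      exact: etrans (cap_const rho hmu Sy Sx) m0.
    - move=> z Qz; right; move: Qy Qz; rewrite /Q/= => Qy Qz.
      have := dist2_le y (\col_i ratr (c i ord0)) z; rewrite (dist2C y (\col_i _)); lra.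
  exists (~` S); split; [by apply: measurableC; exact: measurable_sphere|exact: (proj1 hmu)|].
  by move=> z Qz Sz; apply: nQ; exists z.
pose F (k : nat) : set V := if unpickle k is Some c then Q c else set0.
have : mu.-negligible (\bigcup_k F k).
  apply: negligible_bigcup => k; rewrite /F; case: unpickle => [c|]; [exact: Qneg|exact: negligible_set0].
have -> : \bigcup_k F k = setT.
  apply/seteqP; split => // y _.
  pose e := Num.sqrt (rho / 4 / n.+1%:R).
  have e2 : e ^+ 2 = rho / 4 / n.+1%:R by rewrite sqr_sqrtr// !divr_ge0// ltW.
  have e0 : 0 < e by rewrite sqrtr_gt0 !divr_gt0.
  have cex i : exists q : rat, `|ratr q - (y : 'cV[R]_n.+1) i ord0| < e.
    have lt : (y : 'cV[R]_n.+1) i ord0 - e < (y : 'cV[R]_n.+1) i ord0 + e by lra.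
    have [q] := rat_in_itvoo lt; rewrite in_itv/= => /andP[q1 q2].
    by exists q; rewrite ltr_norml; lra.
  pose c : 'cV[rat]_n.+1 := \col_i projT1 (cid (cex i)).
  exists (pickle c) => //; rewrite /F pickleK /Q/=.
  have -> : rho / 4 = \sum_(i < n.+1) e ^+ 2.
    by rewrite sumr_const card_ord e2 -[RHS]mulr_natr divfK.
  apply: ltr_sum; first by apply/hasP; exists ord0 => //; rewrite mem_index_enum.
  move=> i _; rewrite !mxE; case: cid => q /= qy.
  by rewrite -real_normK ?num_real// ltrXn2r.
move=> [A [mA A0 TA]]; have : mu setT = 0%E.
  by rewrite -A0; congr (mu _); apply/seteqP; split.
by rewrite probability_setT => /eqP; rewrite onee_eq0.
Qed.

Lemma ae_sphere (mu : probability V R) : haar_sphere r mu -> {ae mu, forall x : V, S x}.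
Proof.
move=> [h _]; exists (~` S); split => //; first by apply: measurableC; exact: measurable_sphere.
Qed.

Section compare.
Variables (mu nu : probability V R).
Hypotheses (hmu : haar_sphere r mu) (hnu : haar_sphere r nu).

Let strip (U : set V) rho : set (V * V) := near_pairs rho `&` (setT `*` U).

Let mstrip (U : set V) (rho : R) : measurable U -> measurable (strip U rho).
Proof.
move=> mU; apply: measurableI; first exact: measurable_near_pairs.
exact: measurableX.
Qed.

Let mfst (U : set V) (rho : R) : measurable U ->
  measurable_fun [set: V] (fun x : V => nu [set y | (dist2 x y < rho)%R /\ U y]).
Proof.
move=> mU; have := @measurable_fun_xsection _ _ V V R nu _ (mstrip rho mU).
by congr measurable_fun; apply/funext => x /=; congr (nu _);
  apply/seteqP; split => y /=; rewrite /xsection/= inE/=; [move=> [? []]|move=> []].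
Qed.

(** Tonelli for the pairs at distance below [rho] with second point in [U]: the inner integral in
    [x] is the measure of a cap centred at [y], the same for all [y] of the sphere. *)
Let strip_integral (U : set V) (rho : R) x0 : measurable U -> S x0 ->
  (\int[mu]_x nu [set y | (dist2 x y < rho)%R /\ U y] =
   mu [set z | (dist2 x0 z < rho)%R] * nu U)%E.
Proof.
move=> mU Sx0.
have mI : measurable_fun [set: V * V] (fun xy : V * V => (\1_(strip U rho) xy)%:E : \bar R).
  by apply/measurable_EFinP; apply: measurable_indic; exact: mstrip.
have I0 xy : (0 <= (\1_(strip U rho) xy)%:E :> \bar R)%E by rewrite lee_fin.
have F := @fubini_tonelli _ _ V V R mu nu (fun xy => (\1_(strip U rho) xy)%:E) mI I0.
transitivity (\int[mu]_x \int[nu]_y (\1_(strip U rho) (x, y))%:E)%E.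
  apply: eq_integral => x _.
  have mx : measurable ([set y | (dist2 x y < rho)%R /\ U y] : set V).
    by apply: (@measurableI _ V); [exact: measurable_cap|].
  have e := integral_indic nu measurableT mx; rewrite setIT in e; rewrite -e.
  apply: eq_integral => y _; congr (_%:E); rewrite !indicE; congr (nat_of_bool _)%:R.
  by apply/idP/idP; rewrite !inE => -[]//= ? []//.
rewrite F.
have -> : (mu [set z | (dist2 x0 z < rho)%R] * nu U =
  \int[nu]_y (mu [set z | (dist2 x0 z < rho)%R] * (\1_U y)%:E))%E.
  rewrite ge0_integralZl//; last by apply/measurable_EFinP; exact: measurable_indic.
  by have e := integral_indic nu measurableT mU; rewrite setIT in e; rewrite e.
apply: ge0_ae_eq_integral => //.
- exact: (@measurable_fun_fubini_tonelli_G _ _ V V R mu _ mI I0).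
- apply: emeasurable_funM => //; apply/measurable_EFinP; exact: measurable_indic.
- by move=> y _; apply: integral_ge0.
- by move=> y _; rewrite mule_ge0// lee_fin.
have [N [mN N0 sN]] := ae_sphere hnu; exists N; split => //.
apply: (subset_trans _ sN); apply: subsetC => y Sy _.
rewrite (cap_const rho hmu Sx0 Sy).
have e := integral_indic mu measurableT (measurable_cap y rho); rewrite setIT in e.
have [Uy|nUy] := pselect (U y).
  rewrite indicE mem_set// mule1 -e.
  apply: eq_integral => x _; congr (_%:E); rewrite !indicE; congr (nat_of_bool _)%:R.
  by apply/idP/idP; rewrite !inE /strip /near_pairs/= (dist2C x y)// => -[].
rewrite indicE memNset// mule0; apply: integral0_eq => x _.
by rewrite indicE memNset// => -[_ []].
Qed.

Let cap_eq (rho : R) x0 : S x0 ->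
  nu [set z | (dist2 x0 z < rho)%R] = mu [set z | (dist2 x0 z < rho)%R].
Proof.
move=> Sx0; have := strip_integral rho measurableT Sx0.
rewrite probability_setT mule1 => <-.
have -> : (\int[mu]_x nu [set y | (dist2 x y < rho)%R /\ setT y] =
  \int[mu]_x (cst (nu [set z | (dist2 x0 z < rho)%R]) x))%E.
  apply: ge0_ae_eq_integral => //; first exact: mfst.
  have [N [mN N0 sN]] := ae_sphere hmu; exists N; split => //.
  apply: (subset_trans _ sN); apply: subsetC => x Sx _ /=.
  rewrite -(cap_const rho hnu Sx Sx0); congr (nu _).
  by apply/seteqP; split => y //= -[].
apply/esym; apply: etrans (integral_cst mu measurableT _) _.
by apply: etrans (congr1 (fun a => (_ * a)%E) (probability_setT mu)) _; exact: mule1.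
Qed.

(** The proportion of a small cap around [x] that lies in [U], measured by [nu], has [mu]-integral
    equal to [nu U] and tends to 1 at the points of [U] on the sphere. Fatou concludes; exchanging
    the two laws gives the equality on open sets. *)
Lemma haar_open_le (U : set 'cV[R]_n.+1) : open U -> (mu (U : set V) <= nu (U : set V))%E.
Proof.
move=> oU; have mU : measurable (U : set V) by exact: sub_sigma_algebra.
have [x0 Sx0] := haar_sphere_nonempty hmu.
pose rho (k : nat) : R := k.+1%:R^-1.
have rho0 k : 0 < rho k by rewrite invr_gt0.
pose h k := fine (mu [set z | (dist2 x0 z < rho k)%R]).
have hE k : mu [set z | (dist2 x0 z < rho k)%R] = (h k)%:E.
  by rewrite fineK// fin_num_measure//; exact: measurable_cap.
have h0 k : 0 < h k by rewrite -lte_fin -hE; exact: cap_gt0.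
pose f k (x : V) := ((h k)^-1%:E * nu [set y | (dist2 x y < rho k)%R /\ U y])%E.
have mf k : measurable_fun [set: V] (f k).
  by apply: emeasurable_funM => //; exact: mfst.
have f0 k x : (0 <= f k x)%E by rewrite mule_ge0// lee_fin invr_ge0 ltW.
have intf k : (\int[mu]_x f k x = nu U)%E.
  rewrite ge0_integralZl//; [|exact: mfst|by rewrite lee_fin invr_ge0 ltW].
  by rewrite (strip_integral (rho k) mU Sx0) hE muleA -EFinM mulVf ?gt_eqF// mul1e.
have mS := measurable_sphere; have mUS : measurable ((U : set V) `&` S) by exact: measurableI.
have -> : mu (U : set V) = mu ((U : set V) `&` S).
  apply/eqP; rewrite eq_le; apply/andP; split; last by rewrite le_measure ?inE//; exact: subIsetl.
  have mC : measurable ((U : set V) `&` ~` S) by apply: measurableI => //; exact: measurableC.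
  have eU : (U : set V) = (U `&` S) `|` (U `&` ~` S) by rewrite -setIUr setUv setIT.
  rewrite {1}eU; apply: le_trans (measureU2 _ mUS mC) _.
  rewrite -[leRHS]adde0 leeD// le_eqVlt; apply/orP; left; apply/eqP.
  exact: (subset_measure0 mC (measurableC mS) (@subIsetr _ _ _) (proj1 hmu)).
have e := integral_cst mu mUS 1%E; rewrite mul1e in e; rewrite -e.
have -> : (\int[mu]_(x in (U : set V) `&` S) (cst (1%E : \bar R) x) =
    \int[mu]_(x in (U : set V) `&` S) limn_einf (f^~ x))%E.
  apply: eq_integral => x; rewrite inE => -[Ux Sx].
  suff cv : f k x @[k --> \oo] --> (1%E : \bar R) by have [-> _] := cvg_limn_einf_sup cv.
  have [d d0 dU] := open_sup_ball oU Ux.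
  have d20 : 0 < d ^+ 2 by rewrite exprn_gt0.
  apply: cvg_near_cst; near=> k.
  have rk : rho k < d ^+ 2 by near: k; exact: (near_infty_natSinv_lt (PosNum d20)).
  rewrite /f; have -> : [set y | (dist2 x y < rho k)%R /\ U y] = [set y | (dist2 x y < rho k)%R].
    apply/seteqP; split => y /= => [[]//|xy]; split => //; apply: dU => i j.
    rewrite (ord1 j) -(@ltr_pXn2r _ 2%N) ?nnegrE ?(ltW d0)// real_normK ?num_real//.
    apply: le_lt_trans (lt_trans xy rk).
    by rewrite /dist2 (bigD1 i)//= lerDl sumr_ge0// => l _; exact: sqr_ge0.
  rewrite (cap_const (rho k) hnu Sx Sx0) cap_eq// hE -EFinM mulVf// gt_eqF//.
apply: le_trans (fatou mu mUS _ _) _ => //.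
  by move=> k; exact: measurable_funTS.
rewrite limn_einf_lim; apply: lime_le; first exact: is_cvg_einfs.
apply: nearW => k.
apply: (@le_trans _ _ (\int[mu]_(x in (U : set V) `&` S) f k x)%E).
  by apply: ereal_inf_lbound; exists k => /=.
by rewrite -(intf k); apply: ge0_subset_integral.
Unshelve. all: by end_near. Qed.

End compare.

Lemma haar_sphere_unique (mu nu : probability V R) A :
  haar_sphere r mu -> haar_sphere r nu -> measurable A -> mu A = nu A.
Proof.
move=> hmu hnu mA.
apply: (@measure_unique _ R V (@open 'cV[R]_n.+1) (fun=> setT) erefl _ _ _ mu nu) => //.
- by move=> B C; exact: openI.
- by move=> _; exact: openT.
- by rewrite bigcup_const//; exists 0%N.
- by move=> B oB; apply/eqP; rewrite eq_le; apply/andP; split; exact: haar_open_le.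
- move=> k; apply: le_lt_trans (ltry 1); exact: probability_le1.
Qed.

End haar_unique.

(** * The quadratic maximization problem *)

Section max_quad_lemmas.
Context {R : realType} (n : nat).
Local Notation CV := 'cV[R]_n.+1.
Implicit Types (W : 'M[R]_n.+1) (h v x y : CV) (l : 'I_n.+1 -> R).

Definition quad W h x : R := 2^-1 * (x^T *m W *m x) ord0 ord0 + (h^T *m x) ord0 ord0.

Lemma sphere1P x : sphere n.+1 1 x <-> \sum_i x i ord0 ^+ 2 = 1.
Proof.
rewrite /sphere/= /euclidean_norm; split => [h|->]; last exact: sqrtr1.
rewrite -[LHS]sqr_sqrtr ?h ?expr1n//.
by apply: sumr_ge0 => i _; exact: sqr_ge0.
Qed.

Lemma quadE W h x : quad W h x =
  2^-1 * (\sum_i \sum_j W i j * x i ord0 * x j ord0) + \sum_i h i ord0 * x i ord0.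
Proof.
rewrite /quad; congr (_ * _ + _).
  rewrite -mulmxA mxE; apply: eq_bigr => i _; rewrite !mxE mulr_sumr.
  by apply: eq_bigr => j _; ring.
by rewrite mxE; apply: eq_bigr => i _; rewrite mxE.
Qed.

Lemma sphere_coord_le x i : sphere n.+1 1 x -> `|x i ord0| <= 1.
Proof.
move=> /sphere1P h; rewrite -(@ler_pXn2r _ 2%N) ?nnegrE// expr1n real_normK ?num_real//.
rewrite -h (bigD1 i)//= lerDl sumr_ge0// => j _; exact: sqr_ge0.
Qed.

Lemma quad_bound W h x : sphere n.+1 1 x ->
  `|quad W h x| <= \sum_i \sum_j `|W i j| + \sum_i `|h i ord0|.
Proof.
move=> sx; have cx i := sphere_coord_le i sx.
rewrite quadE (le_trans (ler_normD _ _))// lerD//; last first.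
  rewrite (le_trans (ler_norm_sum _ _ _))// ler_sum// => i _.
  by rewrite normrM ler_piMr.
rewrite normrM ger0_norm ?invr_ge0// -[leRHS]mul1r ler_pM ?invr_ge0//; first lra.
rewrite (le_trans (ler_norm_sum _ _ _))// ler_sum// => i _.
rewrite (le_trans (ler_norm_sum _ _ _))// ler_sum// => j _.
by rewrite !normrM -mulrA ler_piMr// mulr_ile1.
Qed.

Lemma sphere_e0 : sphere n.+1 1 (delta_mx ord0 ord0 : CV).
Proof.
apply/sphere1P; rewrite (bigD1 ord0)//= big1 => [|i i0]; rewrite mxE !eqxx ?addr0 ?expr1n//.
by rewrite (negbTE i0) expr0n.
Qed.

Lemma has_sup_quad W h : has_sup [set quad W h x | x in sphere n.+1 1].
Proof.
split; first by exists (quad W h (delta_mx ord0 ord0)); exists (delta_mx ord0 ord0) => //; exact: sphere_e0.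
exists (\sum_i \sum_j `|W i j| + \sum_i `|h i ord0|) => _ [x sx <-].
exact: le_trans (ler_norm _) (quad_bound W h sx).
Qed.

Lemma max_quad_ub W h x : sphere n.+1 1 x -> quad W h x <= max_quad W h.
Proof. by move=> sx; apply: (ub_le_sup (proj2 (has_sup_quad W h))); exists x. Qed.

Lemma max_quad_le W h c : (forall x, sphere n.+1 1 x -> quad W h x <= c) -> max_quad W h <= c.
Proof.
move=> H; apply: ge_sup; first by case: (has_sup_quad W h).
by move=> _ [x sx <-]; exact: H.
Qed.

Lemma sphere_orthogonal (U : 'M[R]_n.+1) x : orthogonal U -> sphere n.+1 1 x -> sphere n.+1 1 (U *m x).
Proof.
by move=> oU /sphere1P h; apply/sphere1P; rewrite sqr_sumE sqr_sum_orthogonal// -sqr_sumE.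
Qed.

(** The sphere is invariant under [U]; one inequality is proved for all orthogonal matrices and
    applied to both [U] and its transpose. *)
Lemma max_quad_rotate (U W : 'M[R]_n.+1) v : orthogonal U ->
  max_quad W (U *m v) = max_quad (U^T *m W *m U) v.
Proof.
have le (U1 W1 : 'M[R]_n.+1) v1 : orthogonal U1 ->
    max_quad (U1^T *m W1 *m U1) v1 <= max_quad W1 (U1 *m v1).
  move=> oU; apply: max_quad_le => x sx.
  apply: le_trans (max_quad_ub W1 (U1 *m v1) (sphere_orthogonal oU sx)).
  rewrite /quad !trmx_mul -!mulmxA (mulmxA U1^T U1 x) oU mul1mx.
  by rewrite !mulmxA.
move=> oU; have oU' := mulmx1C oU.
apply/eqP; rewrite eq_le; apply/andP; split; last exact: le.
have := le U^T (U^T *m W *m U) (U *m v) (orthogonal_tr oU).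
have -> : U^T^T *m (U^T *m W *m U) *m U^T = W.
  by rewrite trmxK !mulmxA oU' mul1mx -mulmxA oU' mulmx1.
by rewrite mulmxA oU mul1mx.
Qed.

Definition diag l : 'M[R]_n.+1 := diag_mx (\row_i l i).

Lemma quad_diag l v x : quad (diag l) v x =
  2^-1 * (\sum_i l i * x i ord0 ^+ 2) + \sum_i v i ord0 * x i ord0.
Proof.
rewrite quadE; congr (_ * _ + _); apply: eq_bigr => i _.
rewrite (bigD1 i)//= big1 ?addr0 => [|j ji]; rewrite !mxE ?eqxx ?mulr1n; first by ring.
by rewrite eq_sym (negbTE ji) mulr0n !mul0r.
Qed.

Lemma max_quad_perturb l l' v d : (forall i, `|l i - l' i| <= d) ->
  max_quad (diag l) v <= max_quad (diag l') v + d.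
Proof.
move=> ld; apply: max_quad_le => x sx.
have := max_quad_ub (diag l') v sx; rewrite !quad_diag.
have d0 : 0 <= d := le_trans (normr_ge0 _) (ld ord0).
suff : \sum_i l i * x i ord0 ^+ 2 <= \sum_i l' i * x i ord0 ^+ 2 + d by lra.
have /sphere1P s1 := sx.
have -> : d = \sum_i d * x i ord0 ^+ 2 by rewrite -mulr_sumr s1 mulr1.
rewrite -big_split; apply: ler_sum => i _ /=; rewrite -mulrDl ler_wpM2r ?sqr_ge0//.
by have := ler_norm (l i - l' i); have := ld i; lra.
Qed.

(** Twice the Lagrange dual function of the unit sphere constraint, for the multiplier theta / 2. *)
Definition dual_fun l v theta := theta + \sum_i v i ord0 ^+ 2 / (theta - l i).

(** Weak duality: in each coordinate the difference is the square (v - (theta - l) x)^2 / (theta -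
    l). *)
Lemma max_quad_dual_le l v theta : (forall i, l i < theta) ->
  2 * max_quad (diag l) v <= dual_fun l v theta.
Proof.
move=> lt; suff : max_quad (diag l) v <= dual_fun l v theta / 2 by lra.
apply: max_quad_le => x /sphere1P s1; rewrite quad_diag /dual_fun.
have -> : theta = \sum_i theta * x i ord0 ^+ 2 by rewrite -mulr_sumr s1 mulr1.
rewrite mulr_sumr -!big_split mulr_suml /=; apply: ler_sum => i _.
rewrite -mulr_sumr s1 mulr1.
have z0 : 0 < theta - l i by have := lt i; lra.
set z := theta - l i in z0 *; have -> : l i = theta - z by rewrite /z; ring.
set a := v i ord0; set b := x i ord0.
have : 0 <= (a - z * b) ^+ 2 / z by rewrite divr_ge0 ?sqr_ge0// ltW.
have -> : (a - z * b) ^+ 2 / z = a ^+ 2 / z - 2 * a * b + z * b ^+ 2.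
  by field; rewrite gt_eqF.
lra.
Qed.

Lemma slow_dual_fun l v lamp : (forall i, l i <= lamp) -> slow lamp (dual_fun l v).
Proof.
move=> ll; have ti u i : lamp < u -> 0 < u - l i by have := ll i; lra.
split=> [u lu|u w lu uw].
  rewrite lerDl sumr_ge0// => i _; rewrite divr_ge0 ?sqr_ge0//; exact/ltW/ti.
rewrite /dual_fun; suff : \sum_i v i ord0 ^+ 2 / (w - l i) <= \sum_i v i ord0 ^+ 2 / (u - l i) by lra.
apply: ler_sum => i _; rewrite ler_wpM2l ?sqr_ge0// lef_pV2 ?posrE ?ti//; lra.
Qed.

(* Strong duality for the sphere-constrained problem: if the stationary point
   of the Lagrangian is too short for every theta, it can be completed along
   the top eigenvector at no asymptotic cost. *)
Lemma max_quad_dual l v lamp : (forall i, l i <= lamp) -> l ord0 = lamp ->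
  max_quad (diag l) v = half_inf lamp (dual_fun l v).
Proof.
move=> ll l0; have sd := slow_dual_fun v ll.
have ti u i : lamp < u -> 0 < u - l i by have := ll i; lra.
suff : 2 * max_quad (diag l) v = 2 * half_inf lamp (dual_fun l v) by lra.
apply/eqP; rewrite eq_le; apply/andP; split.
  by apply: half_inf_ge => u lu; apply: max_quad_dual_le => i; have := ll i; lra.
(* The squared length of the stationary point x_i = v_i / (u - l_i). At a [u] where it equals 1 this
   point is feasible and there is no duality gap. *)
pose s u := \sum_i (v i ord0 / (u - l i)) ^+ 2.
have [[u lu su]|ns] := pselect (exists2 u, lamp < u & s u = 1).
  apply: le_trans (half_inf_le sd lu) _.
  have sx : sphere n.+1 1 (\col_i (v i ord0 / (u - l i))).
    by apply/sphere1P; rewrite -su; apply: eq_bigr => i _; rewrite mxE.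
  suff : dual_fun l v u = 2 * quad (diag l) v (\col_i (v i ord0 / (u - l i))).
    by move=> ->; have := max_quad_ub (diag l) v sx; lra.
  rewrite quad_diag /dual_fun -{1}[u]mulr1 -{1}su /s.
  rewrite mulrDr mulrA divff ?mul1r// !mulr_sumr -!big_split /=; apply: eq_bigr => i _.
  rewrite mxE; have := ti u i lu => z0; field.
  by rewrite gt_eqF.
have s1 u : lamp < u -> s u < 1.
  move=> lu; rewrite ltNge; apply/negP => su.
  (* Far enough for the stationary point to have length at most 1; a value at least 1 at [u] would
     then produce length exactly 1 in between. *)
  pose b := u + \sum_i `|v i ord0| + 1.
  have V0 : 0 <= \sum_i `|v i ord0| by apply: sumr_ge0.
  have ub : u <= b by rewrite /b; lra.
  have sb : s b <= 1.
    pose V := \sum_i `|v i ord0|.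
    have bl i : V + 1 <= b - l i by rewrite /b -/V; have := ll i; lra.
    apply: (@le_trans _ _ (\sum_i (`|v i ord0| / (V + 1)))).
      apply: ler_sum => i _; have := bl i => bi.
      have V1 : 0 < V + 1 by rewrite /V; lra.
      have c1 : `|v i ord0| / (b - l i) <= `|v i ord0| / (V + 1).
        by rewrite ler_wpM2l// lef_pV2 ?posrE//; lra.
      have c2 : `|v i ord0| / (b - l i) <= 1.
        rewrite ler_pdivrMr; last by lra.
        rewrite mul1r (le_trans _ bi)// /V (bigD1 i)//=.
        have : 0 <= \sum_(j < n.+1 | j != i) `|v j ord0| by apply: sumr_ge0.
        lra.
      have c0 : 0 <= `|v i ord0| / (b - l i) by rewrite divr_ge0//; lra.
      have -> : (v i ord0 / (b - l i)) ^+ 2 = (`|v i ord0| / (b - l i)) ^+ 2.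
        by rewrite !expr_div_n real_normK ?num_real.
      apply: le_trans c1; rewrite expr2 ler_piMl//.
    rewrite -mulr_suml -/V ler_pdivrMr ?mul1r /V; lra.
  have cs : {within `[u, b], continuous s}.
    apply: continuous_in_subspaceT => x; rewrite inE/= in_itv/= => /andP[ux xb].
    apply: cvg_sumr => i; apply: cvg_sqr.
    apply: cvgM; first exact: cvg_cst.
    apply: cvgV; first by rewrite gt_eqF// ti//; lra.
    by apply: cvgB; [exact: cvg_id|exact: cvg_cst].
  have [|c] := @IVT R s u b 1 ub cs; first by rewrite ge_min sb orbT le_max su.
  by rewrite in_itv/= => /andP[uc cb] sc; apply: ns; exists c => //; lra.
apply/ler_addgt0Pr => e e0; pose u := lamp + e.
have lu : lamp < u by rewrite /u; lra.
apply: le_trans (half_inf_le sd lu) _.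
pose t := \sum_(i < n.+1 | i != ord0) (v i ord0 / (u - l i)) ^+ 2.
have sE : s u = (v ord0 ord0 / e) ^+ 2 + t.
  by rewrite /s (bigD1 ord0)//= l0; congr ((_ / _) ^+ 2 + _); rewrite /u; ring.
have st := s1 u lu; have t0 : 0 <= t by apply: sumr_ge0 => i _; exact: sqr_ge0.
have ve0 := sqr_ge0 (v ord0 ord0 / e).
pose q := Num.sqrt (1 - t); have q2 : q ^+ 2 = 1 - t by rewrite sqr_sqrtr//; lra.
have q0 : 0 <= q by exact: sqrtr_ge0.
have qv : `|v ord0 ord0| <= q * e.
  rewrite -ler_pdivrMr// -(@ler_pXn2r _ 2%N) ?nnegrE ?divr_ge0 ?(ltW e0)// q2.
  by move: sE; rewrite !expr_div_n real_normK ?num_real//; lra.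
(* The first coordinate completes the vector to length 1; its sign is that of the linear term, so
   that this term contributes positively. *)
pose c := if 0 <= v ord0 ord0 then q else - q.
have c2 : c ^+ 2 = q ^+ 2 by rewrite /c; case: ifP => // _; rewrite sqrrN.
have vc : v ord0 ord0 * c = `|v ord0 ord0| * q.
  rewrite /c; case: ifPn => [h|]; first by rewrite ger0_norm.
  by rewrite -ltNge => h; rewrite ltr0_norm// mulrN mulNr.
pose x : CV := \col_i (if i == ord0 then c else v i ord0 / (u - l i)).
have x0 : x ord0 ord0 = c by rewrite mxE eqxx.
have xi i : i != ord0 -> x i ord0 = v i ord0 / (u - l i) by move=> i0; rewrite mxE (negbTE i0).
have sx : sphere n.+1 1 x.
  apply/sphere1P; rewrite (bigD1 ord0)//= x0 c2 q2.
  by rewrite (eq_bigr _ (fun i i0 => congr1 (fun a => a ^+ 2) (xi i i0))) -/t; lra.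
have := max_quad_ub (diag l) v sx; rewrite quad_diag => mq.
suff : dual_fun l v u - e <= \sum_i l i * x i ord0 ^+ 2 + 2 * \sum_i v i ord0 * x i ord0 by lra.
have /sphere1P xs := sx.
have -> : dual_fun l v u = \sum_i (u * x i ord0 ^+ 2 + v i ord0 ^+ 2 / (u - l i)).
  by rewrite big_split /= -mulr_sumr xs mulr1.
rewrite mulr_sumr -big_split /= (bigD1 ord0)//= [leRHS](bigD1 ord0)//= x0.
rewrite (eq_bigr (fun i => l i * x i ord0 ^+ 2 + 2 * (v i ord0 * x i ord0))); last first.
  move=> i i0; rewrite xi//; have := ti u i lu => z0; field.
  by rewrite gt_eqF.
suff : u * c ^+ 2 + v ord0 ord0 ^+ 2 / (u - l ord0) - e <=
  l ord0 * c ^+ 2 + 2 * (v ord0 ord0 * c) by lra.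
rewrite l0 vc c2; have -> : u - lamp = e by rewrite /u; ring.
have -> : u = lamp + e by [].
have -> : v ord0 ord0 ^+ 2 / e = `|v ord0 ord0| * (`|v ord0 ord0| / e).
  by rewrite mulrA -expr2 real_normK ?num_real.
have h1 : `|v ord0 ord0| / e <= q by rewrite ler_pdivrMr.
have h2 := ler_wpM2l (normr_ge0 (v ord0 ord0)) h1.
have h3 : q ^+ 2 <= 1 by lra.
have h4 := ler_wpM2l (ltW e0) h3.
have h5 := mulr_ge0 (normr_ge0 (v ord0 ord0)) q0.
lra.
Qed.

End max_quad_lemmas.

(** * Measurability of the maximum *)

Section max_quad_measurable.
Context {R : realType} (n : nat).
Local Notation TR := (measurableTypeR R).
Local Notation CV := 'cV[R]_n.+1.
Implicit Types (W : 'M[R]_n.+1) (h x y : CV).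

Let norm2 y : R := \sum_i y i ord0 ^+ 2.

Let unit_of y : CV := if y == 0 then delta_mx ord0 ord0 else (Num.sqrt (norm2 y))^-1 *: y.

Let norm2_gt0 y : y != 0 -> 0 < norm2 y.
Proof.
move=> y0; rewrite lt_def sumr_ge0 ?andbT => [|i _]; last exact: sqr_ge0.
apply: contra_neq y0 => /eqP; rewrite psumr_eq0 => [/allP h|i _]; last exact: sqr_ge0.
apply/matrixP => i j; rewrite (ord1 j) mxE; apply/eqP.
by have := h i (mem_index_enum i); rewrite /= sqrf_eq0.
Qed.

Let sphere_unit_of y : sphere n.+1 1 (unit_of y).
Proof.
rewrite /unit_of; have [_|y0] := eqVneq y 0; first exact: sphere_e0.
apply/sphere1P; have N0 := norm2_gt0 y0.
transitivity ((Num.sqrt (norm2 y))^-1 ^+ 2 * norm2 y).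
  by rewrite mulr_sumr; apply: eq_bigr => i _; rewrite mxE exprMn.
by rewrite exprVn sqr_sqrtr ?(ltW N0)// mulVf// gt_eqF.
Qed.

(** The extension of the objective that is constant along rays. It is continuous near the sphere, so
    the supremum may be taken over normalised rational vectors, although rational points themselves
    seldom lie on the sphere. *)
Let hom_quad W h y := 2^-1 * (\sum_i \sum_j W i j * y i ord0 * y j ord0) / norm2 y
  + (\sum_i h i ord0 * y i ord0) / Num.sqrt (norm2 y).

Let hom_quadE W h y : y != 0 -> quad W h (unit_of y) = hom_quad W h y.
Proof.
move=> y0; have N0 := norm2_gt0 y0; rewrite quadE /unit_of (negbTE y0) /hom_quad.
set N := norm2 y in N0 *; set q := Num.sqrt N.
have q0 : 0 < q by rewrite sqrtr_gt0.
have q2 : q ^+ 2 = N by rewrite sqr_sqrtr// ltW.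
congr (_ + _).
  rewrite -mulrA; congr (_ * _); rewrite mulr_suml; apply: eq_bigr => i _.
  rewrite mulr_suml; apply: eq_bigr => j _; rewrite !mxE -q2; field.
  by rewrite gt_eqF.
rewrite mulr_suml; apply: eq_bigr => i _; rewrite !mxE; field.
by rewrite gt_eqF.
Qed.

Let csum x (g : 'I_n.+1 -> CV -> R) (a : 'I_n.+1 -> R) :
  (forall i, g i y @[y --> x] --> a i) -> \sum_i g i y @[y --> x] --> \sum_i a i.
Proof. exact: (@cvg_sumr R CV (nbhs x) _ _ g a (nbhs_filter x)). Qed.

Let csqr x (g : CV -> R) (a : R) : g y @[y --> x] --> a -> g y ^+ 2 @[y --> x] --> a ^+ 2.
Proof. exact: (@cvg_sqr R CV (nbhs x) g a (nbhs_filter x)). Qed.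

Let hom_quad_cvg W h x : sphere n.+1 1 x -> hom_quad W h y @[y --> x] --> hom_quad W h x.
Proof.
move=> /sphere1P sx; have Nx : norm2 x = 1 by [].
have cc i : (fun y : CV => y i ord0) @ nbhs x --> x i ord0 by exact: coord_continuous.
have cN : norm2 @ nbhs x --> norm2 x := csum (fun i => csqr (cc i)).
have c1 : (fun y : CV => \sum_i \sum_j W i j * y i ord0 * y j ord0) @ nbhs x -->
    \sum_i \sum_j W i j * x i ord0 * x j ord0.
  apply: (@csum x (fun i y => \sum_j W i j * y i ord0 * y j ord0)
    (fun i => \sum_j W i j * x i ord0 * x j ord0)) => i.
  apply: (@csum x (fun j y => W i j * y i ord0 * y j ord0)
    (fun j => W i j * x i ord0 * x j ord0)) => j.
  exact: (cvgM (cvgM (cvg_cst (W i j)) (cc i)) (cc j)).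
have N0 : norm2 x != 0 by rewrite Nx oner_neq0.
have c2 : (fun y => (norm2 y)^-1) @ nbhs x --> (norm2 x)^-1 by exact: (cvgV N0 cN).
have c3 : (fun y : CV => \sum_i h i ord0 * y i ord0) @ nbhs x --> \sum_i h i ord0 * x i ord0.
  apply: (@csum x (fun i y => h i ord0 * y i ord0) (fun i => h i ord0 * x i ord0)) => i.
  exact: (cvgM (cvg_cst (h i ord0)) (cc i)).
have S0 : Num.sqrt (norm2 x) != 0 by rewrite Nx sqrtr1 oner_neq0.
have c4 : (fun y => (Num.sqrt (norm2 y))^-1) @ nbhs x --> (Num.sqrt (norm2 x))^-1.
  exact: (cvgV S0 (cvg_comp _ _ cN (@sqrt_continuous R _))).
exact: (cvgD (cvgM (cvgM (cvg_cst (2^-1 : R)) c1) c2) (cvgM c3 c4)).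
Qed.

Let dense (k : nat) : CV := if (unpickle k : option 'cV[rat]_n.+1) is Some c
  then unit_of (\col_i ratr (c i ord0)) else delta_mx ord0 ord0.

Let sphere_dense k : sphere n.+1 1 (dense k).
Proof. by rewrite /dense; case: unpickle => [c|]; [exact: sphere_unit_of|exact: sphere_e0]. Qed.

Let max_quad_sups W h : max_quad W h = sups (fun k => quad W h (dense k)) 0.
Proof.
have hs : has_sup [set quad W h (dense k) | k in [set k | (0 <= k)%N]].
  split; first by exists (quad W h (dense 0)); exists 0%N.
  by exists (max_quad W h) => _ [k _ <-]; exact: max_quad_ub.
apply/eqP; rewrite eq_le; apply/andP; split; last first.
  by apply: (ge_sup (proj1 hs)) => _ [k _ <-]; exact: max_quad_ub.
apply: max_quad_le => x sx; apply/ler_addgt0Pr => e e0.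
have x0 : x != 0.
  apply: contraPneq sx => -> /sphere1P; rewrite big1 => [/eqP|i _]; first by rewrite eq_sym oner_eq0.
  by rewrite mxE expr0n.
have ux : unit_of x = x.
  move/sphere1P : (sx) => sx'; rewrite /unit_of (negbTE x0).
  by rewrite /norm2 sx' sqrtr1 invr1 scale1r.
have near1 : \forall y \near nbhs x, hom_quad W h x - e < hom_quad W h y.
  have lt1 : hom_quad W h x - e < hom_quad W h x by lra.
  exact: (@hom_quad_cvg W h x sx _ (open_nbhs_nbhs (conj (@open_gt R _) lt1))).
have near2 : \forall y \near nbhs x, norm2 y > 0.
  have cN : norm2 @ nbhs x --> norm2 x.
    exact: (csum (fun i => csqr (@coord_continuous R n.+1 1 i ord0 x))).
  exact: (cN _ (open_nbhs_nbhs (conj (@open_gt R _) (norm2_gt0 x0)))).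
have /nbhs_ballP[d /= d0 dU] : nbhs x ([set y | hom_quad W h x - e < hom_quad W h y] `&`
    [set y | norm2 y > 0]) by exact: filterI near1 near2.
have cex i : exists q : rat, `|x i ord0 - ratr q| < d.
  have lt : x i ord0 - d < x i ord0 + d by lra.
  have [q] := rat_in_itvoo lt; rewrite in_itv/= => /andP[q1 q2].
  by exists q; rewrite ltr_norml; lra.
pose c : 'cV[rat]_n.+1 := \col_i projT1 (cid (cex i)).
pose y : CV := \col_i ratr (c i ord0).
have [qy Ny] : hom_quad W h x - e < hom_quad W h y /\ 0 < norm2 y.
  by apply: dU; split => // i j; rewrite (ord1 j) !mxE; case: cid.
have y0 : y != 0.
  apply: contraTneq Ny => ->; rewrite /norm2 big1 ?ltxx// => i _; by rewrite mxE expr0n.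
have : quad W h (dense (pickle c)) <= sups (fun k => quad W h (dense k)) 0.
  by apply: (ub_le_sup (proj2 hs)); exists (pickle c).
rewrite {1}/dense pickleK -/y hom_quadE//.
by rewrite -{1}ux hom_quadE//; lra.
Qed.

Lemma measurable_max_quad : measurable_fun
  [set: borel_mx R n.+1 n.+1 * borel_mx R n.+1 1]
  (fun Wh : borel_mx R n.+1 n.+1 * borel_mx R n.+1 1 =>
     max_quad (Wh.1 : 'M[R]_n.+1) (Wh.2 : CV) : TR).
Proof.
have -> : (fun Wh : borel_mx R n.+1 n.+1 * borel_mx R n.+1 1 =>
     max_quad (Wh.1 : 'M[R]_n.+1) (Wh.2 : CV) : TR) =
   (fun Wh => sups (fun k => quad (Wh.1 : 'M[R]_n.+1) (Wh.2 : CV) (dense k)) 0).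
  by apply/funext => Wh; exact: max_quad_sups.
apply: measurable_fun_sups => [Wh _|k].
  by exists (max_quad (Wh.1 : 'M[R]_n.+1) (Wh.2 : CV)) => _ [k _ <-]; exact: max_quad_ub.
under eq_fun do rewrite quadE.
have m1 i j : measurable_fun [set: borel_mx R n.+1 n.+1 * borel_mx R n.+1 1]
    (fun Wh => (Wh.1 : 'M[R]_n.+1) i j : TR).
  exact: (measurableT_comp (@measurable_coord R n.+1 n.+1 i j) measurable_fst).
have m2 i : measurable_fun [set: borel_mx R n.+1 n.+1 * borel_mx R n.+1 1]
    (fun Wh => (Wh.2 : CV) i ord0 : TR).
  exact: (measurableT_comp (@measurable_coord R n.+1 1 i ord0) measurable_snd).
apply: measurable_funD.
  apply: measurable_funM; first exact: measurable_cst.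
  apply: measurable_sum => i; apply: measurable_sum => j.
  apply: measurable_funM; last exact: measurable_cst.
  by apply: measurable_funM; [exact: m1|exact: measurable_cst].
apply: measurable_sum => i.
by apply: measurable_funM; [exact: m2|exact: measurable_cst].
Qed.

End max_quad_measurable.

(** * Real laws determined by countably many half-lines *)

Section real_law_unique.
Context {R : realType}.
Local Notation TR := (measurableTypeR R).

Let Q : set (set TR) := [set A | exists q : rat, A = `]-oo, ratr q[%classic].

Let sigmaQ : (@measurable _ TR) = <<s Q >>.
Proof.
apply/seteqP; split; last first.
  apply: smallest_sub; first exact: sigma_algebra_measurable.
  by move=> _ [q ->]; exact: measurable_itv.
have -> : (@measurable _ TR) = <<s @RGenInftyO.G R >> := RGenInftyO.measurableE R.
apply: smallest_sub; first exact: smallest_sigma_algebra.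
move=> _ [x ->].
have -> : `]-oo, x[%classic = \bigcup_(q : rat) (if (ratr q : R) < x then `]-oo, ratr q[%classic else set0).
  apply/seteqP; split => y /=; rewrite in_itv/=.
    move=> yx; have [q] := rat_in_itvoo yx; rewrite in_itv/= => /andP[q1 q2].
    by exists q => //; rewrite q2/= in_itv.
  by move=> [q _]; case: ifP => //= qx; rewrite in_itv/= => /lt_trans; exact.
apply: (@bigcupT_measurable_rat _ (g_sigma_algebraType Q)) => q.
case: ifP => _; last exact: measurable0.
by apply: sub_sigma_algebra; exists q.
Qed.

(** Countability of the generating family is the point: it allows exceptional null sets to be
    merged. *)
Lemma rational_halfline_unique (m1 m2 : {measure set TR -> \bar R}) :
  (m1 setT < +oo)%E -> (forall q : rat, m1 `]-oo, ratr q[%classic = m2 `]-oo, ratr q[%classic) ->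
  forall A, measurable A -> m1 A = m2 A.
Proof.
move=> moo m12 A mA.
apply: (measure_unique Q (fun k : nat => `]-oo, ratr k%:R[%classic)) => //.
- move=> _ _ [p ->] [q ->]; exists (Order.min p q); apply/seteqP; split => x /=;
    rewrite !in_itv/=; case: (leP p q) => pq.
  + by move=> [].
  + by move=> [].
  + move=> xp; split => //; apply: (lt_le_trans xp); by rewrite ler_rat.
  + move=> xq; split => //; apply: (lt_trans xq); by rewrite ltr_rat.
- by move=> k; exists k%:R.
- apply/seteqP; split => // x _; exists (Num.truncn `|x|).+1 => //=.
  rewrite in_itv/= ratr_nat (le_lt_trans (ler_norm x))//.
  by rewrite truncnS_gt.
- by move=> _ [q ->]; exact: m12.
- move=> k; apply: le_lt_trans moo; apply: le_measure; rewrite ?inE//; exact: measurable_itv.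
Qed.

End real_law_unique.

(** * Conditional laws under independence *)

Section conditional_law_lemmas.
Context d d1 d2 {T : measurableType d} {T1 : measurableType d1} {T2 : measurableType d2}
  {R : realType} (P : probability T R) (X : {RV P >-> T1}) (Y : {RV P >-> T2})
  (f : T1 * T2 -> measurableTypeR R).
Hypothesis mf : measurable_fun setT f.
Hypothesis XY : independent_RVs X Y.
Local Notation TR := (measurableTypeR R).

Let mu1 : probability T1 R := distribution P X.
Let mu2 : probability T2 R := distribution P Y.

Let mXY : measurable_fun setT (fun w : T => (X w, Y w)).
Proof. by apply: measurable_fun_pair. Qed.

Let joint C : measurable C -> P [set w | C (X w, Y w)] = (\int[mu1]_x mu2 [set y | C (x, y)])%E.
Proof.
move=> mC.
have H := @product_measure_unique _ _ T1 T2 R mu1 mu2 (push_prob P mXY).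
have XY' A B : measurable A -> measurable B -> push_prob P mXY (A `*` B) = (mu1 A * mu2 B)%E.
  by move=> mA mB; apply: etrans (XY mA mB); apply: push_probE.
rewrite -[LHS](push_probE P mXY C) -(H XY' C mC).
apply: eq_integral => x _ /=; congr (mu2 _).
by apply/seteqP; split => y /=; rewrite /xsection/= ?inE//; move/mem_set.
Qed.

Let sec x : measurable_fun setT (fun y => f (x, y)).
Proof. exact: (measurableT_comp mf (pair1_measurable x)). Qed.

Let mlaw B : measurable B -> measurable_fun setT (fun x => mu2 [set y | B (f (x, y))]).
Proof.
move=> mB; have := @measurable_fun_xsection _ _ T1 T2 R mu2 _ (measurable_preim mf mB).
by congr measurable_fun; apply/funext => x /=; congr (mu2 _);
  apply/seteqP; split => y /=; rewrite /xsection/= ?inE//; move/mem_set.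
Qed.

(** For a fixed [B] both sides have the same integrals over all sets, hence agree almost surely.
    Applying this to rational half-lines only gives one null set, outside of which the two measures
    coincide on every Borel set. *)
Lemma conditional_law_independent (kappa : R.-pker T1 ~> TR) :
  conditional_law X (fun w => f (X w, Y w)) kappa ->
  {ae P, forall w, forall B, measurable B -> kappa (X w) B = mu2 [set y | B (f (X w, y))]}.
Proof.
move=> cl.
have key B : measurable B -> {ae mu1, forall x, kappa x B = mu2 [set y | B (f (x, y))]}.
  move=> mB.
  have : ae_eq mu1 setT (kappa ^~ B) (fun x => mu2 [set y | B (f (x, y))]).
    apply: integral_ae_eq => //; [|exact: mlaw|].
      apply/integrableP; split; first exact: measurable_kernel.
      apply: (@le_lt_trans _ _ (\int[mu1]_x cst 1%E x)%E); last first.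
        apply: le_lt_trans (ltry 1); rewrite (integral_cst mu1 measurableT 1%E) mul1e.
        exact: probability_le1.
      apply: ge0_le_integral => //.
      + by apply: measurableT_comp => //; exact: measurable_kernel.
      + move=> x _; rewrite gee0_abs ?measure_ge0//.
        by rewrite -(@prob_kernel _ _ _ _ _ kappa x); apply: le_measure; rewrite ?inE.
    move=> A _ mA; rewrite -cl//.
    have mC : measurable ((A `*` setT) `&` f @^-1` B).
      by apply: measurableI; [exact: measurableX|exact: measurable_preim].
    have -> : X @^-1` A `&` (fun w => f (X w, Y w)) @^-1` B =
        [set w | ((A `*` setT) `&` f @^-1` B) (X w, Y w)].
      by apply/seteqP; split => w /=; [move=> []|move=> [[]]].
    rewrite joint// [RHS]integral_mkcond; apply: eq_integral => x _; rewrite patchE.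
    case: ifPn => [/set_mem Ax|/negP nA].
      by congr (mu2 _); apply/seteqP; split => y //= -[].
    rewrite (_ : [set y | _] = set0) ?measure0//.
    by apply/seteqP; split => y //= -[[Ax _] _]; apply: nA; exact: mem_set.
  by apply: filterS => x; exact.
have : {ae mu1, forall x, forall k : nat, forall q : rat, unpickle k = Some q ->
    kappa x `]-oo, ratr q[%classic = mu2 [set y | `]-oo, ratr q[%classic (f (x, y))]}.
  apply/ae_foralln => k; case: (unpickle k) => [q|]; last by apply: nearW.
  have mI : measurable (`]-oo, ratr q[%classic : set TR) by exact: measurable_itv.
  by apply: filterS (key _ mI) => x h p [<-].
move=> [N [mN N0 sN]]; exists (X @^-1` N); split => //.
  by rewrite -[X in measurable X]setTI; exact: measurable_funP.
move=> w nw; apply: sN => /= hx; apply: nw => B mB.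
apply: (@rational_halfline_unique R (kappa (X w)) (pushforward mu2 (fun y => f (X w, y)))) => //.
  by rewrite prob_kernel ltry.
by move=> q; rewrite (hx (pickle q) q)// pickleK.
Qed.

End conditional_law_lemmas.

(** * Relative entropy *)

(** Integrability is not assumed: positive and negative parts are compared separately. This covers
    logarithms of densities, whose integrals may be infinite. *)
Lemma le_integral_ae d (T : measurableType d) (R : realType) (mu : {measure set T -> \bar R})
    (f g : T -> \bar R) :
  measurable_fun setT f -> measurable_fun setT g ->
  {ae mu, forall x, (f x <= g x)%E} -> (\int[mu]_x f x <= \int[mu]_x g x)%E.
Proof.
move=> mf mg fg; rewrite integralE [leRHS]integralE; apply: leeB.
- apply: ae_ge0_le_integral => //; [exact: measurable_funepos..|].
  by apply: filterS fg => x fgx _; rewrite funeposE funeposE ge_max le_max fgx/= le_max lexx orbT.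
- apply: ae_ge0_le_integral => //; [exact: measurable_funeneg..|].
  by apply: filterS fg => x fgx _; rewrite funenegE funenegE ge_max le_max leeN2 fgx/= le_max lexx orbT.
Qed.

Lemma measurable_lne_EFin d (T : measurableType d) (R : realType) (f : T -> measurableTypeR R) :
  measurable_fun setT f -> measurable_fun setT (fun x => lne ((f x : R)%:E)).
Proof.
move=> mf.
have -> : (fun x => lne ((f x : R)%:E)) =
    (fun x => if (f x : R) <= 0 then -oo%E else (ln (f x : R))%:E).
  by apply/funext => x.
apply: measurable_fun_ifT; first exact: measurable_fun_ler.
  exact: measurable_cst.
apply/measurable_EFinP.
exact: measurableT_comp.
Qed.

Lemma finite_density d (T : measurableType d) (R : realType) (mu : {measure set T -> \bar R})
    (w : T -> \bar R) :
  measurable_fun setT w -> (forall x, 0 <= w x)%E -> (\int[mu]_x w x < +oo)%E ->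
  exists rho : {finite_measure set T -> \bar R}, forall A, (rho A = \int[mu]_(x in A) w x)%E.
Proof.
move=> mw w0 fin; pose rho0 (A : set T) := (\int[mu]_(x in A) w x)%E.
have rho00 : rho0 set0 = 0%E by rewrite /rho0 integral_set0.
have rho0_ge0 A : (0 <= rho0 A)%E by exact: integral_ge0.
have rho0_add : semi_sigma_additive rho0.
  move=> F mF tF mUF; rewrite /rho0 ge0_integral_bigcup//.
    by apply: is_cvg_ereal_nneg_natsum_cond => n _ _; exact: rho0_ge0.
  exact: measurable_funTS.
pose m := isMeasure.Build _ T R rho0 rho00 rho0_ge0 rho0_add.
pose rho1 : {measure set T -> \bar R} := HB.pack rho0 m.
have fin1 : fin_num_fun rho1.
  move=> A mA; rewrite ge0_fin_numE; last exact: rho0_ge0.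
  by apply: le_lt_trans fin; exact: ge0_subset_integral.
pose f := Measure_isFinite.Build _ T R rho1 fin1.
pose rho : {finite_measure set T -> \bar R} := HB.pack (rho1 : set T -> \bar R) m f.
by exists rho.
Qed.

(** * Integrals of bounded continuous functions and entropy bounds *)

Section finite_measure_means.
Context {R : realType}.
Local Notation TR := (measurableTypeR R).
Implicit Types (nu : {finite_measure set TR -> \bar R}) (f : R -> R).

Lemma bcont_measurable f : bcont f -> measurable_fun setT (f : TR -> TR).
Proof. by move=> [cf _]; exact: continuous_measurable_fun. Qed.

Lemma bcont_integrable nu f : bcont f -> nu.-integrable setT (EFin \o (f : TR -> R)).
Proof.
move=> bf; apply: measurable_bounded_integrable => //.
- by rewrite ltey_eq fin_num_measure.
- exact: bcont_measurable.
- by case: bf => _ [C fC]; exists C; split; [exact: num_real|move=> M CM x _ /=; exact: le_trans (fC x) (ltW CM)].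
Qed.

Definition mean (nu : {measure set TR -> \bar R}) f := fine (\int[nu]_x (f x)%:E).

Lemma meanE nu f : bcont f -> (\int[nu]_x (f x)%:E = (mean nu f)%:E)%E.
Proof. by move=> bf; rewrite fineK//; apply: integrable_fin_num => //; exact: bcont_integrable. Qed.

Lemma mean_nuD nu f g : bcont f -> bcont g ->
  mean nu (fun x => f x + g x) = mean nu f + mean nu g.
Proof.
move=> bf bg; apply: EFin_inj; rewrite EFinD -!meanE//; last exact: bcontD.
under eq_integral do rewrite EFinD.
by rewrite integralD//; exact: bcont_integrable.
Qed.

Lemma mean_nuZ nu k f : bcont f -> mean nu (fun x => k * f x) = k * mean nu f.
Proof.
move=> bf; apply: EFin_inj; rewrite EFinM -!meanE//; last exact: bcontZ.
under eq_integral do rewrite EFinM.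
by rewrite integralZl//; exact: bcont_integrable.
Qed.

Lemma mean_nu1 nu : (mean nu (fun=> 1))%:E = nu setT.
Proof. by rewrite -meanE; [rewrite (integral_cst nu measurableT 1%E) mul1e|exact: bcont_cst]. Qed.

Lemma concentrated_ae (nu : {measure set TR -> \bar R}) lamm lamp :
  concentrated_on nu `[lamm, lamp] -> {ae nu, forall x, lamm <= x <= lamp}.
Proof.
move=> cnu; exists (~` `[lamm, lamp]%classic); split => //.
by apply: measurableC; exact: measurable_itv.
Qed.

Lemma mean_nu_le nu lamm lamp f g : concentrated_on nu `[lamm, lamp] -> bcont f -> bcont g ->
  (forall x, lamm <= x <= lamp -> f x <= g x) -> mean nu f <= mean nu g.
Proof.
move=> cnu bf bg fg; rewrite -lee_fin -!meanE//; apply: le_integral_ae.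
- by apply/measurable_EFinP; exact: bcont_measurable.
- by apply/measurable_EFinP; exact: bcont_measurable.
- have [N [mN N0 sN]] := concentrated_ae cnu; exists N; split => //.
  apply: (subset_trans _ sN); apply: subsetC => x /= Kx; by rewrite lee_fin fg.
Qed.

Lemma mean_probability (q : probability TR R) lamm lamp :
  concentrated_on q `[lamm, lamp] -> mean_on lamm lamp (mean q).
Proof.
move=> cq; split.
- by move=> f g bf bg; exact: mean_nuD.
- by move=> k f bf; exact: mean_nuZ.
- by apply: EFin_inj; rewrite mean_nu1; exact: probability_setT.
- by move=> f g bf bg fg; exact: mean_nu_le fg.
Qed.

Lemma concentrated_le (q : probability TR R) lamm lamp :
  concentrated_on q `[lamm, lamp] -> lamm <= lamp.
Proof.
move=> cq; rewrite leNgt; apply/negP => lt.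
have : q (~` `[lamm, lamp]%classic) = 1%E.
  by rewrite set_itv_ge ?setC0 ?bnd_simp -?ltNge//; exact: probability_setT.
by rewrite cq => /eqP; rewrite eq_sym onee_eq0.
Qed.

(** The Radon-Nikodym derivative is replaced by a version that is real and nonnegative everywhere,
    so that pointwise inequalities for the logarithm apply. *)
Lemma entropy_density (q : probability TR R) nu : q `<< nu ->
  exists f : R -> R, [/\ measurable_fun setT (f : TR -> TR), (forall x, 0 <= f x),
    (forall A, measurable A -> (q A = \int[nu]_(x in A) (f x)%:E)%E)
  & (rel_entropy q nu = \int[q]_x lne (f x)%:E + nu setT - 1)%E].
Proof.
move=> qnu; pose g := Radon_Nikodym_SigmaFinite.f q nu.
have gE x : ((fine (g x))%:E = g x)%E.
  by rewrite fineK//; exact: Radon_Nikodym_SigmaFinite.f_fin_num.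
have mg : measurable_fun setT g.
  exact: measurable_int (Radon_Nikodym_SigmaFinite.f_integrable qnu).
have mfg : measurable_fun setT (fun x => fine (g x) : TR) by exact: measurableT_comp.
exists (fun x => fine (g x)); split => //.
- by move=> x; rewrite fine_ge0// Radon_Nikodym_SigmaFinite.f_ge0.
- move=> A mA; under eq_integral do rewrite gE.
  exact: Radon_Nikodym_SigmaFinite.f_integral.
- rewrite /rel_entropy; case: asboolP => // _; congr (_ + _ - _)%E.
  have mRN : measurable_fun setT (Radon_Nikodym (charge_of_finite_measure q) nu).
    by exact: measurable_int (Radon_Nikodym_integrable _).
  have RNfin x : Radon_Nikodym (charge_of_finite_measure q) nu x \is a fin_num.
    exact: Radon_Nikodym_fin_num.
  apply: ae_eq_integral => //.
  + under eq_fun do rewrite -(fineK (RNfin _)).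
    by apply: measurable_lne_EFin; exact: measurableT_comp.
  + exact: measurable_lne_EFin.
  have [N [mN N0 sN]] := null_dominates_ae_eq measurableT qnu
    (ae_eq_Radon_Nikodym_SigmaFinite qnu measurableT).
  exists N; split => //; apply: (subset_trans _ sN); apply: subsetC => x /= h _.
  by rewrite -/(lne (fine (g x))%:E) gE /g (h I).
Qed.

Let density_change (q : probability TR R) nu (f g : R -> R) :
  measurable_fun setT (f : TR -> TR) -> (forall x, 0 <= f x) ->
  (forall A, measurable A -> (q A = \int[nu]_(x in A) (f x)%:E)%E) ->
  measurable_fun setT (g : TR -> TR) -> (forall x, 0 <= g x) ->
  (\int[q]_x (g x)%:E = \int[nu]_x (g x * f x)%:E)%E.
Proof.
move=> mf f0 fE mg g0.
have mf' : measurable_fun setT (EFin \o (f : TR -> R)) by exact/measurable_EFinP.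
have mg' : measurable_fun setT (EFin \o (g : TR -> R)) by exact/measurable_EFinP.
have f0' x : (0 <= (EFin \o f) x)%E by rewrite lee_fin.
have g0' x : (0 <= (EFin \o g) x)%E by rewrite lee_fin.
exact: (ge0_integral_density mf' f0' fE mg' g0').
Qed.

(** The counterpart of [hcost_ge] for an arbitrary finite measure: ln (w / f) <= w / f - 1, with f =
    dq/dnu, is integrated against [q]. *)
Lemma rel_entropy_ge (q : probability TR R) nu (w : R -> R) : bpos w ->
  ((mean q (fun x => ln (w x)) + mean nu (fun=> 1) - mean nu w)%:E <= rel_entropy q nu)%E.
Proof.
move=> bw; have [qnu|nqnu] := pselect (q `<< nu); last first.
  by rewrite /rel_entropy; case: asboolP => // _; exact: leey.
have [f [mf f0 fE ->]] := entropy_density qnu.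
have mw := bcont_measurable bw.1.
have bl := bcont_ln bw.
pose g x := w x / f x.
have mg : measurable_fun setT (g : TR -> TR).
  apply: measurable_funM => //.
  rewrite (_ : (fun _ => _) = (fun x => f x `^ (-1))).
    by apply: (@measurableT_comp _ _ _ _ _ _ (@powR R ^~ (-1)) _ f) => //; exact: measurable_powR.
  by apply/funext => x; rewrite powR_inv1.
have g0 x : 0 <= g x by rewrite mulr_ge0 ?invr_ge0// ltW// bpos_gt0.
(* Only an inequality, because [f] may vanish on a set charged by [nu]; there [g] is 0 by the
   convention on division. *)
have gle : (\int[q]_x (g x)%:E <= (mean nu w)%:E)%E.
  rewrite (density_change mf f0 fE mg g0) -meanE; last exact: bw.1.
  apply: ge0_le_integral => //.
  - by move=> x _; rewrite lee_fin mulr_ge0.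
  - by apply/measurable_EFinP; exact: measurable_funM.
  - exact/measurable_EFinP.
  - move=> x _; rewrite lee_fin /g; have [->|fx] := eqVneq (f x) 0.
      by rewrite mulr0 ltW// bpos_gt0.
    by rewrite -mulrA mulVf// mulr1.
have ig : q.-integrable setT (EFin \o (g : TR -> R)).
  apply/integrableP; split; first exact/measurable_EFinP.
  under eq_integral do rewrite /= ger0_norm//.
  exact: le_lt_trans gle (ltry _).
have ae0 : {ae q, forall x, 0 < f x}.
  have mN : measurable ([set x | f x <= 0] : set TR).
    rewrite (_ : [set x | _] = f @^-1` `]-oo, 0]%classic).
      by apply: (measurable_preim mf); exact: measurable_itv.
    by apply/seteqP; split => x /=; rewrite in_itv.
  exists [set x | f x <= 0]; split => //.
  - rewrite fE//; apply: integral0_eq => x /= fx; congr EFin; apply/eqP; by rewrite eq_le fx f0.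
  - by move=> x /= /negP; rewrite -leNgt.
rewrite -mean_nu1 -addeA -EFinD.
apply: (@le_trans _ _ (\int[q]_x (ln (w x) + 1 - g x)%:E + (mean nu (fun=> 1) - 1)%:E)%E).
  have -> : (\int[q]_x (ln (w x) + 1 - g x)%:E =
      (mean q (fun x => ln (w x) + 1))%:E - \int[q]_x (g x)%:E)%E.
    under eq_integral do rewrite EFinB.
    rewrite integralB//; last by apply: bcont_integrable; apply: bcontD => //; exact: bcont_cst.
    by rewrite meanE//; apply: bcontD => //; exact: bcont_cst.
  rewrite mean_nuD//; last exact: bcont_cst.
  have -> : mean q (fun=> 1) = 1 by apply: EFin_inj; rewrite mean_nu1; exact: probability_setT.
  have gfin := integrable_fin_num measurableT ig.
  rewrite -(fineK gfin) in gle *; rewrite -EFinB -EFinD !lee_fin in gle *.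
  by move: gle => /=; lra.
apply: leeD => //; apply: le_integral_ae.
- apply/measurable_EFinP; apply: measurable_funB => //; apply: measurable_funD => //.
  exact: bcont_measurable.
- exact: measurable_lne_EFin.
have [N [mN N0 sN]] := ae0; exists N; split => //.
apply: (subset_trans _ sN); apply: subsetC => x /= fx.
rewrite -/(lne (f x)%:E) lne_EFin// lee_fin.
have gx : 0 < g x by rewrite divr_gt0// bpos_gt0.
have : ln (g x) <= g x - 1 by exact: ln_le_sub1.
have wx : 0 < w x := bpos_gt0 x bw.
rewrite {1}/g ln_div ?posrE// => h.
by move: (ln (w x)) (ln (f x)) (g x) h => a b z; lra.
Qed.

Lemma density_measure (mu : {finite_measure set TR -> \bar R}) (w : R -> R) :
  bcont w -> (forall x, 0 <= w x) ->
  exists rho : {finite_measure set TR -> \bar R},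
    forall A, measurable A -> (rho A = \int[mu]_(x in A) (w x)%:E)%E.
Proof.
move=> bw w0.
have [] := @finite_density _ TR R mu (fun x => (w x)%:E).
- by apply/measurable_EFinP; exact: bcont_measurable.
- by move=> x; rewrite lee_fin.
- by rewrite meanE// ltry.
- by move=> rho rhoE; exists rho => A _.
Qed.

(** If [nu] dominates w q and f = dq/dnu, then the integral of f w against [q] is at most that of f
    against [nu], which is 1; it remains to integrate ln f <= f w - 1 - ln w. The derivative with
    respect to a measure with atoms is thus never computed. *)
Lemma rel_entropy_le (q : probability TR R) nu (w : R -> R) : bpos w ->
  (forall A, measurable A -> (\int[q]_(x in A) (w x)%:E <= nu A)%E) ->
  (rel_entropy q nu <= (mean nu (fun=> 1) - 1 - mean q (fun x => ln (w x)))%:E)%E.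
Proof.
move=> bw wnu.
have mw := bcont_measurable bw.1.
have bl := bcont_ln bw.
have w0 x : 0 <= w x by rewrite ltW// bpos_gt0.
have qnu : q `<< nu.
  apply/null_content_dominatesP => A mA nuA; apply/eqP; rewrite eq_le measure_ge0 andbT.
  case: (bw) => _ [c c0 cw].
  have h : (c%:E * q A <= 0)%E.
    rewrite -nuA; apply: le_trans (wnu A mA).
    rewrite -(integral_cst q mA c%:E); apply: ge0_le_integral => //.
    - by move=> x _; rewrite lee_fin ltW.
    - by apply/measurable_EFinP; exact: measurable_funTS.
    - by move=> x _; rewrite lee_fin.
  by rewrite -(pmule_rle0 _ (_ : 0 < c%:E)%E).
have [f [mf f0 fE ->]] := entropy_density qnu.
have [rho rhoE] := density_measure q bw.1 w0.
have mf' : measurable_fun setT (EFin \o (f : TR -> R)) by exact/measurable_EFinP.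
have mw' : measurable_fun setT (EFin \o (w : TR -> R)) by exact/measurable_EFinP.
have f0' x : (0 <= (EFin \o f) x)%E by rewrite lee_fin.
have w0' x : (0 <= (EFin \o w) x)%E by rewrite lee_fin.
have fw : (\int[q]_x (f x * w x)%:E <= 1)%E.
  apply: (@le_trans _ _ (\int[nu]_x (f x)%:E)%E); last first.
    by rewrite -fE//; exact: probability_le1.
  under eq_integral do rewrite EFinM.
  rewrite -(ge0_integral_density mw' w0' rhoE mf' f0').
  by apply: ge0_le_measure_integral => // A mA; apply: le_trans (wnu A mA); rewrite -rhoE.
have ifw : q.-integrable setT (EFin \o ((fun x => f x * w x) : TR -> R)).
  apply/integrableP; split; first by apply/measurable_EFinP; exact: measurable_funM.
  under eq_integral do rewrite /= ger0_norm ?mulr_ge0//.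
  exact: le_lt_trans fw (ltry _).
rewrite -mean_nu1 -addeA -EFinD.
apply: (@le_trans _ _ (\int[q]_x (f x * w x - (1 + ln (w x)))%:E + (mean nu (fun=> 1) - 1)%:E)%E).
  apply: leeD => //; apply: le_integral_ae.
  - exact: measurable_lne_EFin.
  - apply/measurable_EFinP; apply: measurable_funB; first exact: measurable_funM.
    by apply: measurable_funD => //; exact: bcont_measurable.
  apply/aeW => x; have := f0 x; rewrite le_eqVlt => /orP[/eqP <-|fx].
    by rewrite /lne/= lexx leNye.
  rewrite -/(lne (f x)%:E) lne_EFin// lee_fin.
  have wx : 0 < w x := bpos_gt0 x bw.
  have := ln_le_sub1 (mulr_gt0 fx wx).
  by rewrite lnM ?posrE// => h; clear -h; lra.
have b1 : bcont (fun x => 1 + ln (w x)) by apply: bcontD => //; exact: bcont_cst.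
have -> : (\int[q]_x (f x * w x - (1 + ln (w x)))%:E =
    \int[q]_x (f x * w x)%:E - (mean q (fun x => 1 + ln (w x)))%:E)%E.
  under eq_integral do rewrite EFinB.
  have ib := bcont_integrable q b1.
  by rewrite (integralB measurableT ifw ib) (meanE q b1).
rewrite mean_nuD//; last exact: bcont_cst.
have -> : mean q (fun=> 1) = 1 by apply: EFin_inj; rewrite mean_nu1; exact: probability_setT.
have fwfin := integrable_fin_num measurableT ifw.
rewrite -(fineK fwfin) in fw *; rewrite -EFinB -EFinD !lee_fin in fw *.
by move: fw; clear => /=; lra.
Qed.

End finite_measure_means.

(** * Sublevel sets of the rate functions *)

Definition rate {R : realType} (haar : bool) (lamm lamp Gamma : R)
    (q : probability (measurableTypeR R) R) :=
  if haar then rate_H lamm lamp Gamma q else rate_G lamm lamp Gamma q.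

Section rate_sublevels.
Context {R : realType} (lamm lamp Gamma : R) (q : probability (measurableTypeR R) R).
Hypothesis Gamma_gt0 : 0 < Gamma.
Hypothesis cq : concentrated_on q `[lamm, lamp].
Local Notation TR := (measurableTypeR R).
Local Notation E := (mean q).
Local Notation tint := (tint lamm lamp E).
Local Notation hcost := (hcost lamm lamp E).
Local Notation resolv := (resolv lamm lamp).
Local Notation Fnice := (Fnice lamm lamp Gamma E).
Local Notation level := (level lamm lamp E).
Local Notation Fmax := (Fmax lamm lamp Gamma E).
Local Notation Fmin := (Fmin lamm lamp Gamma E).
Implicit Types (nu : {finite_measure set TR -> \bar R}) (t : nice R) (haar : bool).

Let lam_le : lamm <= lamp := concentrated_le cq.
Let mE : mean_on lamm lamp E := mean_probability cq.

(** Realises a triple as a finite measure. The last property is what [rel_entropy_le] asks for. *)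
Lemma nice_measure t : valid t -> exists nu, [/\ concentrated_on nu `[lamm, lamp],
  forall f, bcont f -> mean nu f = tint t f &
  forall A, measurable A -> (\int[q]_(x in A) (dens t x)%:E <= nu A)%E].
Proof.
move=> [bw a0 b0]; have w0 x : 0 <= dens t x by rewrite ltW// bpos_gt0.
have [rho rhoE] := density_measure q bw.1 w0.
pose nu0 : {measure set TR -> \bar R} := measure_add (measure_add rho
  (mscale (NngNum a0) (\d_(lamm : TR)))) (mscale (NngNum b0) (\d_(lamp : TR))).
have nu0E A : nu0 A = (rho A + (atm t)%:E * \d_(lamm : TR) A + (atp t)%:E * \d_(lamp : TR) A)%E.
  by apply: etrans (measure_addE _ _ _) _; congr (_ + _)%E; exact: measure_addE.
have fin : fin_num_fun nu0.
  move=> A mA; rewrite nu0E !fin_numD !fin_numM ?fin_num_measure//.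
pose nu : {finite_measure set TR -> \bar R} :=
  HB.pack (nu0 : set TR -> \bar R) (Measure.class nu0) (Measure_isFinite.Build _ TR R nu0 fin).
exists nu; split.
- rewrite /concentrated_on.
  apply: etrans (nu0E _) _.
  rewrite rhoE; last by apply: measurableC; exact: measurable_itv.
  rewrite null_set_integral ?add0e//.
  + by rewrite !diracE !memNset ?mule0 ?add0e//= in_itv/= lexx ?lam_le ?andbT; move/negP; rewrite ?lam_le.
  + by apply: measurableC; exact: measurable_itv.
  + by apply: measurable_funTS; apply/measurable_EFinP; exact: bcont_measurable bw.1.
(* Additivity in the measure is available for nonnegative integrands; a bounded [f] is made
   nonnegative by adding a constant. *)
- suff pos f : bcont f -> (forall x, 0 <= f x) -> mean nu f = tint t f.
    move=> f bf; have [C fC] := bf.2.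
    have b1 : bcont (fun=> C : R) := bcont_cst C.
    have C0 : 0 <= C by apply: le_trans (fC 0).
    have h1 : mean nu (fun x => f x + C) = tint t (fun x => f x + C).
      apply: pos => [|x]; first exact: bcontD.
      by have := fC x; rewrite ler_norml => /andP[h _]; rewrite -lerBlDr sub0r.
    have h2 : mean nu (fun=> C) = tint t (fun=> C) by exact: pos.
    by move: h1; rewrite mean_nuD// (tintD mE)// h2 => /addIr.
  move=> bf f0.
  have mf : measurable_fun setT (EFin \o (f : TR -> R)).
    by apply/measurable_EFinP; exact: bcont_measurable.
  have f0' x : (0 <= (EFin \o f) x)%E by rewrite lee_fin.
  have mw : measurable_fun setT (EFin \o (dens t : TR -> R)).
    by apply/measurable_EFinP; exact: bcont_measurable bw.1.
  have w0' x : (0 <= (EFin \o dens t) x)%E by rewrite lee_fin.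
  apply: EFin_inj; rewrite -meanE//.
  transitivity (\int[nu0]_x (EFin \o f) x)%E => //.
  rewrite ge0_integral_measure_add// ge0_integral_measure_add//.
  rewrite ge0_integral_mscale// ge0_integral_mscale// !integral_dirac// !diracT !mul1e.
  rewrite (ge0_integral_density mw w0' rhoE mf f0') /tint !EFinD !EFinM; congr (_ + _ + _)%E.
  rewrite -meanE; last by apply: bcontM => //; exact: bw.1.
  by [].
- move=> A mA; rewrite -rhoE//.
  apply: le_trans (_ : (_ <= nu0 A)%E) => //; rewrite nu0E -addeA leeDl// adde_ge0//;
    by rewrite mule_ge0// lee_fin.
Qed.

(** Since [nu] is carried by the segment, the true resolvent and the truncated one agree almost
    everywhere, and all the values involved are real. *)
Lemma Fvar_mean nu : concentrated_on nu `[lamm, lamp] ->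
  Fvar lamp nu Gamma = (half_inf lamp (fun theta => theta + Gamma * mean nu (resolv theta)))%:E.
Proof.
move=> cnu; rewrite /Fvar /half_inf.
have nu_ge0 theta : lamp < theta -> 0 <= mean nu (resolv theta).
  move=> lt; rewrite /mean fine_ge0// integral_ge0// => x _.
  by rewrite lee_fin ltW// resolv_gt0.
have -> : [set (theta%:E + Gamma%:E * \int[nu]_(x in `]-oo, lamp]) (theta - x)^-1%:E)%E
    | theta in `]lamp, +oo[] =
    [set x%:E | x in [set theta + Gamma * mean nu (resolv theta) | theta in [set theta | lamp < theta]]].
  have key theta : lamp < theta -> (theta%:E + Gamma%:E *
      \int[nu]_(x in `]-oo, lamp]) (theta - x)^-1%:E)%E =
      (theta + Gamma * mean nu (resolv theta))%:E.
    move=> lt; rewrite EFinD EFinM -meanE; last by have [] := bpos_resolv lam_le lt.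
    congr (_ + _ * _)%E.
    rewrite integral_mkcond; apply: ae_eq_integral => //.
    + have mI : measurable (`]-oo, lamp]%classic : set TR) by exact: measurable_itv.
      apply/(measurable_restrictT _ mI).
      apply: (@eq_measurable_fun _ _ _ _ _ (fun x : TR => ((theta - (x : R)) `^ (-1))%:E)).
        move=> x; rewrite inE/= in_itv/= => xl.
        by rewrite powR_inv1// subr_ge0 (le_trans xl)// ltW.
      apply: measurable_funTS; apply/measurable_EFinP.
      apply: (@measurableT_comp _ _ _ _ _ _ (@powR R ^~ (-1)) _ (fun x : TR => theta - (x : R))).
        exact: measurable_powR.
      by apply: measurable_funB => //; exact: measurable_cst.
    + by apply/measurable_EFinP; apply: bcont_measurable; have [] := bpos_resolv lam_le lt.
    + have [N [mN N0 sN]] := concentrated_ae cnu; exists N; split => //.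
      apply: (subset_trans _ sN); apply: subsetC => x /= Kx _.
      rewrite patchE mem_set ?resolvE//= in_itv/=; by case/andP: Kx.
  apply/seteqP; split => y /=.
    move=> [theta]; rewrite in_itv/= andbT => lt <-; rewrite key//.
    by exists (theta + Gamma * mean nu (resolv theta)) => //; exists theta.
  by move=> [_ [theta lt <-] <-]; exists theta; rewrite ?key// in_itv/= andbT.
rewrite ereal_inf_EFin//; last by exists (lamp + 1 + Gamma * mean nu (resolv (lamp + 1))), (lamp + 1) => //=; lra.
exists lamp => _ [theta /= lt <-]; have := mulr_ge0 (ltW Gamma_gt0) (nu_ge0 _ lt); lra.
Qed.

Let half_inf_eq (g g' : R -> R) : (forall theta, lamp < theta -> g theta = g' theta) ->
  half_inf lamp g = half_inf lamp g'.
Proof.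
by move=> gg'; congr (2^-1 * inf _); apply/seteqP; split => _ [theta lt <-]; exists theta; rewrite ?gg'.
Qed.

Let bR theta : lamp < theta -> bcont (resolv theta).
Proof. by move=> lt; have [] := bpos_resolv lam_le lt. Qed.

Let realises nu t : valid t -> concentrated_on nu `[lamm, lamp] ->
  (forall f, bcont f -> mean nu f = tint t f) ->
  (forall A, measurable A -> (\int[q]_(x in A) (dens t x)%:E <= nu A)%E) ->
  Fvar lamp nu Gamma = (Fnice t)%:E /\ (rel_entropy q nu <= (hcost t)%:E)%E.
Proof.
move=> vt cnu nut dnu; split.
  by rewrite Fvar_mean//; congr EFin; apply: half_inf_eq => theta lt; rewrite nut//; exact: bR.
have [bw _ _] := vt.
by have := rel_entropy_le bw dnu; rewrite nut//; exact: bcont_cst.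
Qed.

Let half_le (e : \bar R) (h a : R) : (e <= h%:E)%E -> h <= 2 * a -> ((2^-1)%:E * e <= a%:E)%E.
Proof.
move=> eh ha; apply: (@le_trans _ _ ((2^-1)%:E * h%:E)%E).
  by apply: lee_wpmul2l => //; rewrite lee_fin; lra.
by rewrite -EFinM lee_fin; lra.
Qed.

Lemma rate_le haar a t : level haar a t -> (rate haar lamm lamp Gamma q (Fnice t) <= a%:E)%E.
Proof.
move=> [vt ha mass]; have [nu [cnu nut dnu]] := nice_measure vt.
case: haar mass => mass; last first.
  have [FE HE] := realises vt cnu nut dnu.
  apply: le_trans (half_le HE ha); apply: ereal_inf_lbound; exists nu => //; split => //.
have nuT : nu setT = 1%E by rewrite -mean_nu1 nut ?mass//; exact: bcont_cst.
pose p : probability TR R := HB.pack (nu : set TR -> \bar R) (Measure.class nu)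
  (Measure_isProbability.Build _ TR R nu nuT).
have cp : concentrated_on p `[lamm, lamp] by [].
have [FE HE] := @realises p t vt cp nut dnu.
by apply: le_trans (half_le HE ha); apply: ereal_inf_lbound; exists p.
Qed.

Lemma rel_entropy_ge0 nu : (0 <= rel_entropy q nu)%E.
Proof.
apply: le_trans (rel_entropy_ge q nu (bpos_cst ltr01)).
rewrite (_ : (fun x => ln 1) = (fun=> 0)) ?(mean_cst mE) ?lee_fin ?add0r ?subrr//.
by apply/funext => x; rewrite ln1.
Qed.

Lemma rate_ge0 haar m : (0 <= rate haar lamm lamp Gamma q m)%E.
Proof.
by case: haar; apply/ereal_infP => _ [nu _ <-]; rewrite mule_ge0// ?rel_entropy_ge0// lee_fin; lra.
Qed.

Let admissible haar nu m := [/\ concentrated_on nu `[lamm, lamp],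
  m%:E = Fvar lamp nu Gamma & haar -> mean nu (fun=> 1) = 1].

Let slow_mean nu : concentrated_on nu `[lamm, lamp] ->
  slow lamp (fun theta => theta + Gamma * mean nu (resolv theta)).
Proof.
move=> cnu; have mle := @mean_nu_le R nu lamm lamp _ _ cnu.
split => [u lu|u v lu uv].
  have : mean nu (fun=> 0) <= mean nu (resolv u).
    by apply: mle => //; [exact: bcont_cst|exact: bR|move=> x _; rewrite ltW// resolv_gt0].
  have -> : mean nu (fun=> 0) = 0 by rewrite /mean integral0.
  by move=> /(mulr_ge0 (ltW Gamma_gt0)); lra.
have : mean nu (resolv v) <= mean nu (resolv u).
  apply: mle; [apply: bR; exact: lt_le_trans uv|exact: bR|].
  by move=> x _; exact: resolv_anti.
by move=> /(ler_wpM2l (ltW Gamma_gt0)); lra.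
Qed.

Let mean_dual nu haar v theta : lamp < theta ->
  mean nu (dual_up lamm lamp Gamma haar v theta) =
  mean nu (resolv theta) - (if haar then slack Gamma v theta else 0) * mean nu (fun=> 1).
Proof.
move=> lt; rewrite /dual_up.
have b1 := bcont_cst (R := R) 1.
rewrite (_ : (fun x => _) = (fun x => resolv theta x +
   (- (if haar then slack Gamma v theta else 0)) * 1)); last first.
  by apply/funext => x; rewrite mulr1.
rewrite mean_nuD ?mean_nuZ//; [by rewrite mulNr|exact: bR|exact: bcontZ].
Qed.

Let mean_dualN nu haar v theta : lamp < theta ->
  mean nu (dual_dn lamm lamp Gamma haar v theta) = - mean nu (dual_up lamm lamp Gamma haar v theta).
Proof.
move=> lt; rewrite -mulN1r -mean_nuZ; last exact: bcont_dual_up.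
by congr mean; apply/funext => x; rewrite /dual_dn /dual_up; lra.
Qed.

Let mean_one_sub nu s f : bcont f ->
  mean nu (fun x => 1 - s * f x) = mean nu (fun=> 1) - s * mean nu f.
Proof.
move=> bf; rewrite (_ : (fun x => _) = (fun x => 1 + (- s) * f x)); last first.
  by apply/funext => x; rewrite mulNr.
by rewrite mean_nuD ?mean_nuZ ?mulNr//; [exact: bcont_cst|exact: bcontZ].
Qed.

(** This is where nice measures are seen to suffice: if [m] were outside of the interval, the
    multiplier found on nice measures would provide a weight 1 - s f, and [rel_entropy_ge] for this
    weight would contradict the entropy bound of the arbitrary measure [nu]. *)
Lemma admissible_bounds haar nu m a' a : 0 <= a' -> a' < a -> admissible haar nu m ->
  (rel_entropy q nu <= (2 * a')%:E)%E -> Fmin haar a <= m <= Fmax haar a.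
Proof.
move=> a0 aa' [cnu mF mass] Hle; rewrite Fvar_mean// in mF; case: mF => mF.
have sl := slow_mean cnu.
have a0' : 0 <= a by lra.
apply/andP; split; rewrite leNgt; apply/negP => lt.
  pose v := (m + Fmin haar a) / 2.
  have [theta lth gth] : exists2 theta, lamp < theta & theta + Gamma * mean nu (resolv theta) < 2 * v.
    by apply: half_inf_lt; rewrite -mF /v; lra.
  have [|s [s0 bw hs]] := @dual_lower R lamm lamp Gamma E lam_le Gamma_gt0 mE haar a' a
     (Fmin haar a) v theta a0 aa' _ (fun t lt => Fnice_ge_min lam_le Gamma_gt0 mE a0' lt) lth.
    by rewrite /v; lra.
  have := le_trans (rel_entropy_ge q nu bw) Hle; rewrite lee_fin.
  rewrite mean_one_sub; last exact: bcont_dual_dn.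
  rewrite mean_dualN// mean_dual//.
  have sE := slackE Gamma_gt0 v theta.
  have : mean nu (resolv theta) <= slack Gamma v theta.
    by rewrite -(ler_pM2l Gamma_gt0) sE; lra.
  move: hs; rewrite /dual_thr; clear lt bw; clearbody v.
  case: haar mass => [/(_ isT) ->|_] hs /(ler_wpM2l s0) h1 h2; nra.
have [theta [s [lth s0 bw hs]]] := @dual_upper R lamm lamp Gamma E lam_le Gamma_gt0 mE haar a' a
     (Fmax haar a) m a0 aa' lt (fun t lt => Fnice_le_max lam_le Gamma_gt0 mE a0' lt).
have gth : 2 * m <= theta + Gamma * mean nu (resolv theta) by rewrite mF; exact: (half_inf_le sl).
have := le_trans (rel_entropy_ge q nu bw) Hle; rewrite lee_fin.
rewrite mean_one_sub; last exact: bcont_dual_up.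
rewrite mean_dual//.
have sE := slackE Gamma_gt0 m theta.
have : slack Gamma m theta <= mean nu (resolv theta).
  by rewrite -(ler_pM2l Gamma_gt0) sE; lra.
move: hs; rewrite /dual_thr; clear lt bw.
case: haar mass => [/(_ isT) ->|_] hs /(ler_wpM2l s0) h1 h2; nra.
Qed.

(** The infimum defining the rate may not be attained; a level [b] strictly between [a] and [a']
    leaves room for a nearly optimal measure. *)
Lemma rate_bounds haar m a a' : 0 <= a -> a < a' ->
  (rate haar lamm lamp Gamma q m <= a%:E)%E -> Fmin haar a' <= m <= Fmax haar a'.
Proof.
move=> a0 aa' Ra; pose b := (a + a') / 2.
have lt : (rate haar lamm lamp Gamma q m < b%:E)%E.
  by apply: le_lt_trans Ra _; rewrite lte_fin /b; lra.
have Hle (e : \bar R) : ((2^-1)%:E * e < b%:E)%E -> (e <= (2 * b)%:E)%E.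
  case: e => [r| |]; rewrite ?leNye//.
    by rewrite -EFinM lte_fin lee_fin; lra.
  by rewrite gt0_muley ?lte_fin ?invr_gt0// ltNge leey.
have b0 : 0 <= b by rewrite /b; lra.
have ba : b < a' by rewrite /b; lra.
case: haar lt {Ra} => /ereal_inf_lt[_ [nu [cnu mF] <-] /Hle h].
  apply: (@admissible_bounds true nu m b a' b0 ba) => //; split => // _.
  by apply: EFin_inj; rewrite mean_nu1; exact: probability_setT.
by apply: (@admissible_bounds false nu m b a' b0 ba).
Qed.

End rate_sublevels.

(** * A criterion for large deviation principles *)

Section limits.
Context {R : realType}.
Implicit Types (u : nat -> \bar R) (c : \bar R).

Lemma limn_esup_le_near u c : (\forall n \near \oo, (u n <= c)%E) -> (limn_esup u <= c)%E.
Proof.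
move=> uc; rewrite /limn_esup /limf_esup.
apply: (@le_trans _ _ (ereal_sup [set u n | n in [set n | (u n <= c)%E]])).
  by apply: ereal_inf_lbound; exists [set n | (u n <= c)%E].
by apply: ge_ereal_sup => _ [n /= un <-].
Qed.

Lemma limn_einf_ge_near u c : (\forall n \near \oo, (c <= u n)%E) -> (c <= limn_einf u)%E.
Proof.
move=> uc; rewrite /limn_einf leeNr; apply: limn_esup_le_near.
by apply: filterS uc => n; rewrite leeN2.
Qed.

End limits.

Section LDP_criterion.
Context {R : realType}.
Local Notation TR := (measurableTypeR R).
Variables (mu : nat -> {measure set TR -> \bar R}) (I : R -> \bar R) (V U : R -> R).

Hypothesis mu_le1 : forall n, (mu n setT <= 1)%E.
Hypothesis I_ge0 : forall m, (0 <= I m)%E.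
Hypothesis VU : forall a, 0 <= a -> V a <= U a.
Hypothesis I_le : forall a a' m, 0 <= a -> a < a' -> V a <= m <= U a -> (I m <= a'%:E)%E.
Hypothesis le_I : forall a a' m, 0 <= a -> a < a' -> (I m <= a%:E)%E -> V a' <= m <= U a'.
Hypothesis upper_tail : forall a' a v, 0 <= a' -> a' < a -> U a < v ->
  \forall n \near \oo, (mu n [set x | v <= x]%R <= (expR (- (n.+1%:R * a')))%:E)%E.
Hypothesis lower_tail : forall a' a v, 0 <= a' -> a' < a -> v < V a ->
  \forall n \near \oo, (mu n [set x | x <= v]%R <= (expR (- (n.+1%:R * a')))%:E)%E.
Hypothesis local_lower : forall a a' m e, 0 <= a -> a < a' -> V a <= m <= U a -> 0 < e ->
  \forall n \near \oo, ((expR (- (n.+1%:R * a')))%:E <= mu n [set x | (m - e < x < m + e)%R])%E.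

(** The intervals [[V a], [U a]] locate the sublevel sets up to an arbitrarily small change of
    level. Hence each sublevel set at a nonnegative level is an intersection of compact intervals,
    which gives lower semicontinuity and compactness. *)
Let sublevel a : 0 <= a -> [set m | (I m <= a%:E)%E] =
  \bigcap_(b in [set b | a < b]) `[V b, U b]%classic.
Proof.
move=> a0; apply/seteqP; split => m /=.
  by move=> Im b ab; rewrite /= in_itv/=; exact: le_I Im.
move=> h; apply/lee_addgt0Pr => e e0; rewrite -EFinD.
apply: (@I_le (a + e / 2)); [lra|lra|].
by have := h (a + e / 2); rewrite /= in_itv/=; apply; lra.
Qed.

Let sublevel_neg a : a < 0 -> [set m | (I m <= a%:E)%E] = set0.
Proof.
move=> a0; apply/seteqP; split => m //= Im.
by have := le_trans (I_ge0 m) Im; rewrite lee_fin; lra.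
Qed.

Let sublevel_closed a : closed [set m | (I m <= a%:E)%E].
Proof.
have [a0|a0] := ltP a 0; first by rewrite sublevel_neg//; exact: closed0.
by rewrite sublevel//; apply: closed_bigI => b _; exact: interval_closed.
Qed.

Let good : good_rate_function I.
Proof.
split => // [|a].
  move=> x a ax; exists (~` [set m | (I m <= a%:E)%E]); last first.
    by move=> y /= /negP; rewrite -ltNge.
  apply: open_nbhs_nbhs; split; first by apply: closed_openC; exact: sublevel_closed.
  by move=> /=; apply/negP; rewrite -ltNge.
have [a0|a0] := ltP a 0; first by rewrite sublevel_neg//; exact: compact0.
apply: (@subclosed_compact _ _ `[V (a + 1), U (a + 1)]%classic).
- exact: sublevel_closed.
- exact: segment_compact.
- by rewrite sublevel// => m; apply => /=; lra.
Qed.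

Let lne_le (N : R) (p : \bar R) (a : R) : 0 < N -> (p <= (expR (- (N * a)))%:E)%E ->
  ((N^-1)%:E * lne p <= (- a)%:E)%E.
Proof.
move=> N0 pa; have [p0|p0] := leP p 0%E.
  by rewrite le0_lneNy// gt0_muleNy ?leNye// lte_fin invr_gt0.
case: p p0 pa => [p| |]//; rewrite ?lte_fin ?lee_fin => p0 pa.
rewrite lne_EFin// -EFinM lee_fin ler_pdivrMl//.
rewrite -ler_expR lnK ?posrE// (le_trans pa)// ler_expR; lra.
Qed.

Let lne_ge (N : R) (p : \bar R) (a : R) : 0 < N -> ((expR (- (N * a)))%:E <= p)%E ->
  ((- a)%:E <= (N^-1)%:E * lne p)%E.
Proof.
move=> N0; case: p => [p| |]//; rewrite ?lee_fin => pa; last first.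
  by rewrite /= gt0_muley ?leey// lte_fin invr_gt0.
have p0 : 0 < p by rewrite (lt_le_trans _ pa)// expR_gt0.
rewrite lne_EFin// -EFinM lee_fin ler_pdivlMl//.
by rewrite -ler_expR [leRHS]lnK ?posrE// (le_trans _ pa)// ler_expR; lra.
Qed.

Let lower_bound B : measurable B -> (- ereal_inf (I @` interior (B : set R))
  <= limn_einf (fun n => ((n.+1%:R)^-1)%:E * lne (mu n B)))%E.
Proof.
move=> mB; rewrite leeNl; apply/ereal_infP => _ [m Bm <-]; rewrite leeNl.
case Im : (I m) => [a| |]; rewrite ?leNye//; last by have := I_ge0 m; rewrite Im.
have a0 : 0 <= a by have := I_ge0 m; rewrite Im lee_fin.
have /nbhs_ballP[e /= e0 eB] : nbhs m (B : set R) by [].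
apply/lee_subgt0Pr => d d0; rewrite -EFinN -EFinB.
have bm : V (a + d / 2) <= m <= U (a + d / 2).
  by apply: (@le_I a) => //; [lra|rewrite Im].
apply: limn_einf_ge_near.
have := @local_lower (a + d / 2) (a + d) m e _ _ bm e0.
move=> /(_ ltac:(lra) ltac:(lra)); apply: filterS => n /= h.
rewrite -opprD; apply: lne_ge; first exact: ltr0Sn.
apply: (le_trans h); apply: le_measure; rewrite ?inE//.
  rewrite (_ : [set x | _] = `]m - e, m + e[%classic); first exact: measurable_itv.
  by apply/seteqP; split => x /=; rewrite in_itv.
by move=> x /= xm; apply: eB; rewrite /ball/= ltr_norml; case/andP: xm; lra.
Qed.

Let measurable_ge v : measurable ([set x | v <= x] : set TR).
Proof.
rewrite (_ : [set x | _] = `[v, +oo[%classic); first exact: measurable_itv.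
by apply/seteqP; split => x /=; rewrite in_itv/= andbT.
Qed.

Let measurable_le v : measurable ([set x | x <= v] : set TR).
Proof.
rewrite (_ : [set x | _] = `]-oo, v]%classic); first exact: measurable_itv.
by apply/seteqP; split => x /=; rewrite in_itv/=.
Qed.

(** The closure of [B] misses [[V a], [U a]] for a level [a] slightly above [c], and even a
    neighbourhood of the end points; so [B] lies in two tails, each of rate c + d. The spare factor
    exp (N d) absorbs the 2 of the union bound. *)
Let upper_bound_real (B : set TR) c : measurable B -> 0 <= c ->
  (c%:E < ereal_inf (I @` closure (B : set R)))%E ->
  (limn_esup (fun n => ((n.+1%:R)^-1)%:E * lne (mu n B)) <= (- c)%:E)%E.
Proof.
move=> mB c0 cJ.
have [d d0 dJ] : exists2 d, 0 < d & ((c + 3 * d)%:E < ereal_inf (I @` closure (B : set R)))%E.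
  move: cJ; case: ereal_inf => [j| |]; rewrite ?lte_fin//.
    by move=> cj; exists ((j - c) / 4); rewrite ?lte_fin; lra.
  by exists 1; rewrite ?ltry.
pose a := c + 2 * d.
have a0 : 0 <= a by rewrite /a; lra.
have notB m : V a <= m <= U a -> (~` closure (B : set R)) m.
  move=> am Bm; have : (I m <= (c + 3 * d)%:E)%E by apply: (I_le a0 _ am); rewrite /a; lra.
  by apply/negP; rewrite -ltNge (lt_le_trans dJ)//; apply: ereal_inf_lbound; exists m.
have aVU := VU a0.
have oB : open (~` closure (B : set R)) by apply: closed_openC; exact: closed_closure.
have /nbhs_ballP[e1 /= e10 e1B] : nbhs (U a) (~` closure (B : set R)).
  by apply: open_nbhs_nbhs; split => //; apply: notB; rewrite aVU lexx.
have /nbhs_ballP[e2 /= e20 e2B] : nbhs (V a) (~` closure (B : set R)).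
  by apply: open_nbhs_nbhs; split => //; apply: notB; rewrite aVU lexx.
pose v1 := U a + e1 / 2; pose v2 := V a - e2 / 2.
have Bsub : (B : set R) `<=` [set x | x <= v2] `|` [set x | v1 <= x].
  move=> x Bx /=; have cBx := subset_closure Bx.
  have [xv2|v2x] := leP x v2; first by left.
  right; rewrite leNgt; apply/negP => xv1.
  have [Vx|xV] := leP (V a) x; last first.
    by apply: (e2B x) => //; rewrite /ball/= ltr_norml; move: v2x; rewrite /v2; lra.
  have [xU|Ux] := leP x (U a); first by apply: (notB x) => //; rewrite Vx.
  by apply: (e1B x) => //; rewrite /ball/= ltr_norml; move: xv1; rewrite /v1; lra.
have T1 : \forall n \near \oo, (mu n [set x | v1 <= x]%R <= (expR (- (n.+1%:R * (c + d))))%:E)%E.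
  by apply: (@upper_tail _ a); rewrite /a /v1; lra.
have T2 : \forall n \near \oo, (mu n [set x | x <= v2]%R <= (expR (- (n.+1%:R * (c + d))))%:E)%E.
  by apply: (@lower_tail _ a); rewrite /a /v2; lra.
apply: limn_esup_le_near; near=> n.
apply: lne_le; first exact: ltr0Sn.
have mu_le : (mu n B <= mu n [set x | x <= v2]%R + mu n [set x | v1 <= x]%R)%E.
  apply: (@le_trans _ _ (mu n ([set x : TR | (x <= v2)%R] `|` [set x : TR | (v1 <= x)%R]))).
    by apply: le_measure; rewrite ?inE//; exact: measurableU.
  exact: measureU2.
apply: (le_trans mu_le).
have h1 : (mu n [set x | v1 <= x]%R <= (expR (- (n.+1%:R * (c + d))))%:E)%E by near: n.
have h2 : (mu n [set x | x <= v2]%R <= (expR (- (n.+1%:R * (c + d))))%:E)%E by near: n.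
apply: (le_trans (leeD h2 h1)); rewrite -EFinD lee_fin.
have nd : d^-1 <= n%:R by near: n; exact: nbhs_infty_ger.
have Nd : 1 <= n.+1%:R * d.
  by rewrite -ler_pdivrMr// div1r (le_trans nd)// ler_nat.
have exp2 : 2 <= expR (n.+1%:R * d) by apply: le_trans (expR_ge1Dx _); lra.
have -> : - (n.+1%:R * c) = n.+1%:R * d + - (n.+1%:R * (c + d)) by ring.
by rewrite expRD -mulr2n -[leLHS]mulr_natl ler_wpM2r// expR_ge0.
Unshelve. all: by end_near. Qed.

Let lne_le0 n B : measurable B -> (((n.+1%:R)^-1)%:E * lne (mu n B) <= 0)%E.
Proof.
move=> mB; have h : (mu n B <= (expR (- (n.+1%:R * 0)))%:E)%E.
  rewrite mulr0 oppr0 expR0; apply: le_trans (mu_le1 n).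
  by apply: le_measure; rewrite ?inE.
by have := lne_le (ltr0Sn R n) h; rewrite oppr0.
Qed.

Let upper_bound (B : set TR) : measurable B ->
  (limn_esup (fun n => ((n.+1%:R)^-1)%:E * lne (mu n B)) <=
    - ereal_inf (I @` closure (B : set R)))%E.
Proof.
move=> mB; set s := limn_esup _.
have s0 : (s <= 0)%E by apply: limn_esup_le_near; apply: nearW => n; exact: lne_le0.
have key := upper_bound_real mB.
move: key; set J := ereal_inf _ => key; rewrite -/s in key.
rewrite leNgt; apply/negP => Js.
(* The infimum may be infinite, so a real rate strictly between is used; it is admissible since the
   limit superior is at most 0. *)
have [r /andP[r1 r2]] : exists r : R, (- J < r%:E)%E && (r%:E < s)%E.
  move: s0 Js; case: (s) => [x| |]//; last by move=> _; rewrite ltNge leNye.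
  case: (- J)%E => [j| |]//; rewrite ?lte_fin.
    by move=> _ jx; exists ((j + x) / 2); rewrite !lte_fin; apply/andP; split; lra.
  by move=> _ _; exists (x - 1); rewrite ltNyr/= lte_fin ltrBlDr ltrDl ltr01.
have r0 : r <= 0 by have := lt_le_trans r2 s0; rewrite lte_fin => /ltW.
have := key (- r) _ _; rewrite opprK => h.
have cJ : ((- r)%:E < J)%E by rewrite EFinN lteNl.
have c0 : 0 <= - r by rewrite oppr_ge0.
by have := lt_le_trans r2 (h c0 cJ); rewrite ltxx.
Qed.

Lemma LDP_of_levels : LDP_good (fun n => n.+1%:R) mu I.
Proof. by split => // B mB; split; [exact: lower_bound|exact: upper_bound]. Qed.

End LDP_criterion.

(** * Exponential estimates for Gaussian vectors *)

Section gauss_line.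
Context {R : realType}.
Local Notation TR := (measurableTypeR R).
Local Notation leb := (@lebesgue_measure R).
Local Notation gauss := (normal_prob (0 : R) 1).

(** Up to the factor [s], the integrand times the density is the normal density of standard
    deviation s = (1 - f)^(-1/2). *)
Lemma gauss_mgf (f : R) : f < 1 ->
  (\int[gauss]_x (expR (f / 2 * (x : R) ^+ 2))%:E = (expR (- (ln (1 - f) / 2)))%:E)%E.
Proof.
move=> f1; have f0 : 0 < 1 - f by lra.
have mexp : measurable_fun setT (fun x : TR => expR (f / 2 * (x : R) ^+ 2) : TR).
  apply: (@measurableT_comp _ _ _ _ _ _ (@expR R) _ (fun x : TR => f / 2 * (x : R) ^+ 2)).
    exact: measurable_expR.
  by apply: measurable_funM; [exact: measurable_cst|exact: measurable_funX].
rewrite ge0_integral_gauss//; first last.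
  by apply/measurable_EFinP.
pose s := expR (- (ln (1 - f) / 2)).
have s0 : 0 < s := expR_gt0 _.
have s2 : s ^+ 2 = (1 - f)^-1.
  rewrite expr2 -expRD -opprD -splitr expRN lnK//.
rewrite (_ : (fun x => _) = (fun x => s%:E * (normal_pdf 0 s x)%:E)%E); last first.
  apply/funext => x; rewrite -!EFinM; congr EFin.
  rewrite !normal_pdfE ?gt_eqF// /normal_fun /normal_peak s2 expr1n !subr0.
  have -> : Num.sqrt ((1 - f)^-1 * pi *+ 2) = s * Num.sqrt (1 * pi *+ 2).
    rewrite -s2 -mulrnAr sqrtrM ?sqr_ge0// sqrtr_sqr gtr0_norm// mul1r//.
  move: (Num.sqrt (1 * pi *+ 2)) => p.
  rewrite invfM mulrCA -expRD !mulrA mulfV ?gt_eqF// mul1r.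
  by congr (_ * expR _); field; lra.
rewrite ge0_integralZl//.
- by rewrite integral_normal_pdf mule1.
- by apply/measurable_EFinP; exact: measurable_normal_pdf.
- by move=> x _; rewrite lee_fin normal_pdf_ge0.
- by rewrite lee_fin ltW.
Qed.

(** The density is smallest at the right end of this interval of length 1; the constant 2 comes from
    sqrt (2 pi) <= 3 <= exp 2. *)
Lemma gauss_interval_ge (c : R) : 0 <= c ->
  ((expR (- ((c + 1) ^+ 2 / 2 + 2)))%:E <= gauss `[c, (c + 1)%R]%classic)%E.
Proof.
move=> c0; rewrite /normal_prob.
set J : set TR := `[c, (c + 1)%R]%classic.
have mJ : measurable J by exact: measurable_itv.
pose k : R := expR (- ((c + 1) ^+ 2 / 2 + 2)).
have LJ : leb J = 1%E.
  apply: etrans (lebesgue_measure_itv _) _; rewrite /= lte_fin ltrDl ltr01 -EFinB.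
  by rewrite [(c + 1)%R]addrC addrK.
have Jk : (\int[leb]_(x in J) (cst k%:E x) = k%:E)%E.
  by apply: etrans (integral_cst leb mJ k%:E) _; apply: etrans (congr1 (mule k%:E) LJ) _; exact: mule1.
rewrite -/k -[leLHS]Jk.
apply: ge0_le_integral => //.
- by move=> x _; rewrite lee_fin expR_ge0.
- by apply: measurable_funTS; apply/measurable_EFinP; exact: measurable_normal_pdf.
move=> x; rewrite /J /= in_itv/= => /andP[cx xc]; rewrite lee_fin normal_pdfE ?oner_neq0//.
rewrite /normal_fun /normal_peak expr1n subr0 mul1r.
rewrite /k opprD addrC expRD; apply: ler_pM; rewrite ?expR_ge0//; last first.
  have xx : x * x <= (c + 1) * (c + 1) by apply: ler_pM => //; lra.
  by rewrite ler_expR mulNr lerN2 ler_pM2r ?invr_gt0// !expr2.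
rewrite expRN lef_pV2 ?posrE ?expR_gt0 ?sqrtr_gt0//; last by rewrite pmulrn_lgt0// pi_gt0.
have e3 : 3 <= expR 2 :> R by apply: le_trans (expR_ge1Dx _); lra.
apply: le_trans e3; rewrite -(@ler_pXn2r _ 2) ?nnegrE ?sqrtr_ge0// sqr_sqrtr; last first.
  by rewrite mulrn_wge0// pi_ge0.
have h := @pihalf_lt2 R; rewrite -mulr_natl expr2; lra.
Qed.

End gauss_line.

(** * Gaussian vectors under a product change of measure *)

Section weighted_gauss.
Context {R : realType} (n : nat).
Local Notation TR := (measurableTypeR R).
Local Notation V := (borel_mx R n 1).
Local Notation gauss := (normal_prob (0 : R) 1).
Variables (gamma : probability V R) (g : 'I_n -> R -> R).
Hypothesis gammaE : gauss_law gamma.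
Hypothesis mg : forall i, measurable_fun setT (g i : TR -> TR).
Hypothesis g0 : forall i x, 0 <= g i x.

Definition weight (z : 'cV[R]_n) := \prod_i g i (z i ord0).

Lemma weight_ge0 z : 0 <= weight z.
Proof. by apply: prodr_ge0 => i _. Qed.

Lemma prod_EFin (I : Type) (s : seq I) (u : I -> R) :
  (\prod_(i <- s) (u i)%:E = (\prod_(i <- s) u i)%:E)%E.
Proof. by elim: s => [|i s IH]; rewrite ?big_nil// !big_cons IH. Qed.

Let mcoord (u : R -> R) i : measurable_fun setT (u : TR -> TR) ->
  measurable_fun setT (fun z : V => u ((z : 'cV[R]_n) i ord0) : TR).
Proof. by move=> mu; exact: (measurableT_comp mu (@measurable_coord R n 1 i ord0)). Qed.

Lemma measurable_weight : measurable_fun setT (fun z : V => (weight z)%:E).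
Proof.
under eq_fun do rewrite /weight -prod_EFin.
by apply: emeasurable_prod => i; apply/measurable_EFinP; exact: mcoord.
Qed.

Lemma measurable_quad_form (f : 'I_n -> R) :
  measurable_fun setT (fun z : V => \sum_i f i * (z : 'cV[R]_n) i ord0 ^+ 2 : TR).
Proof.
apply: measurable_sum => i; apply: measurable_funM; first exact: measurable_cst.
by apply: measurable_funX; exact: measurable_coord.
Qed.

Lemma measurable_quad_ge (f : 'I_n -> R) (c : R) :
  measurable ([set z | c <= \sum_i f i * z i ord0 ^+ 2] : set V).
Proof.
have mI : measurable (`[c, +oo[%classic : set TR) by exact: measurable_itv.
have := measurable_preim (measurable_quad_form f) mI.
by congr measurable; apply/seteqP; split => z /=; rewrite in_itv/= andbT.
Qed.

(** Exponential Markov inequality under the weighted law; [k i] is the logarithmic moment generating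
    function of the i-th coordinate. *)
Lemma weighted_chernoff (f k : 'I_n -> R) (s c : R) : 0 <= s ->
  (forall i, (\int[gauss]_x (expR (s * f i / 2 * (x : R) ^+ 2) * g i x)%:E = (expR (k i))%:E)%E) ->
  (\int[gamma]_(z in [set z | (c <= \sum_i f i * z i ord0 ^+ 2)%R]) (weight z)%:E
    <= (expR (\sum_i k i - s * c / 2))%:E)%E.
Proof.
move=> s0 kE.
pose u i (x : TR) : \bar R := (expR (s * f i / 2 * (x : R) ^+ 2) * g i x)%:E.
have mu i : measurable_fun setT (u i).
  apply/measurable_EFinP; apply: measurable_funM; last exact: mg.
  apply: (@measurableT_comp _ _ _ _ _ _ (@expR R) _ (fun x : TR => s * f i / 2 * (x : R) ^+ 2)).
    exact: measurable_expR.
  by apply: measurable_funM; [exact: measurable_cst|exact: measurable_funX].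
have u0 : forall i x, (0 <= u i x)%E.
  by move=> i x; rewrite lee_fin mulr_ge0// expR_ge0.
pose U (z : V) : \bar R := (\prod_i u i ((z : 'cV[R]_n) i ord0))%E.
have U0 z : (0 <= U z)%E by apply: prode_ge0 => j _.
have mU : measurable_fun setT U.
  by apply: emeasurable_prod => i; exact: (measurableT_comp (mu i) (@measurable_coord R n 1 i ord0)).
have IU : (\int[gamma]_z U z = (expR (\sum_i k i))%:E)%E.
  rewrite (prod_law_integral gammaE mu u0).
  by under eq_bigr do rewrite kE; rewrite prod_EFin expR_sum.
set A := [set z | _]; have mA : measurable (A : set V) by exact: measurable_quad_ge.
apply: (@le_trans _ _ (\int[gamma]_(z in A) ((expR (- (s * c / 2)))%:E * U z))%E).
  apply: ge0_le_integral => //.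
  - by move=> z _; rewrite lee_fin weight_ge0.
  - exact: measurable_funTS measurable_weight.
  - by apply: measurable_funTS; apply: emeasurable_funM => //; exact: measurable_cst.
  move=> z Az; rewrite /U /u prod_EFin -EFinM lee_fin big_split/= mulrA -/(weight z).
  rewrite -[leLHS]mul1r ler_wpM2r ?weight_ge0// -expR_sum -expRD.
  rewrite -[leLHS]expR0 ler_expR; move: Az; rewrite /A/=.
  have -> : \sum_i s * f i / 2 * z i ord0 ^+ 2 = s / 2 * \sum_i f i * z i ord0 ^+ 2.
    by rewrite mulr_sumr; apply: eq_bigr => i _; ring.
  by move: (\sum_i _) => S cS; have := ler_wpM2l s0 cS; lra.
apply: (@le_trans _ _ (\int[gamma]_z ((expR (- (s * c / 2)))%:E * U z))%E).
  apply: ge0_subset_integral => //.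
  - by apply: emeasurable_funM => //; exact: measurable_cst.
  - by move=> z _; apply: mule_ge0; [rewrite lee_fin expR_ge0|exact: U0].
rewrite ge0_integralZl// ?lee_fin ?expR_ge0//.
by rewrite IU -EFinM -expRD addrC.
Qed.

Lemma weight_total : (forall i, (\int[gauss]_x (g i x)%:E = 1)%E) ->
  (\int[gamma]_z (weight z)%:E = 1)%E.
Proof.
move=> gE; under eq_integral do rewrite /weight -prod_EFin.
have mu i : measurable_fun setT (fun x : TR => (g i x)%:E) by apply/measurable_EFinP; exact: mg.
have u0 i x : (0 <= (g i x)%:E)%E by rewrite lee_fin.
by rewrite (prod_law_integral gammaE mu u0); apply: big1 => i _; exact: gE.
Qed.

(** An upper bound on the weight turns a lower bound for the weighted law into one for the Gaussian
    law. *)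
Lemma weight_le (A : set V) (M : R) : measurable A -> (forall z, A z -> weight z <= expR M) ->
  (\int[gamma]_(z in A) (weight z)%:E <= (expR M)%:E * gamma A)%E.
Proof.
move=> mA AM; rewrite -integral_cst//; apply: ge0_le_integral => //.
- by move=> z _; rewrite lee_fin weight_ge0.
- exact: measurable_funTS measurable_weight.
Qed.

End weighted_gauss.

Lemma gauss_chernoff {R : realType} n (gamma : probability (borel_mx R n 1) R)
    (f : 'I_n -> R) (s c : R) : gauss_law gamma -> 0 <= s -> (forall i, s * f i < 1) ->
  (gamma [set z | (c <= \sum_i f i * z i ord0 ^+ 2)%R] <=
    (expR (- ((s * c + \sum_i ln (1 - s * f i)) / 2)))%:E)%E.
Proof.
move=> gammaE s0 sf.
pose A : set (borel_mx R n 1) := [set z | c <= \sum_i f i * z i ord0 ^+ 2].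
have mA : measurable A by exact: measurable_quad_ge.
have h := @weighted_chernoff R n gamma (fun _ _ => 1) gammaE
  (fun _ => @measurable_cst _ _ _ _ setT (1 : measurableTypeR R)) (fun _ _ => ler01) f
  (fun i => - (ln (1 - s * f i) / 2)) s c s0.
have -> : gamma A = (\int[gamma]_(z in A) (weight (fun (_ : 'I_n) (_ : R) => 1) z)%:E)%E.
  under eq_integral do rewrite /weight big1//.
  by rewrite (integral_cst gamma mA 1%E) mul1e.
apply: le_trans (h _) _ => [i|].
  by under eq_integral do rewrite mulr1; exact: gauss_mgf.
by rewrite lee_fin ler_expR sumrN -mulr_suml; lra.
Qed.

(** * Large deviations of Gaussian quadratic forms *)

(** An idealised spectrum whose extreme values sit exactly at the edges. In dimension 1 the first
    and the last index coincide, hence the restriction 0 < n. *)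
Definition profile {R : realType} (lamm lamp : R) (E : (R -> R) -> R)
    (l : forall n, 'I_n.+1 -> R) :=
  [/\ forall n i, lamm <= l n i <= lamp,
      forall n, l n ord0 = lamp,
      forall n, (0 < n)%N -> l n ord_max = lamm
    & forall f, bcont f -> (n.+1%:R)^-1 * (\sum_i f (l n i)) @[n --> \oo] --> E f].

Section quadratic_form_bounds.
Context {R : realType} (lamm lamp : R) (E : (R -> R) -> R).
Hypothesis lam_le : lamm <= lamp.
Hypothesis mE : mean_on lamm lamp E.
Local Notation TR := (measurableTypeR R).
Local Notation gauss := (normal_prob (0 : R) 1).
Variable l : forall n, 'I_n.+1 -> R.
Arguments l : clear implicits.
Hypothesis pl : profile lamm lamp E l.
Variable gamma : forall n, probability (borel_mx R n.+1 1) R.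
Arguments gamma : clear implicits.
Hypothesis gammaE : forall n, gauss_law (gamma n).
Local Notation tint := (tint lamm lamp E).
Local Notation hcost := (hcost lamm lamp E).

Let lcvg f : bcont f -> (n.+1%:R)^-1 * (\sum_i f (l n i)) @[n --> \oo] --> E f.
Proof. by case: pl => _ _ _; apply. Qed.

Let N0 n : 0 < n.+1%:R :> R.
Proof. exact: ltr0Sn. Qed.

Let near_gt (u : nat -> R) (a b : R) : u n @[n --> \oo] --> a -> b < a ->
  \forall n \near \oo, b < u n.
Proof. by move=> ua ba; apply: (ua _ (open_nbhs_nbhs (conj (@open_gt R _) ba))). Qed.

(** Chernoff with the multiplier [s] given by duality; the normalised sum of logarithms converges to
    its mean under [q], and the strict inequality absorbs the error. *)
Lemma quad_form_upper f (s c a : R) : bcont f -> 0 <= s -> bpos (fun x => 1 - s * f x) ->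
  2 * a < s * c + E (fun x => ln (1 - s * f x)) ->
  \forall n \near \oo, (gamma n [set z | (n.+1%:R * c <= \sum_i f (l n i) * z i ord0 ^+ 2)%R]
    <= (expR (- (n.+1%:R * a)))%:E)%E.
Proof.
move=> bf s0 bw ha; have bl := bcont_ln bw.
have H : 2 * a - s * c < E (fun x => ln (1 - s * f x)) by lra.
apply: filterS (near_gt (lcvg bl) H) => n hn.
have sf i : s * f (l n i) < 1 by have := bpos_gt0 (l n i) bw; rewrite subr_gt0.
have ch := @gauss_chernoff R _ (gamma n) (fun i => f (l n i)) s (n.+1%:R * c) (@gammaE n) s0 sf.
apply: (le_trans ch).
rewrite lee_fin ler_expR.
move: hn; set L := \sum_i _ => hn.
have : n.+1%:R * (2 * a - s * c) < L by rewrite -ltr_pdivlMl.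
by set M := n.+1%:R => h; lra.
Qed.

Let special n (i : 'I_n.+1) := (i == ord0) || (i == ord_max).

(** The bulk values: 0 at the two extreme indices, which are treated apart. Removing two terms does
    not affect averages in the limit. *)
Let ends n (f : R -> R) (i : 'I_n.+1) := if special i then 0 else f (l n i).

Let sum_special n (x y : R) : (0 < n)%N ->
  \sum_(i < n.+1) ((if i == ord0 then x else 0) + (if i == ord_max then y else 0)) = x + y.
Proof.
by move=> n0; rewrite big_split/= -!big_mkcond/= !big_pred1_eq.
Qed.

Let ends_sum n f : (0 < n)%N ->
  \sum_(i < n.+1) ends f i = \sum_i f (l n i) - (f lamp + f lamm).
Proof.
move=> n0; rewrite -(sum_special (f lamp) (f lamm) n0) -sumrB; apply: eq_bigr => i _.
case: (pl) => _ l0 lmax _; rewrite /ends /special.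
have [->|i0] := eqVneq i ord0; last first.
  have [->|_] /= := eqVneq i ord_max; last by rewrite addr0 subr0.
  by rewrite lmax// add0r subrr.
rewrite l0 /= (_ : (ord0 == ord_max :> 'I_n.+1) = false) ?addr0 ?subrr//.
by apply/eqP => /(congr1 val)/= h; rewrite -h in n0.
Qed.

Let ends_cvg f : bcont f -> (n.+1%:R)^-1 * (\sum_(i < n.+1) ends f i) @[n --> \oo] --> E f.
Proof.
move=> bf.
have h : (n.+1%:R)^-1 * (\sum_i f (l n i)) - (f lamp + f lamm) * harmonic n @[n --> \oo] -->
    E f - (f lamp + f lamm) * 0.
  apply: cvgB; first exact: lcvg.
  by apply: cvgM; [exact: cvg_cst|exact: cvg_harmonic].
rewrite mulr0 subr0 in h; apply: cvg_trans h; apply: near_eq_cvg.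
exists 1%N => // n /= n0; rewrite ends_sum// /harmonic/= mulrBr; congr (_ - _).
exact: mulrC.
Qed.

(* The weights of the change of measure: all coordinates but the first and
   the last one get the variance prescribed by the density, and those two are
   conditioned to carry the mass of the atoms. *)
Let J (c : R) : set TR := `[c, (c + 1)%R]%classic.
Let mJ c : measurable (J c).
Proof. exact: measurable_itv. Qed.
Let pJ c := fine (gauss (J c)).
Let pJE c : (gauss (J c) = (pJ c)%:E)%E.
Proof. by rewrite fineK// fin_num_measure. Qed.
Let pJ_ge c : 0 <= c -> expR (- ((c + 1) ^+ 2 / 2 + 2)) <= pJ c.
Proof. by move=> c0; rewrite -lee_fin -pJE; exact: gauss_interval_ge. Qed.
Let pJ_gt0 c : 0 <= c -> 0 < pJ c.
Proof. by move=> /pJ_ge; apply: lt_le_trans; exact: expR_gt0. Qed.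

(** Densities with respect to N(0, 1): in the bulk, of the normal law of variance [r (l n i)]; at
    the two ends, of N(0, 1) conditioned on [J c0], resp. [J c1]. *)
Let tilt (r : R -> R) (c0 c1 : R) n (i : 'I_n.+1) (x : R) : R :=
  if i == ord0 then \1_(J c0) x / pJ c0 else
  if i == ord_max then \1_(J c1) x / pJ c1 else
  expR ((1 - (r (l n i))^-1) / 2 * x ^+ 2 - ln (r (l n i)) / 2).

Let measurable_tilt r c0 c1 n (i : 'I_n.+1) : measurable_fun setT (tilt r c0 c1 i : TR -> TR).
Proof.
have mI c : measurable_fun setT (fun x : TR => \1_(J c) x / pJ c : TR).
  by apply: measurable_funM; [exact: measurable_indic|exact: measurable_cst].
rewrite /tilt; have [_|_] := eqVneq i ord0; first exact: mI.
have [_|_] := eqVneq i ord_max; first exact: mI.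
apply: (@measurableT_comp _ _ _ _ _ _ (@expR R) _
  (fun x : TR => (1 - (r (l n i))^-1) / 2 * (x : R) ^+ 2 - ln (r (l n i)) / 2)).
  exact: measurable_expR.
apply: measurable_funB; last exact: measurable_cst.
by apply: measurable_funM; [exact: measurable_cst|exact: measurable_funX].
Qed.

Let tilt_ge0 r c0 c1 n (i : 'I_n.+1) x : 0 <= c0 -> 0 <= c1 -> 0 <= tilt r c0 c1 i x.
Proof.
move=> h0 h1; rewrite /tilt; case: ifP => _; first by rewrite divr_ge0// ltW// pJ_gt0.
by case: ifP => _; rewrite ?expR_ge0// divr_ge0// ltW// pJ_gt0.
Qed.

Let indic_int c : 0 <= c -> (\int[gauss]_x (\1_(J c) x / pJ c)%:E = 1)%E.
Proof.
move=> c0; under eq_integral do rewrite mulrC EFinM.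
rewrite ge0_integralZl//; last 2 first.
- by apply/measurable_EFinP; exact: measurable_indic.
- by rewrite lee_fin invr_ge0 ltW// pJ_gt0.
rewrite integral_indic// setIT; apply: etrans (congr1 (mule _) (pJE c)) _.
by rewrite -EFinM mulVf// gt_eqF// pJ_gt0.
Qed.

Let tilt_int r c0 c1 n (f : R -> R) s : bpos r -> 0 <= c0 -> 0 <= c1 ->
  (forall x, s * (f x * r x) < 1) -> forall i : 'I_n.+1,
  (\int[gauss]_x (expR (s * ends f i / 2 * (x : R) ^+ 2) * tilt r c0 c1 i x)%:E =
    (expR (- (ends (fun x => ln (1 - s * (f x * r x))) i / 2)))%:E)%E.
Proof.
move=> br h0 h1 sf i; rewrite /tilt /ends /special.
have simp (g : R -> R) : (fun x : TR => (expR (s * 0 / 2 * (x : R) ^+ 2) * g x)%:E) = (fun x => (g x)%:E).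
  by apply/funext => x; rewrite mulr0 !mul0r expR0 mul1r.
have [_|i0] /= := eqVneq i ord0.
  by rewrite simp mul0r oppr0 expR0 indic_int.
have [_|i1] /= := eqVneq i ord_max.
  by rewrite simp mul0r oppr0 expR0 indic_int.
set x0 := l n i; have r0 := bpos_gt0 x0 br; have sfx := sf x0.
have f1 : s * f x0 + 1 - (r x0)^-1 < 1.
  rewrite -subr_gt0 (_ : _ - _ = (1 - s * (f x0 * r x0)) / r x0); last by field; rewrite gt_eqF.
  by rewrite divr_gt0// subr_gt0.
under eq_integral => x _.
  rewrite -expRD (_ : _ + _ = - (ln (r x0) / 2) + (s * f x0 + 1 - (r x0)^-1) / 2 * x ^+ 2); last by field; rewrite gt_eqF.
  rewrite expRD EFinM; over.
rewrite ge0_integralZl//; last first.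
  apply/measurable_EFinP; apply: (@measurableT_comp _ _ _ _ _ _ (@expR R) _
    (fun x : TR => (s * f x0 + 1 - (r x0)^-1) / 2 * (x : R) ^+ 2)).
    exact: measurable_expR.
  by apply: measurable_funM; [exact: measurable_cst|exact: measurable_funX].
rewrite gauss_mgf// -EFinM -expRD; congr (expR _)%:E.
rewrite -opprD -mulrDl -lnM ?posrE ?subr_gt0//; congr (- (ln _ / 2)).
by field; rewrite gt_eqF.
Qed.

Let ln1B_ge (x : R) : `|x| <= 1 / 4 -> - x - 2 * x ^+ 2 <= ln (1 - x).
Proof.
rewrite ler_norml => /andP[h1 h2].
have y0 : 0 < 1 - x by lra.
have := ln_le_sub1 (x := (1 - x)^-1); rewrite invr_gt0 => /(_ y0).
rewrite lnV ?posrE// => h.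
suff : (1 - x)^-1 - 1 <= x + 2 * x ^+ 2 by lra.
have -> : (1 - x)^-1 - 1 = x / (1 - x) by field; lra.
rewrite ler_pdivrMr//.
have xx : 0 <= x ^+ 2 := sqr_ge0 x.
have x3 : x * x ^+ 2 <= 1 / 4 * x ^+ 2 by rewrite ler_wpM2r.
have -> : (x + 2 * x ^+ 2) * (1 - x) = x + x ^+ 2 - 2 * (x * x ^+ 2) by ring.
lra.
Qed.

Let near_expR_small (k e : R) : 0 < k -> 0 < e ->
  \forall n \near \oo, expR (- (n.+1%:R * k)) <= e.
Proof.
move=> k0 e0; have := nbhs_infty_ger (- ln e / k); apply: filterS => n hn.
rewrite -[leRHS]lnK ?posrE// ler_expR.
have : - ln e <= n.+1%:R * k.
  by rewrite -ler_pdivrMr// (le_trans hn)// ler_nat.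
by move=> h; lra.
Qed.

(** A weak law of large numbers under the tilted law, for upper deviations, by Chernoff with a small
    [s]. It is uniform in [c0] and [c1] since the extreme coordinates do not enter the sum. *)
Let tilt_dev r f (d e : R) : bpos r -> bcont f -> 0 < d -> 0 < e ->
  \forall n \near \oo, forall c0 c1 : R, 0 <= c0 -> 0 <= c1 ->
  (\int[gamma n]_(z in [set z | (n.+1%:R * (E (fun x => f x * r x) + d) <=
       \sum_i ends f i * z i ord0 ^+ 2)%R]) (weight (@tilt r c0 c1 n) z)%:E <= e%:E)%E.
Proof.
move=> br bf d0 e0; have bfr : bcont (fun x => f x * r x) := bcontM bf br.1.
have [C' C'P] := bfr.2; pose C := `|C'| + 1.
have C0 : 0 < C by have := normr_ge0 C'; rewrite /C; lra.
have CP x : `|f x * r x| <= C.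
  by apply: le_trans (C'P x) _; have := ler_norm C'; rewrite /C; lra.
have C1 : 1 <= C by have := normr_ge0 C'; rewrite /C; lra.
pose d' := Num.min d 1.
have d'0 : 0 < d' by rewrite lt_min d0 ltr01.
have d'd : d' <= d by rewrite ge_min lexx.
have d'1 : d' <= 1 by rewrite ge_min lexx orbT.
(* The second-order error 2 (s C)^2 of the logarithm then equals s d' / 2, half of the linear gain s
   d'; moreover s C <= 1/4. *)
pose s := d' / (4 * C ^+ 2).
have CC : 0 < C ^+ 2 by rewrite exprn_gt0.
have s0 : 0 < s by rewrite divr_gt0// mulr_gt0.
have sC2 : 2 * s * C ^+ 2 = d' / 2 by rewrite /s; field; rewrite gt_eqF.
have sC : s * C <= 1 / 4.
  have -> : s * C = d' / (4 * C) by rewrite /s; field; rewrite gt_eqF.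
  by rewrite ler_pdivrMr ?mulr_gt0//; lra.
have sfr x : `|s * (f x * r x)| <= 1 / 4.
  by rewrite normrM gtr0_norm// (le_trans _ sC)// ler_wpM2l// ltW.
have sf1 x : s * (f x * r x) < 1 by have := ler_norm (s * (f x * r x)); have := sfr x; lra.
have bw : bpos (fun x => 1 - s * (f x * r x)).
  split; first by apply: bcontB; [exact: bcont_cst|exact: bcontZ].
  exists (1 / 2); first by lra.
  by move=> x; have := ler_norm (s * (f x * r x)); have := sfr x; lra.
pose h x := ln (1 - s * (f x * r x)); have bh : bcont h := bcont_ln bw.
have Eh : - s * E (fun x => f x * r x) - 2 * (s * C) ^+ 2 <= E h.
  rewrite -(mean_cst mE (2 * (s * C) ^+ 2)).
  have bs : bcont (fun x => - s * (f x * r x)) := bcontZ (- s) bfr.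
  have bc := bcont_cst (2 * (s * C) ^+ 2).
  case: (mE) => _ EZ _ Ele.
  rewrite -EZ// -(meanB mE)//; apply: Ele => //; first exact: bcontB.
  move=> x _; apply: le_trans (ln1B_ge (sfr x)).
  rewrite mulNr lerD2l lerN2 ler_pM2l// -[X in X <= _]real_normK ?num_real//.
  have sC0 : 0 <= s * C by rewrite mulr_ge0// ltW.
  have sfC : `|s * (f x * r x)| <= s * C by rewrite normrM gtr0_norm// ler_wpM2l// ltW.
  by rewrite lerXn2r// nnegrE.
pose k := s * (E (fun x => f x * r x) + d) + E h.
have k0 : 0 < k.
  apply: (@lt_le_trans _ _ (s * (d' / 2))); first by rewrite mulr_gt0//; lra.
  have := ler_wpM2l (ltW s0) d'd; rewrite /k; move: Eh; rewrite exprMn.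
  have -> : 2 * (s ^+ 2 * C ^+ 2) = s * (2 * s * C ^+ 2) by ring.
  by rewrite sC2 => h1 h2; lra.
have nE : \forall n \near \oo, E h - k / 2 < (n.+1%:R)^-1 * \sum_(i < n.+1) ends h i.
  by apply: (near_gt (ends_cvg bh)); lra.
have k4 : 0 < k / 4 by lra.
near=> n => c0 c1 h0 h1.
apply: le_trans (@weighted_chernoff R n.+1 (gamma n) (@tilt r c0 c1 n) (@gammaE n)
  (@measurable_tilt r c0 c1 n) (fun i x => @tilt_ge0 r c0 c1 n i x h0 h1)
  (@ends n f) _ s _ (ltW s0) (@tilt_int r c0 c1 n f s br h0 h1 sf1)) _.
rewrite lee_fin; apply: (@le_trans _ _ (expR (- (n.+1%:R * (k / 4))))); last first.
  by near: n; exact: near_expR_small.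
have hn : E h - k / 2 < (n.+1%:R)^-1 * \sum_(i < n.+1) ends h i by near: n.
move: hn; rewrite ltr_pdivlMl// => hn.
rewrite ler_expR sumrN -mulr_suml -/h.
move: hn; rewrite /k; move: (\sum_i _) (n.+1%:R : R) (E h) (E _) => L N eh ef hn.
nra.
Unshelve. all: by end_near. Qed.

(** Conditioning a coordinate on an interval of length 1 above sqrt (N b) changes its square by
    O(sqrt N), negligible at scale N. *)
Let near_sqrt (b d : R) : 0 <= b -> 0 < d ->
  \forall n \near \oo, (Num.sqrt (n.+1%:R * b) + 1) ^+ 2 <= n.+1%:R * (b + d).
Proof.
move=> b0 d0; have := nbhs_infty_ger ((2 * b / d + 1) / (d / 2)); apply: filterS => n hn.
have N0' := N0 n.
have hN : 2 * b / d + 1 <= n.+1%:R * (d / 2).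
  by rewrite -ler_pdivrMr ?divr_gt0// (le_trans hn)// ler_nat.
have x0 := sqrtr_ge0 (n.+1%:R * b).
have xx : Num.sqrt (n.+1%:R * b) ^+ 2 = n.+1%:R * b by rewrite sqr_sqrtr// mulr_ge0// ltW.
move: x0 xx; set x := Num.sqrt _; move: hN; set N := n.+1%:R in N0' * => hN x0 xx.
have bd0 : 0 <= 2 * b / d by rewrite divr_ge0 ?mulr_ge0// ltW.
have x2 : 2 * x <= N * (d / 2) + 2 * b / d.
  have Nd : 0 <= N * (d / 2) by rewrite mulr_ge0// ?divr_ge0// ltW.
  rewrite -(@ler_pXn2r _ 2) ?nnegrE ?mulr_ge0 ?addr_ge0//.
  have e : (2 * x) ^+ 2 = 4 * (N * (d / 2) * (2 * b / d)).
    by rewrite exprMn xx; field; rewrite gt_eqF.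
  rewrite e; have := sqr_ge0 (N * (d / 2) - 2 * b / d).
  by move: (N * (d / 2)) (2 * b / d) => u v; rewrite !expr2 => huv; lra.
by rewrite sqrrD xx expr1n; lra.
Qed.

Lemma measure_bigsetU_le d (T : measurableType d) (rho : {measure set T -> \bar R})
    (K : Type) (s : seq K) (F : K -> set T) :
  (forall k, measurable (F k)) ->
  (rho (\big[setU/set0]_(k <- s) F k) <= \sum_(k <- s) rho (F k))%E.
Proof.
move=> mF; elim: s => [|k s IH]; first by rewrite !big_nil measure0.
rewrite !big_cons; apply: le_trans (measureU2 _ _ _) _ => //; last exact: leeD.
exact: bigsetU_measurable.
Qed.

Let tilt_le r c0 c1 n (i : 'I_n.+1) x : (0 < n)%N -> 0 <= c0 -> 0 <= c1 ->
  tilt r c0 c1 i x <= expR ((if i == ord0 then (c0 + 1) ^+ 2 / 2 + 2 else 0) +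
    (if i == ord_max then (c1 + 1) ^+ 2 / 2 + 2 else 0) +
    (ends (fun x => 1 - (r x)^-1) i * x ^+ 2 / 2 - ends (fun x => ln (r x)) i / 2)).
Proof.
move=> n0 h0 h1; rewrite /tilt /ends /special.
have ind c : 0 <= c -> \1_(J c) x / pJ c <= expR ((c + 1) ^+ 2 / 2 + 2).
  move=> c0'; have pc := pJ_ge c0'; rewrite expRN in pc.
  apply: (@le_trans _ _ (pJ c)^-1).
    have i1 : \1_(J c) x <= 1 :> R by rewrite indicE; case: (_ \in _).
    by rewrite -[leRHS]mul1r ler_wpM2r// invr_ge0 ltW// pJ_gt0.
  by rewrite -[leRHS]invrK lef_pV2 ?posrE ?invr_gt0 ?expR_gt0 ?pJ_gt0.
have [i0|i0] /= := eqVneq i ord0.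
  have -> : (i == ord_max) = false.
    by apply/eqP => /(congr1 val)/=; rewrite i0 /= => h; rewrite -h in n0.
  by rewrite !mul0r subrr !addr0; exact: ind.
have [i1|i1] /= := eqVneq i ord_max.
  by rewrite !mul0r subrr addr0 add0r; exact: ind.
by rewrite ler_expR; lra.
Qed.

Let quad_split n f (z : 'cV[R]_n.+1) : (0 < n)%N ->
  \sum_i f (l n i) * z i ord0 ^+ 2 = \sum_i ends f i * z i ord0 ^+ 2 +
    (f lamp * z ord0 ord0 ^+ 2 + f lamm * z ord_max ord0 ^+ 2).
Proof.
move=> n0; rewrite -(sum_special (f lamp * z ord0 ord0 ^+ 2) (f lamm * z ord_max ord0 ^+ 2) n0).
rewrite -big_split/=; apply: eq_bigr => i _.
case: (pl) => _ l0 lmax _; rewrite /ends /special.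
have [i0|i0] /= := eqVneq i ord0.
  have -> : (i == ord_max) = false.
    by apply/eqP => /(congr1 val)/=; rewrite i0 /= => h; rewrite -h in n0.
  by rewrite i0 l0 mul0r add0r addr0.
have [i1|i1] /= := eqVneq i ord_max; last by rewrite !addr0.
by rewrite i1 lmax// mul0r !add0r.
Qed.

Let edge_le (p C x c0 N b e : R) : `|p| <= C -> 0 < C -> 0 <= c0 -> c0 ^+ 2 = N * b ->
  (c0 + 1) ^+ 2 <= N * (b + e / C) -> c0 <= x <= c0 + 1 -> p * x ^+ 2 <= N * (p * b + e).
Proof.
move=> pC C0 c00 cE cN /andP[x1 x2].
have xl : N * b <= x ^+ 2 by rewrite -cE lerXn2r// nnegrE// (le_trans c00).
have xu : x ^+ 2 <= N * (b + e / C).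
  by apply: le_trans cN; rewrite lerXn2r// nnegrE ?(le_trans c00)//; lra.
have h : p * (x ^+ 2 - N * b) <= C * (N * (e / C)).
  apply: (@le_trans _ _ (C * (x ^+ 2 - N * b))).
    by rewrite ler_wpM2r ?subr_ge0// (le_trans (ler_norm p)).
  by rewrite ler_pM2l//; lra.
have Ce : C * (N * (e / C)) = N * e by field; rewrite gt_eqF.
by rewrite Ce in h; lra.
Qed.

Let tilt_mass r c0 c1 n (i : 'I_n.+1) : bpos r -> 0 <= c0 -> 0 <= c1 ->
  (\int[gauss]_x (tilt r c0 c1 i x)%:E = 1)%E.
Proof.
move=> br h0 h1; have sf (x : R) : 0 * (0 * r x) < 1 by rewrite mul0r ltr01.
have H := @tilt_int r c0 c1 n (fun=> 0) 0 br h0 h1 sf i.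
have e0 : ends (fun x => ln (1 - 0 * (0 * r x))) i = 0.
  by rewrite /ends; case: ifP => // _; rewrite !mul0r subr0 ln1.
apply: (etrans _ (etrans H _)); last by rewrite e0 mul0r oppr0 expR0.
by apply: eq_integral => x _; rewrite !mul0r expR0 mul1r.
Qed.

(** Budget of the exponent: the four errors [d <= e / 8] use one half of [e], and the constants 2 +
    2 + 1 fit into the other half because N e >= 20. *)
Let exponent_le (N p0 p1 L er el b c d e : R) :
  p0 <= N * (b + d) -> p1 <= N * (c + d) -> N * (el - d) <= L -> N * d <= N * (e / 8) ->
  20 <= N * e ->
  p0 / 2 + 2 + (p1 / 2 + 2) + (N * (er - 1 + d) / 2 - L / 2) + 1 <=
    N * ((er + c + b - 1 - el + e) / 2).
Proof. by move=> h0 h1 hL hd he; lra. Qed.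

Let total_lt (N S e b c p q z0 z1 d d' : R) : S < N * (e + d') ->
  p * z0 <= N * (p * b + d / 4) -> q * z1 <= N * (q * c + d / 4) ->
  N * d' <= N * (d / 2) -> S + (p * z0 + q * z1) < N * (e + c * q + b * p + d).
Proof. by move=> h0 h1 h2 h3; lra. Qed.

(** Under the tilted law, a probability, the complement of the bad set [D] has mass at least 1/2,
    and on it the weight is at most exp [Mn]; so its Gaussian mass is at least exp (- Mn) / 2, where
    [Mn] is about N times half of the cost. All forms are handled jointly, by a union bound over
    finitely many upper deviations. *)
Lemma quad_form_lower (K : finType) (f : K -> R -> R) t (d a : R) :
  valid t -> (forall k, bcont (f k)) -> 0 < d -> hcost t < 2 * a ->
  \forall n \near \oo, ((expR (- (n.+1%:R * a)))%:E <=
    gamma n [set z | forall k, (\sum_i f k (l n i) * z i ord0 ^+ 2 < n.+1%:R * (tint t (f k) + d))%R])%E.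
Proof.
move=> vt bf d0 ha; have [br a0 b0] := vt.
pose r := dens t; pose b := atp t; pose c := atm t.
(* The quadratic form in the exponent of the weight. Adding it to the family (index [None]) lets the
   same deviation estimate bound the weight from above. *)
pose chi x := 1 - (r x)^-1.
have bchi : bcont chi by apply: bcontB; [exact: bcont_cst|exact: bcont_inv].
have blr : bcont (fun x => ln (r x)) := bcont_ln br.
pose ff (o : option K) := if o is Some k then f k else chi.
have bff o : bcont (ff o) by case: o.
pose eta := 2 * a - hcost t; have eta0 : 0 < eta by rewrite /eta; lra.
pose d' := Num.min (d / 2) (eta / 8).
have d'0 : 0 < d' by rewrite lt_min; apply/andP; split; lra.
have d'd : d' <= d / 2 by rewrite ge_min lexx.
have d'e : d' <= eta / 8 by rewrite ge_min lexx orbT.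
pose M : R := #|{: option K}|%:R.
have M0 : 0 < M by rewrite ltr0n card_option.
have /choice[C CP] : forall k, exists C, 0 < C /\ forall x, `|f k x| <= C.
  move=> k; have [C CP] := (bf k).2; exists (`|C| + 1); split.
    by have := normr_ge0 C; lra.
  by move=> x; have := CP x; have := ler_norm C; lra.
have F1 : \forall n \near \oo, forall (o : option K) (c0 c1 : R), 0 <= c0 -> 0 <= c1 ->
    (\int[gamma n]_(z in [set z | (n.+1%:R * (E (fun x => ff o x * r x) + d') <=
       \sum_i ends (ff o) i * z i ord0 ^+ 2)%R]) (weight (@tilt r c0 c1 n) z)%:E <= ((2 * M)^-1)%:E)%E.
  apply: filter_forall => o; apply: tilt_dev => //; by rewrite invr_gt0 mulr_gt0.
have F2 : \forall n \near \oo, forall k : K,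
    (Num.sqrt (n.+1%:R * b) + 1) ^+ 2 <= n.+1%:R * (b + (d / 4) / C k).
  by apply: filter_forall => k; apply: near_sqrt => //; have [Ck _] := CP k; rewrite !divr_gt0.
have F3 : \forall n \near \oo, forall k : K,
    (Num.sqrt (n.+1%:R * c) + 1) ^+ 2 <= n.+1%:R * (c + (d / 4) / C k).
  by apply: filter_forall => k; apply: near_sqrt => //; have [Ck _] := CP k; rewrite !divr_gt0.
have F4 := near_sqrt b0 d'0.
have F5 := near_sqrt a0 d'0.
have F6 : \forall n \near \oo, E (fun x => ln (r x)) - d' <
    (n.+1%:R)^-1 * \sum_(i < n.+1) ends (fun x => ln (r x)) i.
  by apply: (near_gt (ends_cvg blr)); lra.
near=> n.
have n0 : (0 < n)%N by near: n; exact: nbhs_infty_gt.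
have nN : 20 / eta <= n%:R by near: n; exact: nbhs_infty_ger.
set N : R := n.+1%:R.
have N0' : 0 < N := N0 n.
have Neta : 20 <= N * eta by rewrite -ler_pdivrMr// (le_trans nN)// ler_nat.
(* The squares of the first and of the last coordinate have to be about N b and N c, the masses of
   the atoms. *)
pose c0 := Num.sqrt (N * b); pose c1 := Num.sqrt (N * c).
have c00 : 0 <= c0 := sqrtr_ge0 _.
have c10 : 0 <= c1 := sqrtr_ge0 _.
have c0E : c0 ^+ 2 = N * b by rewrite sqr_sqrtr// mulr_ge0// ltW.
have c1E : c1 ^+ 2 = N * c by rewrite sqr_sqrtr// mulr_ge0// ltW.
pose V := borel_mx R n.+1 1.
pose g := @tilt r c0 c1 n.
have mg : forall i, measurable_fun setT (g i : TR -> TR) := @measurable_tilt r c0 c1 n.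
have g0 : forall i x, 0 <= g i x := fun i x => @tilt_ge0 r c0 c1 n i x c00 c10.
have gT : (\int[gamma n]_z (weight g z)%:E = 1)%E.
  by apply: (weight_total (@gammaE n) mg g0) => i; exact: tilt_mass.
have gToo : (\int[gamma n]_z (weight g z)%:E < +oo)%E by rewrite gT ltry.
have w0' z : (0 <= (weight g z)%:E)%E by rewrite lee_fin weight_ge0.
have [rho rhoE] := @finite_density _ V R (gamma n) (fun z => (weight g z)%:E)
  (measurable_weight mg) w0' gToo.
pose B (o : option K) : set V := [set z | N * (E (fun x => ff o x * r x) + d') <=
  \sum_i ends (ff o) i * z i ord0 ^+ 2].
have mB o : measurable (B o) by exact: measurable_quad_ge.
pose Z (i : 'I_n.+1) (k : R) : set V := [set z | ~ J k (z i ord0)].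
have mZ i k : measurable (Z i k).
  exact: (measurable_preim (@measurable_coord R n.+1 1 i ord0) (measurableC (mJ k))).
have Z0 i k : (forall x, ~ J k x -> g i x = 0) -> rho (Z i k) = 0%E.
  move=> gi; apply: etrans (rhoE _) _; apply: integral0_eq => z Zz.
  by rewrite /weight (bigD1 i)//= gi ?mul0r.
have rZ0 : rho (Z ord0 c0) = 0%E.
  by apply: Z0 => x nx; rewrite /g /tilt eqxx indicE memNset// mul0r.
have rZ1 : rho (Z ord_max c1) = 0%E.
  apply: Z0 => x nx; rewrite /g /tilt eqxx ifF; first by rewrite indicE memNset// mul0r.
  by apply/eqP => /(congr1 val)/= h; rewrite h in n0.
pose D : set V := Z ord0 c0 `|` (Z ord_max c1 `|` \big[setU/set0]_(o : option K) B o).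
have mU : measurable (\big[setU/set0]_(o : option K) B o) by exact: bigsetU_measurable.
have mD : measurable D by apply: measurableU => //; exact: measurableU.
have rU : (rho (\big[setU/set0]_(o : option K) B o) <= (2^-1)%:E)%E.
  apply: le_trans (measure_bigsetU_le _ _ mB) _.
  apply: (@le_trans _ _ (\sum_(o : option K) ((2 * M)^-1)%:E)%E).
    apply: lee_sum => o _.
    have F1n : forall (o : option K) (c0 c1 : R), 0 <= c0 -> 0 <= c1 ->
      (\int[gamma n]_(z in [set z | (n.+1%:R * (E (fun x => ff o x * r x) + d') <=
       \sum_i ends (ff o) i * z i ord0 ^+ 2)%R]) (weight (@tilt r c0 c1 n) z)%:E <= ((2 * M)^-1)%:E)%E.
      by near: n.
    by apply: le_trans (F1n o c0 c1 c00 c10); rewrite le_eqVlt; apply/orP; left; apply/eqP/rhoE.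
  rewrite sumEFin lee_fin sumr_const -[leLHS]mulr_natl -/M invfM.
  by rewrite mulrCA mulfV ?mulr1// gt_eqF.
have rZ0' : (rho (Z ord0 c0) <= 0)%E by rewrite rZ0.
have rZ1' : (rho (Z ord_max c1) <= 0)%E by rewrite rZ1.
have rD : (rho D <= (2^-1)%:E)%E.
  have := le_trans (measureU2 rho (mZ ord0 c0) (measurableU _ _ (mZ ord_max c1) mU))
    (leeD rZ0' (le_trans (measureU2 rho (mZ ord_max c1) mU) (leeD rZ1' rU))).
  by rewrite !add0e.
have rA : ((2^-1)%:E <= rho (~` D))%E.
  have h : (1 <= rho (~` D) + rho D)%E.
    rewrite -gT -rhoE -[in leLHS](setvU D); apply: measureU2 => //; exact: measurableC.
  have := le_trans h (leeD2l _ rD).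
  case: (rho (~` D)) => [x| |]; rewrite ?leey//.
  by rewrite -EFinD !lee_fin -lerBlDr (_ : 1 - 2^-1 = 2^-1)//; field.
pose L := \sum_(i < n.+1) ends (fun x => ln (r x)) i.
pose Mn := ((c0 + 1) ^+ 2 / 2 + 2) + ((c1 + 1) ^+ 2 / 2 + 2) +
  (N * (E (fun x => chi x * r x) + d') / 2 - L / 2).
have wA z : (~` D) z -> weight g z <= expR Mn.
  move=> nD; rewrite /weight.
  apply: (@le_trans _ _ (\prod_(i < n.+1) expR ((if i == ord0 then (c0 + 1) ^+ 2 / 2 + 2 else 0) +
    (if i == ord_max then (c1 + 1) ^+ 2 / 2 + 2 else 0) +
    (ends (fun x => 1 - (r x)^-1) i * z i ord0 ^+ 2 / 2 - ends (fun x => ln (r x)) i / 2)))).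
    by apply: ler_prod => i _; rewrite g0 /= /g; exact: tilt_le.
  rewrite -expR_sum ler_expR big_split/= sum_special// /Mn lerD2l sumrB -!mulr_suml -/L lerD2r.
  rewrite ler_pM2r ?invr_gt0//; apply: ltW; rewrite ltNge; apply/negP => Bz.
  apply: nD; right; right; rewrite -bigcup_seq.
  by exists None => //=; rewrite mem_index_enum.
have gA := @weight_le R n.+1 (gamma n) g mg g0 (~` D) Mn (measurableC mD) wA.
rewrite -rhoE in gA.
have Er : E (fun x => chi x * r x) = E r - 1.
  have bc1 : bcont (fun=> 1 : R) := bcont_cst 1.
  rewrite -(mean_cst mE 1) -(meanB mE)//; last by case: br.
  congr E; apply/funext => x; rewrite /chi mulrBl mul1r mulVf// gt_eqF//.
  exact: bpos_gt0.
have hcE : hcost t = E r + c + b - 1 - E (fun x => ln (r x)).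
  rewrite /hcost /tint !mulr1; congr (_ + _ + _ - _ - _).
  by congr E; apply/funext => x; rewrite mul1r.
(* The additional 1 pays for the factor 1/2, as exp 1 >= 2. *)
have Mna : Mn + 1 <= N * a.
  have P0 : (c0 + 1) ^+ 2 <= N * (b + d') by rewrite /c0 /N; near: n; exact: F4.
  have P1 : (c1 + 1) ^+ 2 <= N * (c + d') by rewrite /c1 /N; near: n; exact: F5.
  have PL : N * (E (fun x => ln (r x)) - d') <= L.
    by rewrite -ler_pdivlMl//; apply: ltW; rewrite /L /N; near: n; exact: F6.
  have Nd' : N * d' <= N * (eta / 8) by rewrite ler_pM2l.
  have aE : a = (hcost t + eta) / 2 by rewrite /eta; field.
  rewrite /Mn Er aE hcE.
  exact: exponent_le P0 P1 PL Nd' Neta.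
have gA' : ((expR (- (N * a)))%:E <= gamma n (~` D))%E.
  move: (le_trans rA gA); case: (gamma n (~` D)) => [x| |]; rewrite ?leey//; last first.
    by rewrite gt0_muleNy// lte_fin expR_gt0.
  rewrite -EFinM !lee_fin => h.
  apply: (@le_trans _ _ (expR (- Mn) / 2)); last first.
    by rewrite expRN ler_pdivrMl ?expR_gt0// mulrC; lra.
  have -> : - Mn = (N * a - Mn) + - (N * a) by ring.
  have e2 : 2 <= expR (N * a - Mn) by apply: le_trans (expR_ge1Dx _); rewrite -[leLHS]/(1 + 1) lerD2l lerBrDl.
  by rewrite expRD ler_pdivlMr// [leLHS]mulrC ler_wpM2r// expR_ge0.
apply: (le_trans gA'); apply: le_measure; rewrite ?inE.
- exact: measurableC.
- have -> : (fun z : V => [set z | forall k, \sum_i f k (l n i) * z i ord0 ^+ 2 < N * (tint t (f k) + d)] z) =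
      \bigcap_(k in [set: K]) ~` [set z : V | N * (tint t (f k) + d) <= \sum_i f k (l n i) * z i ord0 ^+ 2].
    apply/seteqP; split => z /= h k; first by move=> _ /=; apply/negP; rewrite -ltNge.
    by have := h k I => /= /negP; rewrite -ltNge.
  apply: fin_bigcap_measurable => // k _.
  by apply: measurableC; exact: measurable_quad_ge.
move=> z nD k; rewrite quad_split//.
have z0J : J c0 (z ord0 ord0) by apply: contrapT => h; apply: nD; left.
have z1J : J c1 (z ord_max ord0) by apply: contrapT => h; apply: nD; right; left.
have zB : \sum_i ends (f k) i * z i ord0 ^+ 2 < N * (E (fun x => f k x * r x) + d').
  rewrite ltNge; apply/negP => h; apply: nD; right; right; rewrite -bigcup_seq.
  by exists (Some k) => //=; rewrite mem_index_enum.
have [Ck CkP] := CP k.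
have e0 : f k lamp * z ord0 ord0 ^+ 2 <= N * (f k lamp * b + d / 4).
  apply: (@edge_le _ (C k) _ c0) => //.
  by move: (k); rewrite /c0 /N; near: n; exact: F2.
have e1 : f k lamm * z ord_max ord0 ^+ 2 <= N * (f k lamm * c + d / 4).
  apply: (@edge_le _ (C k) _ c1) => //.
  by move: (k); rewrite /c1 /N; near: n; exact: F3.
have Nd : N * d' <= N * (d / 2) by rewrite ler_pM2l.
exact: total_lt zB e0 e1 Nd.
Unshelve. all: by end_near. Qed.

End quadratic_form_bounds.

(** * Spectral data *)

Section empirical.
Context {R : realType}.
Local Notation TR := (measurableTypeR R).

Let ge0_integral_empirical n (lam : n.+1.-tuple R) (g : TR -> R) :
  measurable_fun setT (g : TR -> TR) -> (forall x, 0 <= g x) ->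
  (\int[empirical_measure lam]_x (g x)%:E =
    ((n.+1%:R)^-1 * \sum_(i < n.+1) g (nth 0 lam i))%:E)%E.
Proof.
move=> mg g0.
have mg' : measurable_fun setT (fun x : TR => (g x)%:E) by exact/measurable_EFinP.
have g0' (x : TR) : setT x -> (0 <= (g x)%:E)%E by rewrite lee_fin.
rewrite /empirical_measure; apply: etrans (ge0_integral_mscale _ measurableT _ mg' g0') _.
rewrite EFinM; congr (_ * _)%E.
have H := ge0_integral_measure_sum (fun j => \d_((nth 0 lam j) : TR)) measurableT g0' mg' n.+1.
apply: (etrans H).
rewrite -sumEFin; apply: eq_bigr => i _.
by rewrite integral_dirac// diracT mul1e.
Qed.

Lemma integral_empirical n (lam : n.+1.-tuple R) (g : R -> R) : bcont g ->
  (\int[empirical_measure lam]_x (g x)%:E =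
    ((n.+1%:R)^-1 * \sum_(i < n.+1) g (nth 0 lam i))%:E)%E.
Proof.
move=> bg; have mg := bcont_measurable bg.
have mp : measurable_fun setT (fun x : TR => Num.max (g x) 0 : TR).
  by apply: measurable_maxr => //; exact: measurable_cst.
have mn : measurable_fun setT (fun x : TR => Num.max (- g x) 0 : TR).
  by apply: measurable_maxr; [exact: measurableT_comp|exact: measurable_cst].
rewrite integralE.
have -> : (\int[empirical_measure lam]_x ((fun x => (g x)%:E)^\+ x) =
    \int[empirical_measure lam]_x (Num.max (g x) 0)%:E)%E.
  by apply: eq_integral => x _; rewrite funeposE EFin_max.
have -> : (\int[empirical_measure lam]_x ((fun x => (g x)%:E)^\- x) =
    \int[empirical_measure lam]_x (Num.max (- g x) 0)%:E)%E.
  by apply: eq_integral => x _; rewrite funenegE EFin_max.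
rewrite !ge0_integral_empirical//; try by move=> x; rewrite le_max lexx orbT.
rewrite -EFinB -mulrBr -sumrB; congr (_ * _)%:E; apply: eq_bigr => i _.
case: (leP (g (nth 0 lam i)) 0) => h.
  rewrite max_l; first by rewrite sub0r opprK.
  by rewrite oppr_ge0.
by rewrite max_r ?subr0// oppr_le0 ltW.
Qed.

End empirical.

(** The eigenvalues are truncated to the segment and the extreme ones are replaced by the edges.
    Convergence of the extreme eigenvalues makes this change uniformly small, while weak convergence
    identifies the limit of the averages. *)
Lemma spectral_profile {R : realType} (lamm lamp : R) (q : probability (measurableTypeR R) R)
    (W : forall n, 'M[R]_n.+1) :
  concentrated_on q `[lamm, lamp] -> spectral_class lamm lamp q W ->
  exists (U : forall n, 'M[R]_n.+1) (lam l : forall n, 'I_n.+1 -> R),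
    [/\ forall n, orthogonal (U n), forall n, (U n)^T *m W n *m U n = diag (lam n),
        profile lamm lamp (mean q) l
      & forall d, 0 < d -> \forall n \near \oo, forall i, `|lam n i - l n i| <= d].
Proof.
move=> cq [Wsym [s [ord_s wk top bot]]].
have lam_le := concentrated_le cq.
have Uex : forall n, exists U : 'M[R]_n.+1, orthogonal U /\
    U^T *m W n *m U = diag (fun i : 'I_n.+1 => nth 0 (s n) i).
  move=> n; have [srt ch] := ord_s n.
  have [U [oU dU]] := symmetric_diagonalization (Wsym n) ch.
  by exists U.
pose U n := projT1 (cid (Uex n)).
have UP n : orthogonal (U n) /\ (U n)^T *m W n *m U n = diag (fun i : 'I_n.+1 => nth 0 (s n) i).
  exact: projT2 (cid (Uex n)).
have top_i n i : nth 0 (s n) (i : 'I_n.+1) <= tnth (s n) ord0.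
  have [srt _] := ord_s n; rewrite (tnth_nth 0)/=.
  apply: (sorted_leq_nth (leT := fun a b : R => b <= a)) => //.
  - by move=> y x z yx zy; exact: le_trans zy yx.
  - by rewrite inE size_tuple.
  - by rewrite inE size_tuple.
have bot_i n i : tnth (s n) ord_max <= nth 0 (s n) (i : 'I_n.+1).
  have [srt _] := ord_s n; rewrite (tnth_nth 0)/=.
  apply: (sorted_leq_nth (leT := fun a b : R => b <= a)) => //.
  - by move=> y x z yx zy; exact: le_trans zy yx.
  - by rewrite inE size_tuple.
  - by rewrite inE size_tuple.
  - by rewrite -ltnS.
pose lam n (i : 'I_n.+1) := nth 0 (s n) i.
pose l n (i : 'I_n.+1) : R := if i == ord0 then lamp else if i == ord_max then lamm else
  clampK lamm lamp (lam n i).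
have lK n i : lamm <= l n i <= lamp.
  rewrite /l; case: ifP => _; first by rewrite lam_le lexx.
  by case: ifP => _; [rewrite lexx lam_le|exact: clampK_itv].
exists U, lam, l; split.
- by move=> n; case: (UP n).
- by move=> n; case: (UP n).
- split => //.
  + by move=> n n0; rewrite /l eqxx ifF//; apply/eqP => /(congr1 val)/= h; rewrite h in n0.
  move=> f bf; have [C CP] := bf.2.
  have bfc : bcont (fun x => f (clampK lamm lamp x)) by exact: bcont_clampK bf.1.
  have Ef : mean q (fun x => f (clampK lamm lamp x)) = mean q f.
    by apply/eqP; rewrite eq_le; apply/andP; split; apply: (mean_nu_le cq) => // x Kx;
      rewrite clampK_id.
  have h : (n.+1%:R)^-1 * (\sum_i f (clampK lamm lamp (lam n i))) @[n --> \oo] --> mean q f.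
    rewrite -Ef; have := wk _ bfc.1 bfc.2; rewrite meanE//.
    under eq_fun do rewrite integral_empirical//.
    by move/fine_cvg.
  rewrite -[X in _ --> X]addr0.
  (* Only the first and the last term differ from the truncated spectrum, so this error is at most 4
     C / N. *)
  pose e n : R := (n.+1%:R)^-1 * (\sum_i (f (l n i) - f (clampK lamm lamp (lam n i)))).
  have -> : (fun n => (n.+1%:R)^-1 * (\sum_i f (l n i))) =
      (fun n => (n.+1%:R)^-1 * (\sum_i f (clampK lamm lamp (lam n i))) + e n).
    apply/funext => n; rewrite /e -mulrDr -big_split/=; congr (_ * _).
    by apply: eq_bigr => i _; rewrite addrC subrK.
  apply: cvgD => //.
  apply: (@squeeze_cvgr _ _ _ _ (fun n => - (4 * C * harmonic n)) (fun n => 4 * C * harmonic n)).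
  + apply: nearW => n; rewrite -ler_norml /e normrM ger0_norm ?invr_ge0//.
    rewrite mulrC /harmonic/= ler_pM2r ?invr_gt0//.
    apply: le_trans (ler_norm_sum _ _ _) _.
    apply: (@le_trans _ _ (\sum_(i < n.+1) ((if i == ord0 then 2 * C else 0) +
        (if i == ord_max then 2 * C else 0)))); last first.
      by rewrite big_split/= -!big_mkcond/= !big_pred1_eq; lra.
    have C0 : 0 <= C by apply: le_trans (CP 0).
    apply: ler_sum => i _; rewrite /l; case: ifP => _.
      apply: (@le_trans _ _ (2 * C)); last by rewrite lerDl; case: ifP => // _; rewrite mulr_ge0.
      by apply: le_trans (ler_normB _ _) _; have := CP lamp; have := CP (clampK lamm lamp (lam n i)); lra.
    case: ifP => _; last by rewrite subrr normr0 addr0.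
    by rewrite add0r; apply: le_trans (ler_normB _ _) _; have := CP lamm; have := CP (clampK lamm lamp (lam n i)); lra.
  + rewrite -oppr0; apply: cvgN; rewrite -(mulr0 (4 * C)).
    by apply: cvgM; [exact: cvg_cst|exact: cvg_harmonic].
  + rewrite -(mulr0 (4 * C)).
    by apply: cvgM; [exact: cvg_cst|exact: cvg_harmonic].
- move=> d d0.
  have T : \forall n \near \oo, `|lamp - tnth (s n) ord0| < d by move/cvgrPdist_lt : top; exact.
  have Bt : \forall n \near \oo, `|lamm - tnth (s n) ord_max| < d by move/cvgrPdist_lt : bot; exact.
  near=> n => i.
  have hT : `|lamp - tnth (s n) ord0| < d by near: n.
  have hB : `|lamm - tnth (s n) ord_max| < d by near: n.
  have := top_i n i; have := bot_i n i; rewrite -/(lam n i) => h1 h2.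
  move: hT hB; rewrite !ltr_norml => /andP[hT1 hT2] /andP[hB1 hB2].
  rewrite ler_norml /l; case: eqP => [i0|_].
    move: hT1 hT2; rewrite (tnth_nth 0)/= /lam i0/=; lra.
  case: eqP => [i1|_].
    move: hB1 hB2; rewrite (tnth_nth 0)/= /lam i1/=; lra.
  rewrite /clampK; case: (leP lamp (lam n i)) => h3; first by rewrite max_r//; lra.
by case: (leP lamm (lam n i)) => h4; lra.
Unshelve. all: by end_near. Qed.

(** * Random fields as images of Gaussian vectors *)

Section random_fields.
Context {R : realType} (n : nat) (Gamma : R).
Hypothesis Gamma_gt0 : 0 < Gamma.
Local Notation TR := (measurableTypeR R).
Local Notation V := (borel_mx R n.+1 1).
Local Notation CV := 'cV[R]_n.+1.
Local Notation gauss := (normal_prob (0 : R) 1).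
Implicit Types (z : CV) (gamma mu : probability V R).

(** At z = 0 the Haar scale is [Gamma / 0 = 0], so the field leaves the sphere there; this happens
    on a null set. *)
Definition field_scale (haar : bool) z : R :=
  if haar then Gamma / (\sum_i z i ord0 ^+ 2) else Gamma / n.+1%:R.

Definition field (haar : bool) z : CV := Num.sqrt (field_scale haar z) *: z.

Lemma field_scale_ge0 haar z : 0 <= field_scale haar z.
Proof.
rewrite /field_scale; case: haar; last by rewrite divr_ge0// ltW.
apply: divr_ge0; first exact: ltW.
by apply: sumr_ge0 => i _; exact: sqr_ge0.
Qed.

Lemma field_sqr haar z i : field haar z i ord0 ^+ 2 = field_scale haar z * z i ord0 ^+ 2.
Proof. by rewrite /field mxE exprMn sqr_sqrtr// field_scale_ge0. Qed.

Let norm_mul U z : orthogonal U ->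
  \sum_i (U *m z) i ord0 ^+ 2 = \sum_i z i ord0 ^+ 2.
Proof. by move=> oU; rewrite !sqr_sumE sqr_sum_orthogonal. Qed.

Lemma field_mul haar U z : orthogonal U -> field haar (U *m z) = U *m field haar z.
Proof. by move=> oU; rewrite /field /field_scale norm_mul// -scalemxAr. Qed.

Lemma measurable_field haar : measurable_fun setT (field haar : V -> V).
Proof.
apply: measurable_mx => i j; rewrite (ord1 j).
rewrite (_ : (fun z : V => _) = (fun z : V => Num.sqrt (field_scale haar (z : CV)) * (z : CV) i ord0)); last first.
  by apply/funext => z; rewrite mxE.
apply: measurable_funM; last exact: measurable_coord.
apply: (@measurableT_comp _ _ _ _ _ _ (@Num.sqrt R) _ (fun z : V => field_scale haar (z : CV))).
  exact: continuous_measurable_fun (@sqrt_continuous R).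
rewrite /field_scale; case: haar; last exact: measurable_cst.
apply: measurable_funM; first exact: measurable_cst.
rewrite (_ : (fun z => _) = (fun z : V => (\sum_i (z : CV) i ord0 ^+ 2) `^ (-1))); last first.
  by apply/funext => z; rewrite powR_inv1// sumr_ge0// => k _; exact: sqr_ge0.
apply: (@measurableT_comp _ _ _ _ _ _ (@powR R ^~ (-1)) _ (fun z : V => \sum_i (z : CV) i ord0 ^+ 2)).
  exact: measurable_powR.
apply: measurable_sum => k; apply: measurable_funX; exact: measurable_coord.
Qed.

Let gauss_point (x : R) : gauss [set x] = 0%E.
Proof.
rewrite /normal_prob; apply: null_set_integral => //.
- by apply: measurable_funTS; apply/measurable_EFinP; exact: measurable_normal_pdf.
- exact: lebesgue_measure_set1.
Qed.

Let gauss_law_zero gamma : gauss_law gamma -> gamma [set z | \sum_i (z : CV) i ord0 ^+ 2 = 0] = 0%E.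
Proof.
move=> gE; pose B (i : 'I_n.+1) : set TR := [set 0].
have mB i : measurable (B i) by exact: measurable_set1.
have -> : [set z : V | \sum_i (z : CV) i ord0 ^+ 2 = 0] = rect B.
  apply/seteqP; split => z /= h.
    move=> i; rewrite /B/=; have /eqP := h; rewrite psumr_eq0 => [/allP h'|k _]; last exact: sqr_ge0.
    by have := h' i (mem_index_enum i); rewrite /= sqrf_eq0 => /eqP.
  by apply: big1 => i _; rewrite h expr0n.
apply: etrans (gE B mB) _; rewrite big_ord_recl.
by apply: etrans (congr1 (mule ^~ _) (gauss_point 0)) _; rewrite mul0e.
Qed.

(** Normalisation commutes with orthogonal maps, so the invariance of the Gaussian law is
    inherited. *)
Lemma haar_field gamma : gauss_law gamma ->
  haar_sphere (Num.sqrt Gamma) (push_prob gamma (measurable_field true)).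
Proof.
move=> gE; split.
  have mS : measurable (~` (sphere n.+1 (Num.sqrt Gamma) : set V)).
    by apply: measurableC; exact: measurable_sphere.
  apply: etrans (push_probE _ _ _) _; apply: (subset_measure0 _ _ _ (gauss_law_zero gE)).
  - exact: (measurable_preim (measurable_field true) mS).
  - rewrite (_ : [set z | _] = (fun z : V => \sum_i (z : CV) i ord0 ^+ 2 : TR) @^-1` [set 0])//.
    apply: measurable_preim; last exact: measurable_set1.
    by apply: measurable_sum => k; apply: measurable_funX; exact: measurable_coord.
  move=> z /= nS; apply: contrapT => /eqP s0; apply: nS.
  rewrite /sphere/= /euclidean_norm; congr Num.sqrt.
  under eq_bigr do rewrite field_sqr.
  by rewrite -mulr_sumr /field_scale divfK.
move=> U oU B mB.
have mFB : measurable ((field true : V -> V) @^-1` B) := measurable_preim (measurable_field true) mB.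
apply: etrans (push_probE _ _ _) _; apply: etrans (orthogonal_preserves oU gE mFB).
by congr (gamma _); apply/seteqP; split => z /=; rewrite field_mul.
Qed.

Section diagonalised.
Variables (U W : 'M[R]_n.+1) (lam : 'I_n.+1 -> R).
Hypotheses (oU : orthogonal U) (dU : U^T *m W *m U = diag lam).

Let measurable_slice A : measurable_fun setT (fun y : V => max_quad (A : 'M[R]_n.+1) (y : CV) : TR).
Proof.
exact: (measurableT_comp (@measurable_max_quad R n) (@pair1_measurable _ _ (borel_mx R n.+1 n.+1) V A)).
Qed.

Lemma haar_max_quad mu gamma (B : set TR) :
  haar_sphere (Num.sqrt Gamma) mu -> gauss_law gamma -> measurable B ->
  mu [set y | B (max_quad W (y : CV))] = gamma [set z | B (max_quad (diag lam) (field true z))].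
Proof.
move=> hmu gE mB.
have mC A : measurable ([set y | B (max_quad (A : 'M[R]_n.+1) (y : CV))] : set V).
  exact: measurable_preim (measurable_slice A) mB.
rewrite -(hmu.2 U oU _ (mC W)) (_ : [set x : CV | _] = [set y | B (max_quad (diag lam) (y : CV))]).
  exact: etrans (haar_sphere_unique hmu (haar_field gE) (mC (diag lam))) (push_probE _ _ _).
by apply/seteqP; split => y /=; rewrite max_quad_rotate// dU.
Qed.

(** The matrix [A] of the definition is known through A A^T only. As the covariance is scalar, A / s
    is orthogonal, and it is absorbed together with the diagonalising [U] into one orthogonal matrix
    [Q], which preserves the Gaussian law. *)
Lemma normal_max_quad mu : centered_normal ((Gamma / n.+1%:R)%:M) mu ->
  exists2 gamma, gauss_law gamma & forall B : set TR, measurable B ->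
  mu [set y | B (max_quad W (y : CV))] = gamma [set z | B (max_quad (diag lam) (field false z))].
Proof.
move=> [A [gamma [AA gE muE]]]; exists gamma; first exact: gE.
move=> B mB; pose s := Num.sqrt (Gamma / n.+1%:R).
have G0 : 0 < Gamma / n.+1%:R by rewrite divr_gt0.
have s0 : s != 0 by rewrite gt_eqF// sqrtr_gt0.
have ss : s * s = Gamma / n.+1%:R by rewrite -expr2 sqr_sqrtr// ltW.
pose Q := U^T *m (s^-1 *: A).
have oQ : orthogonal Q.
  apply: orthogonal_mul; first exact: orthogonal_tr.
  apply: mulmx1C; rewrite linearZ/= -scalemxAl -scalemxAr AA scalerA -mul_scalar_mx -scalar_mxM -ss.
  by rewrite -invfM mulVf// mulf_neq0.
have mC K : measurable ([set y | B (max_quad (K : 'M[R]_n.+1) (y : CV))] : set V).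
  exact: measurable_preim (measurable_slice K) mB.
have mD : measurable ([set z | B (max_quad (diag lam) (field false z))] : set V).
  exact: (measurable_preim (measurable_field false) (mC (diag lam))).
rewrite (muE _ (mC W)) -[RHS](orthogonal_preserves oQ gE mD); congr (gamma _).
have UQ : U *m Q = s^-1 *: A by rewrite /Q mulmxA (mulmx1C oU) mul1mx.
have key z : max_quad (diag lam) (field false (Q *m z)) = max_quad W (A *m z).
  rewrite field_mul// -dU -max_quad_rotate// mulmxA UQ; congr (max_quad W _).
  by rewrite [field _ _]/(s *: z) -scalemxAr -scalemxAl scalerA mulfV// scale1r.
by apply/seteqP; split => z /=; rewrite key.
Qed.

End diagonalised.
End random_fields.

(** * Large deviations of the ground state energy *)

Section ground_state.
Context {R : realType} (lamm lamp Gamma : R) (E : (R -> R) -> R) (haar : bool).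
Hypothesis lam_le : lamm <= lamp.
Hypothesis Gamma_gt0 : 0 < Gamma.
Hypothesis mE : mean_on lamm lamp E.
Local Notation TR := (measurableTypeR R).
Variables (lam l : forall n, 'I_n.+1 -> R) (gamma : forall n, probability (borel_mx R n.+1 1) R).
Arguments lam : clear implicits.
Arguments l : clear implicits.
Arguments gamma : clear implicits.
Hypothesis pl : profile lamm lamp E l.
Hypothesis lam_l : forall d, 0 < d -> \forall n \near \oo, forall i, `|lam n i - l n i| <= d.
Hypothesis gammaE : forall n, gauss_law (gamma n).
Local Notation tint := (tint lamm lamp E).
Local Notation hcost := (hcost lamm lamp E).
Local Notation resolv := (resolv lamm lamp).
Local Notation Fnice := (Fnice lamm lamp Gamma E).
Local Notation Gfun := (Gfun lamm lamp Gamma E).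
Local Notation level := (level lamm lamp E).
Local Notation Fmax := (Fmax lamm lamp Gamma E).
Local Notation Fmin := (Fmin lamm lamp Gamma E).
Local Notation slack := (slack Gamma).
Local Notation dual_up := (dual_up lamm lamp Gamma haar).
Local Notation dual_dn := (dual_dn lamm lamp Gamma haar).
Local Notation dual_thr := (dual_thr Gamma haar).
Local Notation fscale := (field_scale Gamma haar).
Local Notation fld := (field Gamma haar).

Definition ground n (z : 'cV[R]_n.+1) := max_quad (diag (lam n)) (fld z).

Let groundl n (z : 'cV[R]_n.+1) := max_quad (diag (l n)) (fld z).

Let S n f (z : 'cV[R]_n.+1) := \sum_i f (l n i) * z i ord0 ^+ 2.

Let T n (z : 'cV[R]_n.+1) := \sum_i z i ord0 ^+ 2.

Let N0 n : 0 < n.+1%:R :> R.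
Proof. exact: ltr0Sn. Qed.

Let T_ge0 n (z : 'cV[R]_n.+1) : 0 <= T z.
Proof. by apply: sumr_ge0 => i _; exact: sqr_ge0. Qed.

Let dual_field n (z : 'cV[R]_n.+1) theta : lamp < theta ->
  dual_fun (l n) (fld z) theta = theta + fscale z * S (resolv theta) z.
Proof.
move=> lt; rewrite /dual_fun mulr_sumr; congr (_ + _); apply: eq_bigr => i _.
case: (pl) => lK _ _ _; rewrite field_sqr// resolvE//.
by rewrite -mulrA; congr (_ * _); exact: mulrC.
Qed.

Let slow_field n (z : 'cV[R]_n.+1) : slow lamp (dual_fun (l n) (fld z)).
Proof. by apply: slow_dual_fun => i; case: (pl) => lK _ _ _; case/andP: (lK n i). Qed.

Let groundlE n (z : 'cV[R]_n.+1) : groundl z = half_inf lamp (dual_fun (l n) (fld z)).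
Proof.
case: (pl) => lK l0 _ _; apply: max_quad_dual => //.
by move=> i; case/andP: (lK n i).
Qed.

Let S_up n v theta (z : 'cV[R]_n.+1) :
  S (dual_up v theta) z = S (resolv theta) z - (if haar then slack v theta else 0) * T z.
Proof. by rewrite /S /T mulr_sumr -sumrB; apply: eq_bigr => i _; rewrite mulrBl. Qed.

Let S_dn n v theta (z : 'cV[R]_n.+1) : S (dual_dn v theta) z = - S (dual_up v theta) z.
Proof.
by rewrite /S -sumrN; apply: eq_bigr => i _; rewrite /dual_dn /dual_up -mulNr opprB.
Qed.

Let S_null n f (z : 'cV[R]_n.+1) : T z = 0 -> S f z = 0.
Proof.
move=> /eqP; rewrite psumr_eq0 => [/allP h|i _]; last exact: sqr_ge0.
by apply: big1 => i _; have /eqP -> := h i (mem_index_enum i); rewrite mulr0.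
Qed.

Let scale_le (G N s x v th : R) : 0 < G -> 0 < N -> G * s = v - th ->
  v <= th + G / N * x -> N * s <= x.
Proof.
move=> G0 N0' sE h; rewrite -(ler_pM2l G0) mulrCA sE -ler_pdivlMl//.
by rewrite lerBlDl mulrCA mulrA.
Qed.

Let scale_ge (G N s x v th : R) : 0 < G -> 0 < N -> G * s = v - th ->
  th + G / N * x <= v -> x <= N * s.
Proof.
move=> G0 N0' sE h; rewrite -(ler_pM2l G0) mulrCA sE -ler_pdivrMl//.
by rewrite lerBrDl mulrCA mulrA.
Qed.

(** An inequality on the dual function at one [theta] becomes a half-space for a quadratic form. In
    the Haar case it is multiplied by |z|^2; both sides vanish at z = 0. *)
Let up_incl n v theta (z : 'cV[R]_n.+1) : 2 * v <= theta + fscale z * S (resolv theta) z ->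
  n.+1%:R * dual_thr v theta <= S (dual_up v theta) z.
Proof.
rewrite S_up /dual_thr /field_scale -/(T z).
have sE : Gamma * slack v theta = 2 * v - theta := slackE Gamma_gt0 v theta.
case: (haar) => h; last by rewrite mul0r subr0; exact: scale_le sE h.
have := T_ge0 z; rewrite le_eqVlt => /orP[/eqP T0|T0].
  by rewrite S_null -T0// !mulr0 subr0.
by rewrite mulr0 subr_ge0 mulrC; exact: scale_le sE h.
Qed.

Let dn_incl n v theta (z : 'cV[R]_n.+1) : theta + fscale z * S (resolv theta) z <= 2 * v ->
  n.+1%:R * - dual_thr v theta <= S (dual_dn v theta) z.
Proof.
rewrite mulrN S_dn lerN2 S_up /dual_thr /field_scale -/(T z).
have sE : Gamma * slack v theta = 2 * v - theta := slackE Gamma_gt0 v theta.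
case: (haar) => h; last by rewrite mul0r subr0; exact: scale_ge sE h.
have := T_ge0 z; rewrite le_eqVlt => /orP[/eqP T0|T0].
  by rewrite S_null -T0// !mulr0 subr0.
by rewrite mulr0 subr_le0 mulrC; exact: scale_ge sE h.
Qed.

Let measurable_ground n : measurable_fun setT (fun z : borel_mx R n.+1 1 => ground (z : 'cV[R]_n.+1) : TR).
Proof.
have h : measurable_fun setT (fun y : borel_mx R n.+1 1 => max_quad (diag (lam n)) (y : 'cV[R]_n.+1) : TR).
  exact: (measurableT_comp (@measurable_max_quad R n)
    (@pair1_measurable _ _ (borel_mx R n.+1 n.+1) (borel_mx R n.+1 1) (diag (lam n)))).
have mf : measurable_fun setT (fld : borel_mx R n.+1 1 -> borel_mx R n.+1 1).
  exact: measurable_field.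
exact: (measurableT_comp h mf).
Qed.

Let ground_close d : 0 < d -> \forall n \near \oo, forall z : 'cV[R]_n.+1,
  ground z <= groundl z + d /\ groundl z <= ground z + d.
Proof.
move=> d0; apply: filterS (lam_l d0) => n h z; split; apply: max_quad_perturb => //.
by move=> i; rewrite distrC.
Qed.

Let half_line_ge v : measurable ([set x : TR | (v <= (x : R))%R]).
Proof.
rewrite (_ : [set x | _] = `[v, +oo[%classic); first exact: measurable_itv.
by apply/seteqP; split => x /=; rewrite in_itv/= andbT.
Qed.

Let half_line_le v : measurable ([set x : TR | ((x : R) <= v)%R]).
Proof.
rewrite (_ : [set x | _] = `]-oo, v]%classic); first exact: measurable_itv.
by apply/seteqP; split => x /=; rewrite in_itv.
Qed.

(** A large infimum makes the dual function large at every [theta], in particular at the one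
    provided by minimax, so a single half-space contains the event. *)
Lemma ground_upper_tail a' a v : 0 <= a' -> a' < a -> Fmax haar a < v ->
  \forall n \near \oo, (gamma n [set z | (v <= ground (z : 'cV[R]_n.+1))%R] <= (expR (- (n.+1%:R * a')))%:E)%E.
Proof.
move=> a0 aa' lv; pose u := Fmax haar a; pose v' := (u + v) / 2; pose d := (v - u) / 2.
have d0 : 0 < d by rewrite /d /u; lra.
have uv' : u < v' by rewrite /v' /u; lra.
have a0' : 0 <= a by lra.
have [theta [s [lt s0 bw hs]]] := @dual_upper R lamm lamp Gamma E lam_le Gamma_gt0 mE haar a' a u v'
  a0 aa' uv' (fun t => @Fnice_le_max R lamm lamp Gamma E lam_le Gamma_gt0 mE haar a t a0').
have bu : bcont (dual_up v' theta) by exact: bcont_dual_up.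
have H := quad_form_upper pl gammaE bu s0 bw hs.
near=> n.
apply: (@le_trans _ _ (gamma n [set z | (n.+1%:R * dual_thr v' theta <= S (dual_up v' theta) (z : 'cV[R]_n.+1))%R])); last first.
  by near: n; exact: H.
apply: le_measure; rewrite ?inE.
- exact: (measurable_preim (@measurable_ground n) (half_line_ge v)).
- exact: measurable_quad_ge.
move=> z /= vz; apply: up_incl; rewrite -dual_field//.
have [h1 _] : ground z <= groundl z + d /\ groundl z <= ground z + d.
  by move: z {vz}; near: n; exact: ground_close.
apply: le_trans (half_inf_le (slow_field z) lt); rewrite -groundlE.
have : v <= groundl z + d by exact: le_trans h1.
by rewrite /d /v' => h2; lra.
Unshelve. all: by end_near. Qed.

Let grid_exists (w d : R) : 0 < d -> exists n0 : nat, (0 < n0)%N /\ w <= lamp + d * n0%:R.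
Proof.
move=> d0; exists (Num.truncn `|(w - lamp) / d|).+1; split => //.
rewrite -lerBlDl mulrC -ler_pdivrMr// (le_trans (ler_norm _))// ltW//.
exact: truncnS_gt.
Qed.

(** A small infimum makes the dual function small at some node of a grid that does not depend on
    [n]. The number of nodes in the union bound is absorbed by the gap between [a'] and [a1]. *)
Lemma ground_lower_tail a' a v : 0 <= a' -> a' < a -> v < Fmin haar a ->
  \forall n \near \oo, (gamma n [set z | (ground (z : 'cV[R]_n.+1) <= v)%R] <= (expR (- (n.+1%:R * a')))%:E)%E.
Proof.
move=> a0 aa' lv; pose u := Fmin haar a; pose d := (u - v) / 4; pose v2 := v + 3 * d.
have d0 : 0 < d by rewrite /d /u; lra.
have uv2 : v2 < u by rewrite /v2 /d /u; lra.
have a0' : 0 <= a by lra.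
pose a1 := (a' + a) / 2.
have a1a : a1 < a by rewrite /a1; lra.
have a1' : a' < a1 by rewrite /a1; lra.
have a10 : 0 <= a1 by lra.
have [n0 [n00 wn0]] := grid_exists (2 * v2) d0.
pose th (k : nat) := lamp + d * k.+1%:R.
have th_gt k : lamp < th k by rewrite ltrDl mulr_gt0.
have H : \forall n \near \oo, forall k : 'I_n0,
   (gamma n [set z | (n.+1%:R * - dual_thr v2 (th k) <= S (dual_dn v2 (th k)) (z : 'cV[R]_n.+1))%R]
     <= (expR (- (n.+1%:R * a1)))%:E)%E.
  apply: filter_forall => k.
  have [s [s0 bw hs]] := @dual_lower R lamm lamp Gamma E lam_le Gamma_gt0 mE haar a1 a u v2 (th k)
    a10 a1a uv2 (fun t => @Fnice_ge_min R lamm lamp Gamma E lam_le Gamma_gt0 mE haar a t a0') (th_gt k).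
  have bd : bcont (dual_dn v2 (th k)) by exact: bcont_dual_dn.
  have H := quad_form_upper pl gammaE bd s0 bw hs.
  by apply: filterS H => n.
near=> n.
pose B (k : 'I_n0) : set (borel_mx R n.+1 1) :=
  [set z | n.+1%:R * - dual_thr v2 (th k) <= S (dual_dn v2 (th k)) (z : 'cV[R]_n.+1)].
have mB k : measurable (B k) by exact: measurable_quad_ge.
apply: (@le_trans _ _ (gamma n (\big[setU/set0]_(k : 'I_n0) B k))).
  apply: le_measure; rewrite ?inE.
  - exact: (measurable_preim (@measurable_ground n) (half_line_le v)).
  - exact: bigsetU_measurable.
  move=> z /= vz.
  have [_ h1] : ground z <= groundl z + d /\ groundl z <= ground z + d.
    by move: z {vz}; near: n; exact: ground_close.
  have lt1 : 2 * groundl z < 2 * v2 - d by rewrite /v2; lra.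
  have [k kn hk] : exists2 k, (k < n0)%N & dual_fun (l n) (fld z) (th k) < 2 * v2.
    apply: contrapT => nk.
    have : 2 * v2 - d <= 2 * half_inf lamp (dual_fun (l n) (fld z)).
      apply: (half_inf_grid (slow_field z) d0 wn0) => k kn; rewrite leNgt; apply/negP => h.
      by apply: nk; exists k.
    by rewrite -groundlE leNgt lt1.
  rewrite -bigcup_seq; exists (Ordinal kn) => /=; first by rewrite mem_index_enum.
  by apply: dn_incl; rewrite -dual_field//; exact: ltW.
apply: le_trans (measure_bigsetU_le _ _ mB) _.
apply: (@le_trans _ _ (\sum_(k : 'I_n0) (expR (- (n.+1%:R * a1)))%:E)%E).
  have Hn : forall k : 'I_n0,
    (gamma n [set z | (n.+1%:R * - dual_thr v2 (th k) <= S (dual_dn v2 (th k)) (z : 'cV[R]_n.+1))%R]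
     <= (expR (- (n.+1%:R * a1)))%:E)%E by near: n; exact: H.
  by apply: lee_sum => k _; exact: Hn.
rewrite sumEFin lee_fin sumr_const card_ord -[leLHS]mulr_natl.
have -> : - (n.+1%:R * a') = n.+1%:R * (a1 - a') + - (n.+1%:R * a1) by ring.
rewrite expRD ler_wpM2r ?expR_ge0//; apply: le_trans (expR_ge1Dx _).
have nn : n0%:R / (a1 - a') <= n%:R by near: n; exact: nbhs_infty_ger.
have : n0%:R <= n.+1%:R * (a1 - a').
  by rewrite -ler_pdivrMr ?subr_gt0// (le_trans nn)// ler_nat.
by move=> h; rewrite (le_trans h)// lerDr.
Unshelve. all: by end_near. Qed.

(** With the three estimates that follow: if X / N is within [d] of [tau] and, in the Haar case, Y /
    N within [d] of 1, then Gamma X / Y, resp. Gamma X / N, is within [e] of Gamma tau, each lemma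
    giving one side. [B] bounds 1 + tau for all the values used at once. *)
Let ratio_le (N X Y tau d e B : R) : 0 < N -> 0 < d -> 0 <= tau -> 1 + tau <= B -> 0 < e ->
  d <= 1 / 2 -> d * (Gamma * B + e) <= e -> X < N * (tau + d) -> N * (1 - d) < Y ->
  Gamma / Y * X <= Gamma * tau + e.
Proof.
move=> N0' d0 t0 tB e0 d2 hd hX hY.
have Nd : 0 < N * (1 - d) by rewrite mulr_gt0//; lra.
have Y0 : 0 < Y by exact: lt_trans hY.
rewrite mulrAC ler_pdivrMr//.
have G0 := Gamma_gt0.
have k0 : 0 <= Gamma * tau + e by apply: addr_ge0; [apply: mulr_ge0 => //; exact: ltW|exact: ltW].
apply: (@le_trans _ _ ((Gamma * tau + e) * (N * (1 - d)))); last by rewrite ler_wpM2l// ltW.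
apply: (@le_trans _ _ (Gamma * (N * (tau + d)))); first by rewrite ler_wpM2l// ltW.
have -> : Gamma * (N * (tau + d)) = N * (Gamma * (tau + d)) by ring.
have -> : (Gamma * tau + e) * (N * (1 - d)) = N * ((Gamma * tau + e) * (1 - d)) by ring.
rewrite ler_pM2l//.
have h : d * (Gamma * (1 + tau)) <= d * (Gamma * B).
  by rewrite ler_pM2l// ler_wpM2l// ltW.
have -> : (Gamma * tau + e) * (1 - d) = Gamma * tau + e - d * (Gamma * tau) - d * e by ring.
have -> : Gamma * (tau + d) = Gamma * tau + d * (Gamma * (1 + tau)) - d * (Gamma * tau) by ring.
by rewrite mulrDr in hd; lra.
Qed.

Let ratio_ge (N X Y tau d e B : R) : 0 < N -> 0 < d -> 0 <= tau -> 1 + tau <= B -> 0 < e ->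
  d * (Gamma * B + e) <= e -> 0 <= X -> N * (tau - d) < X -> 0 < Y -> Y < N * (1 + d) ->
  Gamma * tau - e <= Gamma / Y * X.
Proof.
move=> N0' d0 t0 tB e0 hd X0 hX Y0 hY; have G0 := Gamma_gt0.
rewrite mulrAC ler_pdivlMr//.
have [k0|k0] := leP (Gamma * tau - e) 0.
  apply: (@le_trans _ _ 0); first by rewrite mulr_le0_ge0// ltW.
  by rewrite mulr_ge0// ltW.
apply: (@le_trans _ _ ((Gamma * tau - e) * (N * (1 + d)))); first by rewrite ler_wpM2l// ltW.
apply: (@le_trans _ _ (Gamma * (N * (tau - d)))); last by rewrite ler_wpM2l// ltW.
have -> : Gamma * (N * (tau - d)) = N * (Gamma * (tau - d)) by ring.
have -> : (Gamma * tau - e) * (N * (1 + d)) = N * ((Gamma * tau - e) * (1 + d)) by ring.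
rewrite ler_pM2l//.
have h : d * (Gamma * (1 + tau)) <= d * (Gamma * B).
  by rewrite ler_pM2l// ler_wpM2l// ltW.
have de : 0 < d * e by rewrite mulr_gt0.
have -> : (Gamma * tau - e) * (1 + d) = Gamma * tau - e + d * (Gamma * tau) - d * e by ring.
have -> : Gamma * (tau - d) = Gamma * tau - d * (Gamma * (1 + tau)) + d * (Gamma * tau) by ring.
by rewrite mulrDr in hd; lra.
Qed.

Let ratio_le_cst (N X tau d e B : R) : 0 < N -> 0 < d -> 0 <= tau -> 1 + tau <= B -> 0 < e ->
  d * (Gamma * B + e) <= e -> X < N * (tau + d) -> Gamma / N * X <= Gamma * tau + e.
Proof.
move=> N0' d0 t0 tB e0 hd hX; have G0 := Gamma_gt0.
rewrite mulrAC ler_pdivrMr//.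
apply: (@le_trans _ _ (Gamma * (N * (tau + d)))); first by rewrite ler_wpM2l// ltW.
have -> : Gamma * (N * (tau + d)) = (Gamma * tau + d * Gamma) * N by ring.
rewrite ler_pM2r//.
have h : d * (Gamma * 1) <= d * (Gamma * B) by rewrite ler_pM2l// ler_pM2l//; lra.
have de : 0 < d * e by rewrite mulr_gt0.
by rewrite mulrDr in hd; rewrite mulr1 in h; lra.
Qed.

Let ratio_ge_cst (N X tau d e B : R) : 0 < N -> 0 < d -> 0 <= tau -> 1 + tau <= B -> 0 < e ->
  d * (Gamma * B + e) <= e -> N * (tau - d) < X -> Gamma * tau - e <= Gamma / N * X.
Proof.
move=> N0' d0 t0 tB e0 hd hX; have G0 := Gamma_gt0.
rewrite mulrAC ler_pdivlMr//.
apply: (@le_trans _ _ (Gamma * (N * (tau - d)))); last by rewrite ler_wpM2l// ltW.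
have -> : Gamma * (N * (tau - d)) = (Gamma * tau - d * Gamma) * N by ring.
rewrite ler_pM2r//.
have h : d * (Gamma * 1) <= d * (Gamma * B) by rewrite ler_pM2l// ler_pM2l//; lra.
have de : 0 < d * e by rewrite mulr_gt0.
by rewrite mulrDr in hd; rewrite mulr1 in h; lra.
Qed.

Let S_opp n f (z : 'cV[R]_n.+1) : S (fun x => - f x) z = - S f z.
Proof. by rewrite /S -sumrN; apply: eq_bigr => i _; rewrite mulNr. Qed.

Let S_one n (z : 'cV[R]_n.+1) : S (fun=> 1) z = T z.
Proof. by apply: eq_bigr => i _; rewrite mul1r. Qed.

(** Finitely many quadratic forms pin the value: a nearly optimal [theta] from above, a grid from
    below. Since [quad_form_lower] controls upper deviations only, lower ones are expressed by
    negated functions; the constants 1 and -1 control |z|^2 for the Haar normalisation. *)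
Let near_level t m e : valid t -> (haar -> tint t (fun=> 1) = 1) -> Fnice t = m -> 0 < e ->
  exists (K : finType) (f : K -> R -> R) (d : R), [/\ forall k, bcont (f k), 0 < d &
    forall n (z : 'cV[R]_n.+1), (forall k, S (f k) z < n.+1%:R * (tint t (f k) + d)) ->
      m - e <= groundl z <= m + e].
Proof.
move=> vt mass Ft e0.
have [ts lts Gts] : exists2 u, lamp < u & Gfun t u < 2 * m + e.
  by apply: half_inf_lt; rewrite -Ft -/(Fnice t); lra.
have [n0 [n00 wn0]] := grid_exists (2 * m - e) e0.
pose th (k : nat) := lamp + e * k.+1%:R.
have th_gt k : lamp < th k by rewrite ltrDl mulr_gt0.
have bR u : lamp < u -> bcont (resolv u) by move=> lu; have [] := bpos_resolv lam_le lu.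
pose tau u := tint t (resolv u).
have tau0 u : lamp < u -> 0 <= tau u.
  move=> lu; apply: (tint_ge0 lam_le mE vt (bR u lu)) => x _.
  by rewrite ltW// resolv_gt0.
pose B := 1 + tau ts + \sum_(k < n0) tau (th k).
have sum0 : 0 <= \sum_(k < n0) tau (th k) by apply: sumr_ge0 => k _; exact: tau0.
have Bs : 1 + tau ts <= B by rewrite /B lerDl.
have Bk (k : 'I_n0) : 1 + tau (th k) <= B.
  rewrite /B (bigD1 k)//= -addrA lerD2l.
  have : 0 <= \sum_(i < n0 | i != k) tau (th i) by apply: sumr_ge0 => i _; exact: tau0.
  by have := tau0 _ lts => h1 h2; lra.
have B0 : 0 < B by have := tau0 _ lts => h; lra.
pose D := Gamma * B + e.
have D0 : 0 < D by rewrite addr_gt0// mulr_gt0.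
pose d := Num.min (1 / 2) (e / D).
have d0 : 0 < d by rewrite lt_min divr_gt0//= divr_gt0.
have d2 : d <= 1 / 2 by rewrite ge_min lexx.
have dD : d * (Gamma * B + e) <= e by rewrite -ler_pdivlMr// ge_min lexx orbT.
pose f (k : option (option (option 'I_n0))) : R -> R := match k with
  | None => resolv ts | Some None => fun=> 1 | Some (Some None) => fun=> - 1
  | Some (Some (Some k)) => fun x => - resolv (th k) x end.
exists (option (option (option 'I_n0))), f, d; split => //.
  move=> [[[k|]|]|] /=; [apply: bcontN; exact: bR|exact: bcont_cst|exact: bcont_cst|exact: bR].
move=> n z H.
have Ss : S (resolv ts) z < n.+1%:R * (tau ts + d) := H None.
have T1 : T z < n.+1%:R * (tint t (fun=> 1) + d) by have := H (Some None); rewrite /f S_one.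
have T2 : n.+1%:R * (tint t (fun=> 1) - d) < T z.
  have := H (Some (Some None)); rewrite /f S_opp S_one (tint_cst mE)// => h.
  by rewrite ltrNl in h; apply: le_lt_trans h; rewrite mulN1r -mulrN opprD opprK.
have Sk (k : 'I_n0) : n.+1%:R * (tau (th k) - d) < S (resolv (th k)) z.
  have := H (Some (Some (Some k))); rewrite /f S_opp (tintN mE)//; last exact: bR.
  by move=> h; rewrite ltrNl in h; apply: le_lt_trans h; rewrite -mulrN opprD opprK.
have Sk0 (k : 'I_n0) : 0 <= S (resolv (th k)) z.
  by apply: sumr_ge0 => i _; rewrite mulr_ge0 ?sqr_ge0// ltW// resolv_gt0.
have TN : haar -> n.+1%:R * (1 - d) < T z /\ T z < n.+1%:R * (1 + d).
  by move=> /mass h; rewrite h in T1 T2.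
have up : fscale z * S (resolv ts) z <= Gamma * tau ts + e.
  rewrite /field_scale -/(T z); case: (haar) TN => [/(_ isT)[TN1 TN2]|_].
    exact: (ratio_le (N0 n) d0 (tau0 _ lts) Bs e0 d2 dD Ss TN1).
  exact: (ratio_le_cst (N0 n) d0 (tau0 _ lts) Bs e0 dD Ss).
have dn (k : 'I_n0) : Gamma * tau (th k) - e <= fscale z * S (resolv (th k)) z.
  rewrite /field_scale -/(T z); case: (haar) TN => [/(_ isT)[TN1 TN2]|_].
    have TT : 0 < T z by apply: lt_trans TN1; rewrite mulr_gt0 ?N0//; lra.
    exact: (ratio_ge (N0 n) d0 (tau0 _ (th_gt k)) (Bk k) e0 dD (Sk0 k) (Sk k) TT TN2).
  exact: (ratio_ge_cst (N0 n) d0 (tau0 _ (th_gt k)) (Bk k) e0 dD (Sk k)).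
apply/andP; split.
  have : 2 * m - e - e <= 2 * half_inf lamp (dual_fun (l n) (fld z)).
    apply: (half_inf_grid (slow_field z) e0 wn0) => k kn.
    rewrite -/(th k) dual_field//.
    have := half_inf_le (slow_Gfun lam_le Gamma_gt0 mE vt) (th_gt k).
    rewrite -/(Fnice t) Ft /Gfun -/(tau _).
    by have := dn (Ordinal kn) => /= h1 h2; lra.
  by rewrite -groundlE => h; lra.
have := half_inf_le (slow_field z) lts; rewrite -groundlE dual_field//.
by move: Gts; rewrite /Gfun -/(tau _) => h1 h2; lra.
Qed.

(** A nice measure of cost below [2 * a'] realising [m] exactly is followed by the Gaussian vector,
    at a cost in probability below the prescribed rate. *)
Lemma ground_local a a' m e : 0 <= a -> a < a' -> Fmin haar a <= m <= Fmax haar a -> 0 < e ->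
  \forall n \near \oo, ((expR (- (n.+1%:R * a')))%:E <=
    gamma n [set z | (m - e < ground (z : 'cV[R]_n.+1) < m + e)%R])%E.
Proof.
move=> a0 aa' hm e0; pose a1 := (a + a') / 2.
have a1a : a < a1 by rewrite /a1; lra.
have a1' : a1 < a' by rewrite /a1; lra.
have [t [vt ht mass] Ft] := Fvalues_interval lam_le Gamma_gt0 mE a0 a1a hm.
have e4 : 0 < e / 4 by lra.
have [K [f [d [bf d0 Kin]]]] := near_level vt mass Ft e4.
have ha : hcost t < 2 * a' by lra.
have H := quad_form_lower mE pl gammaE vt bf d0 ha.
near=> n.
apply: (@le_trans _ _ (gamma n [set z | forall k, (S (f k) (z : 'cV[R]_n.+1) < n.+1%:R * (tint t (f k) + d))%R])).
  by near: n; exact: H.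
apply: le_measure; rewrite ?inE.
- have -> : [set z : borel_mx R n.+1 1 | forall k, S (f k) (z : 'cV[R]_n.+1) < n.+1%:R * (tint t (f k) + d)] =
      \bigcap_(k in [set: K]) ~` [set z | n.+1%:R * (tint t (f k) + d) <= S (f k) (z : 'cV[R]_n.+1)].
    apply/seteqP; split => z /= h k; first by move=> _ /=; apply/negP; rewrite -ltNge.
    by have := h k I => /= /negP; rewrite -ltNge.
  apply: fin_bigcap_measurable => // k _.
  by apply: measurableC; exact: measurable_quad_ge.
- have mI : measurable (`]m - e, m + e[%classic : set TR) by exact: measurable_itv.
  have := measurable_preim (@measurable_ground n) mI.
  by congr measurable; apply/seteqP; split => z /=; rewrite in_itv.
move=> z /= /Kin /andP[h1 h2].
have [h3 h4] : ground z <= groundl z + e / 4 /\ groundl z <= ground z + e / 4.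
  by move: z {h1 h2}; near: n; exact: ground_close.
by apply/andP; split; lra.
Unshelve. all: by end_near. Qed.

End ground_state.

(** * Large deviations for a fixed realisation and for conditional laws *)

Section conclusion.
Context {R : realType} (Gamma lamm lamp : R) (q : probability (measurableTypeR R) R).
Hypothesis Gamma_gt0 : 0 < Gamma.
Hypothesis cq : concentrated_on q `[lamm, lamp].
Local Notation TR := (measurableTypeR R).
Local Notation E := (mean q).

Let lam_le : lamm <= lamp := concentrated_le cq.
Let mE : mean_on lamm lamp E := mean_probability cq.

(** The deterministic statement. The Gaussian law may depend on the diagonalisation and on [n]: only
    one-dimensional marginal laws matter for large deviations, not their coupling across
    dimensions. *)
Lemma LDP_max_quad haar (W : forall n, 'M[R]_n.+1) (mu : nat -> {measure set TR -> \bar R}) :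
  spectral_class lamm lamp q W ->
  (forall n U lam, orthogonal U -> U^T *m W n *m U = diag lam ->
    exists2 gamma : probability (borel_mx R n.+1 1) R, gauss_law gamma &
    forall B : set TR, measurable B ->
      mu n B = gamma [set z | B (max_quad (diag lam) (field Gamma haar z))]) ->
  LDP_good (fun n => n.+1%:R) mu (rate haar lamm lamp Gamma q).
Proof.
move=> sW muE; have [U [lam [l [oU dU pl lam_l]]]] := spectral_profile cq sW.
pose gex n := muE n (U n) (lam n) (oU n) (dU n).
pose gamma n := projT1 (cid2 (gex n)).
have gammaE n : gauss_law (gamma n) by rewrite /gamma; case: cid2.
have muG n (B : set TR) : measurable B -> mu n B = gamma n [set z | B (ground Gamma haar lam z)].
  by rewrite /gamma; case: cid2 => g /= _; apply.
have mI (i : interval R) (A : set R) : A = [set` i] -> measurable (A : set TR).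
  by move=> ->; exact: measurable_itv.
have mge v : measurable ([set x | v <= x] : set TR).
  by apply: (mI `[v, +oo[); apply/seteqP; split => x /=; rewrite in_itv/= andbT.
have mle v : measurable ([set x | x <= v] : set TR).
  by apply: (mI `]-oo, v]); apply/seteqP; split => x /=; rewrite in_itv.
have moo a b : measurable ([set x | a < x < b] : set TR).
  by apply: (mI `]a, b[); apply/seteqP; split => x /=; rewrite in_itv.
apply: (@LDP_of_levels R mu _ (Fmin lamm lamp Gamma E haar) (Fmax lamm lamp Gamma E haar)).
- by move=> n; rewrite muG//; exact: (probability_le1 (gamma n) measurableT).
- by move=> m; exact: rate_ge0.
- move=> a a0; have lb : level lamm lamp E haar a base by exact: level_base.
  apply: le_trans (Fnice_le_max lam_le Gamma_gt0 mE a0 lb).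
  exact: Fnice_ge_min.
- move=> a a' m a0 aa' hm.
  have [t lt <-] := Fvalues_interval lam_le Gamma_gt0 mE a0 aa' hm.
  exact: rate_le.
- by move=> a a' m a0 aa'; exact: rate_bounds.
- move=> a' a v a0 aa' lv.
  have H := ground_upper_tail lam_le Gamma_gt0 mE pl lam_l gammaE a0 aa' lv.
  by apply: filterS H => n; rewrite muG.
- move=> a' a v a0 aa' lv.
  have H := ground_lower_tail lam_le Gamma_gt0 mE pl lam_l gammaE a0 aa' lv.
  by apply: filterS H => n; rewrite muG.
- move=> a a' m e a0 aa' hm e0.
  have H := ground_local lam_le Gamma_gt0 mE pl lam_l gammaE a0 aa' hm e0.
  by apply: filterS H => n; rewrite muG.
Qed.

(** Outside of one null set, common to all dimensions, the kernels are the image laws at the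
    realised matrices and these matrices are in the spectral class; the deterministic statement
    applies there. *)
Lemma LDP_conditional haar d (Omega : measurableType d) (P : probability Omega R)
    (W : forall n : nat, {RV P >-> borel_mx R n.+1 n.+1})
    (h : forall n : nat, {RV P >-> borel_mx R n.+1 1}) :
  {ae P, forall w, spectral_class lamm lamp q (fun n => W n w)} ->
  (forall n, independent_RVs (W n) (h n)) ->
  (forall n (A U : 'M[R]_n.+1) lam, orthogonal U -> U^T *m A *m U = diag lam ->
    exists2 gamma : probability (borel_mx R n.+1 1) R, gauss_law gamma &
    forall B : set TR, measurable B ->
      distribution P (h n) [set y | B (max_quad A (y : 'cV[R]_n.+1))] =
      gamma [set z | B (max_quad (diag lam) (field Gamma haar z))]) ->
  forall kappa : forall n : nat, R.-pker (borel_mx R n.+1 n.+1) ~> TR,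
  (forall n, conditional_law (W n) (fun w => max_quad (W n w) (h n w) : TR) (kappa n)) ->
  {ae P, forall w, LDP_good (fun n => n.+1%:R) (fun n => kappa n (W n w))
    (rate haar lamm lamp Gamma q)}.
Proof.
move=> sW ind law kappa cl.
have ae_law : {ae P, forall w, forall n (B : set TR), measurable B -> kappa n (W n w) B =
    distribution P (h n) [set y | B (max_quad (W n w : 'M[R]_n.+1) (y : 'cV[R]_n.+1))]}.
  apply/ae_foralln => n.
  exact: (conditional_law_independent (@measurable_max_quad R n) (ind n) (cl n)).
apply: filterS2 sW ae_law => w sw lw; apply: LDP_max_quad sw _ => n U lam oU dU.
have [gamma gE lawE] := law n _ U lam oU dU; exists gamma => // B mB.
exact: etrans (lw n B mB) (lawE B mB).
Qed.

End conclusion.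

Theorem corollary1p7 (R : realType) (Gamma lamm lamp : R)
    (q : probability (measurableTypeR R) R)
    (d : measure_display) (Omega : measurableType d) (P : probability Omega R)
    (W : forall n : nat, {RV P >-> borel_mx R n.+1 n.+1}) :
  0 < Gamma ->
  concentrated_on q `[lamm, lamp] ->
  {ae P, forall w, spectral_class lamm lamp q (fun n => W n w)} ->
  (forall h : forall n : nat, {RV P >-> borel_mx R n.+1 1},
     (forall n, independent_RVs (W n) (h n)) ->
     (forall n, haar_sphere (Num.sqrt Gamma) (distribution P (h n))) ->
     forall kappa : forall n : nat,
       R.-pker (borel_mx R n.+1 n.+1) ~> (measurableTypeR R),
     (forall n, conditional_law (W n)
        (fun w => max_quad (W n w) (h n w) : measurableTypeR R) (kappa n)) ->
     {ae P, forall w, LDP_good (fun n => n.+1%:R)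
        (fun n => kappa n (W n w)) (rate_H lamm lamp Gamma q)})
  /\
  (forall g : forall n : nat, {RV P >-> borel_mx R n.+1 1},
     (forall n, independent_RVs (W n) (g n)) ->
     (forall n, centered_normal ((Gamma / n.+1%:R)%:M) (distribution P (g n))) ->
     forall kappa : forall n : nat,
       R.-pker (borel_mx R n.+1 n.+1) ~> (measurableTypeR R),
     (forall n, conditional_law (W n)
        (fun w => max_quad (W n w) (g n w) : measurableTypeR R) (kappa n)) ->
     {ae P, forall w, LDP_good (fun n => n.+1%:R)
        (fun n => kappa n (W n w)) (rate_G lamm lamp Gamma q)}).
Proof.
move=> Gamma_gt0 cq sW; split=> h ind law kappa cl.
  apply: (@LDP_conditional R Gamma lamm lamp q Gamma_gt0 cq true d Omega P W h sW ind _ kappa cl).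
  move=> n A U lam oU dU; have [gamma gE] := @gauss_law_exists R n.+1.
  by exists gamma => // B mB; exact: (haar_max_quad Gamma_gt0 oU dU (law n) gE mB).
apply: (@LDP_conditional R Gamma lamm lamp q Gamma_gt0 cq false d Omega P W h sW ind _ kappa cl).
by move=> n A U lam oU dU; exact: (normal_max_quad Gamma_gt0 oU dU (law n)).
Qed.
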